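(* Let $n\geqslant 2$, let $D,D'\subset\mathbb{R}^n$ be domains, let $\delta>0$, let $A\subset D$ be a continuum, and let $Q:\mathbb{R}^n\to[0,\infty]$ be a Lebesgue measurable function with $Q(x)\in[1,\infty]$ for $x\in D$ and $Q(x)=0$ for $x\notin D$. Suppose that $D$ is locally connected at all of its boundary points, that $\overline{D}$ and $\overline{D'}$ are compact subsets of $\mathbb{R}^n$, and that $D'$ has a weakly flat boundary. Suppose also that every path-connected component of $\partial D'$ is a non-degenerate continuum. If $Q\in L^1(D)$, then each mapping $g\in\mathfrak{S}_{\delta,A,Q}(D,D')$ extends by continuity to a mapping $\overline{g}:\overline{D'}\to\overline{D}$ with $\overline{g}|_{D'}=g$; in addition, $\overline{g}(\overline{D'})=\overline{D}$, and the family $\mathfrak{S}_{\delta,A,Q}(\overline{D},\overline{D'})$ consisting of all the extended mappings $\overline{g}:\overline{D'}\to\overline{D}$, $g\in\mathfrak{S}_{\delta,A,Q}(D,D')$, is equicontinuous in $\overline{D'}$ (that is, equicontinuous at every point of $\overline{D'}$ with respect to the Euclidean metric).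
   Context: A domain is a nonempty open connected subset of $\mathbb{R}^n$; a continuum is a compact connected set, and it is non-degenerate if it is not a single point; $dm$ denotes Lebesgue measure in $\mathbb{R}^n$; $\mathrm{diam}$ is the Euclidean diameter. For a family $\Gamma$ of paths, a Borel function $\rho:\mathbb{R}^n\to[0,\infty]$ is called admissible, written $\rho\in\mathrm{adm}\,\Gamma$, if $\int_\gamma \rho(x)\,|dx|\geqslant 1$ for every (locally rectifiable) $\gamma\in\Gamma$. The modulus of $\Gamma$ is $M(\Gamma)=\inf_{\rho\in\mathrm{adm}\,\Gamma}\int_{\mathbb{R}^n}\rho^n(x)\,dm(x)$ (equal to $\infty$ if $\mathrm{adm}\,\Gamma=\varnothing$). For a mapping $f$, $f(\Gamma)=\{f\circ\gamma:\gamma\in\Gamma\}$. For sets $E,F\subset\overline{\mathbb{R}^n}=\mathbb{R}^n\cup\{\infty\}$ and a domain $G$, $\Gamma(E,F,G)$ denotes the family of all paths $\gamma:[a,b]\to\overline{\mathbb{R}^n}$ with $\gamma(a)\in E$, $\gamma(b)\in F$ and $\gamma(t)\in G$ for $t\in(a,b)$. A domain $G\subset\mathbb{R}^n$ is locally connected at $x_0\in\partial G$ if for every neighborhood $U$ of $x_0$ there is a neighborhood $V\subset U$ of $x_0$ such that $V\cap G$ is connected. The boundary of $G$ is weakly flat at $x_0\in\partial G$ if for every $P>0$ and every neighborhood $U$ of $x_0$ there is a neighborhood $V\subset U$ of $x_0$ such that $M(\Gamma(E,F,G))>P$ for all continua $E,F\subset G$ each of which intersects both $\partial U$ and $\partial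 V$. The boundary of $G$ is weakly flat if it is weakly flat at every point of $\partial G$. The family $\mathfrak{S}_{\delta,A,Q}(D,D')$ consists of all mappings $g:D'\to D$ such that $f=g^{-1}$ is a homeomorphism of $D$ onto $D'$ with $\mathrm{diam}\,f(A)\geqslant\delta$ satisfying, for every family $\Gamma$ of paths in $D$, $$M(f(\Gamma))\leqslant\int_D Q(x)\,\rho^n(x)\,dm(x)\qquad\text{for all }\rho\in\mathrm{adm}\,\Gamma.$$ *)

(* Defs.v *)
From HB Require Import structures.
From mathcomp Require Import all_boot all_order all_algebra.
From mathcomp Require Import all_classical all_reals all_analysis.
From mathcomp Require Import measurable_realfun.

Set Implicit Arguments.
Unset Strict Implicit.
Unset Printing Implicit Defensive.

Import Order.TTheory GRing.Theory Num.Theory.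
Import numFieldNormedType.Exports.

Local Open Scope classical_set_scope.
Local Open Scope ring_scope.

(** * Euclidean metric *)

(* The topology that the library puts on ['rV[R]_n] is the product topology,
   i.e. the Euclidean one; its norm is the sup norm, so that metric notions
   have to go through [eucl_dist]. *)

Section Euclidean.
Context {R : realType} {n : nat}.
Implicit Types (x y : 'rV[R]_n) (S : set 'rV[R]_n).

Definition eucl_dist x y : R := Num.sqrt (\sum_(i < n) (x 0 i - y 0 i) ^+ 2).

Definition eucl_diam S : \bar R :=
  ereal_sup [set (eucl_dist p.1 p.2)%:E | p in [set p | S p.1 /\ S p.2]].

End Euclidean.

(** * Lebesgue measure on R^n *)

Section LebesgueOuter.
Context {R : realType} {n : nat}.
Local Open Scope ereal_scope.

(* Closed boxes [a_1, b_1] x ... x [a_n, b_n]; [None] is the empty box, needed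
   only to have the outer measure of the empty set vanish when [n] is [0]. *)
Definition box (B : option ('rV[R]_n * 'rV[R]_n)) : set 'rV[R]_n :=
  if B is Some (a, b) then
    [set x | forall i, (a ord0 i <= x ord0 i <= b ord0 i)%R]
  else set0.

Definition box_vol (B : option ('rV[R]_n * 'rV[R]_n)) : \bar R :=
  if B is Some (a, b) then
    (\prod_(i < n) Num.max 0 (b ord0 i - a ord0 i))%R%:E
  else 0.

Definition lebesgue_outer (A : set 'rV[R]_n) : \bar R :=
  ereal_inf [set \sum_(k <oo) box_vol (F k) | F in
    [set F : nat -> option ('rV[R]_n * 'rV[R]_n) |
      A `<=` \bigcup_k box (F k)]].

Lemma box_vol_ge0 B : 0 <= box_vol B.
Proof.
case: B => [[a b]|] //=; rewrite lee_fin.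
by apply: prodr_ge0 => i _; rewrite le_max lexx.
Qed.

Lemma lebesgue_outer_ge0 A : 0 <= lebesgue_outer A.
Proof.
apply: le_ereal_inf_tmp => _ [F _ <-].
by apply: nneseries_ge0 => k _ _; exact: box_vol_ge0.
Qed.

Lemma lebesgue_outer0 : lebesgue_outer set0 = 0.
Proof.
apply/eqP; rewrite eq_le lebesgue_outer_ge0 andbT.
apply: ereal_inf_lbound; exists (fun=> None) => //=.
by rewrite eseries0.
Qed.

Lemma le_lebesgue_outer : {homo lebesgue_outer : A B / A `<=` B >-> A <= B}.
Proof.
move=> A B AB; apply/ereal_inf_le_tmp => _ [F BF <-].
by exists F => //=; exact: subset_trans AB BF.
Qed.

Lemma lebesgue_outer_sigma_subadditive : sigma_subadditive lebesgue_outer.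
Proof.
move=> A; have [[i ioo]|] := pselect (exists i, lebesgue_outer (A i) = +oo).
  rewrite (eseries_pinfty _ _ ioo) ?leey// => k _.
  by rewrite -ltNye (lt_le_trans _ (lebesgue_outer_ge0 _)).
rewrite -forallNE => Aoo; apply/lee_addgt0Pr => e e0.
rewrite (le_trans _ (epsilon_trick _ _ (ltW e0)))//; last first.
  by move=> k; exact: lebesgue_outer_ge0.
have [G PG] : {G : nat -> nat -> option ('rV[R]_n * 'rV[R]_n) &
    forall k, A k `<=` \bigcup_j box (G k j) /\
      \sum_(j <oo) box_vol (G k j) <=
        lebesgue_outer (A k) + (e / (2 ^ k.+1)%:R)%:E}.
  apply: (@choice _ _ (fun k (B : nat -> option ('rV[R]_n * 'rV[R]_n)) =>
    A k `<=` \bigcup_j box (B j) /\ \sum_(j <oo) box_vol (B j) <=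
        lebesgue_outer (A k) + (e / (2 ^ k.+1)%:R)%:E)) => k.
  have Afin : lebesgue_outer (A k) \is a fin_num.
    by rewrite ge0_fin_numE ?lebesgue_outer_ge0// ltey; apply/eqP/Aoo.
  have ek : (0 < e / (2 ^ k.+1)%:R)%R by rewrite divr_gt0// ltr0n expn_gt0.
  have [_ [B AB <-] lt] := lb_ereal_inf_adherent ek Afin.
  by exists B; split => //; exact/ltW.
have vG_ge0 x : 0 <= (box_vol \o uncurry G) x by exact: box_vol_ge0.
apply: (@le_trans _ _ (\esum_(i in setT) (box_vol \o uncurry G) i)).
  apply: ereal_inf_lbound => /=.
  have /card_esym/ppcard_eqP[f] := card_nat2.
  exists (uncurry G \o f) => /=.
    move=> t [k _] /((PG k).1)[j _ Gt].
    by exists (f^-1%FUN (k, j)) => //=; rewrite invK ?inE.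
  rewrite -(esum_pred_image (box_vol \o uncurry G) _ xpredT)
    ?[fun=> _]set_true//.
  by rewrite image_eq.
rewrite (_ : esum _ _ = \sum_(i <oo) \sum_(j <oo) box_vol (G i j)); last first.
  pose J : nat -> set (nat * nat) := fun i => [set (i, j) | j in setT].
  rewrite (_ : setT = \bigcup_k J k); last first.
    by rewrite predeqE => -[a b]; split => // _; exists a => //; exists b.
  rewrite esum_bigcupT /=; last 2 first.
    - apply/trivIsetP => i j _ _ ij.
      rewrite predeqE => -[p q] /=; split => //= -[] [_] _ [<-{p} _].
      by move=> [? _] [] /esym/eqP; rewrite (negbTE ij).
    - by move=> ?; exact: box_vol_ge0.
  rewrite -(image_id [set: nat]) -fun_true esum_pred_image//; last first.
    by move=> k _; apply: esum_ge0 => ? _; exact: box_vol_ge0.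
  apply: eq_eseriesr => /= j _.
  rewrite -(esum_pred_image (box_vol \o uncurry G) (pair j) predT)//=; last 2 first.
    - by move=> k _; exact: box_vol_ge0.
    - by move=> ? ? _ _; exact: (@can_inj _ _ _ snd).
  by congr esum; rewrite predeqE => -[a b]; split; move=> [i _ <-]; exists i.
apply: lee_nneseries => k _.
  by move=> _; apply: nneseries_ge0 => j _ _; exact: box_vol_ge0.
exact: (PG k).2.
Qed.

HB.instance Definition _ := isOuterMeasure.Build R 'rV[R]_n lebesgue_outer
  lebesgue_outer0 lebesgue_outer_ge0 le_lebesgue_outer
  lebesgue_outer_sigma_subadditive.

End LebesgueOuter.

(* [Leb_type R n] is R^n with the sigma-algebra of Lebesgue measurable sets,
   [Borel_type R n] is R^n with the Borel sigma-algebra. *)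
Notation Leb_type R n := (caratheodory_type (@lebesgue_outer R n)).
Notation Borel_type R n := (g_sigma_algebraType (@open 'rV[R]_n)).

Definition lebesgue_outer_measure (R : realType) (n : nat) :
  {outer_measure set 'rV[R]_n -> \bar R} := @lebesgue_outer R n.

Definition lebesgue_rV (R : realType) (n : nat) :
    {measure set (Leb_type R n) -> \bar R} :=
  (lebesgue_outer_measure R n : set (Leb_type R n) -> \bar R).

Definition lebesgue_measurable_fun (R : realType) (n : nat)
  (q : 'rV[R]_n -> \bar R) := measurable_fun [set: Leb_type R n] q.

Definition borel_fun (R : realType) (n : nat) (q : 'rV[R]_n -> \bar R) :=
  measurable_fun [set: Borel_type R n] q.

(** * Paths, line integrals and the modulus *)

(* A path is a pair of an interval and a function; only the values of the
   function on the interval are relevant.  The interval may be open, half-open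
   or unbounded, whence the local rectifiability below. *)
Definition curve (R : realType) (n : nat) : Type :=
  (interval R * (R -> 'rV[R]_n))%type.

Section Modulus.
Context {R : realType} {n : nat}.
Local Open Scope ereal_scope.

Definition path_in (D : set 'rV[R]_n) (c : curve R n) :=
  [/\ exists a b : R, (a < b)%R /\ `[a, b] `<=` [set` c.1],
      {within [set` c.1], continuous c.2} &
      forall t : R, t \in c.1 -> D (c.2 t)].

Definition path_length (gamma : R -> 'rV[R]_n) (a b : R) : \bar R :=
  ereal_sup [set
    (\sum_(p <- zip (a :: s) s) eucl_dist (gamma p.1) (gamma p.2))%:E |
    s in itv_partition a b].

Definition locally_rectifiable (c : curve R n) :=
  forall a b : R, (a <= b)%R -> `[a, b] `<=` [set` c.1] ->
    path_length c.2 a b < +oo.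

(* The arc length parametrization of [gamma] on [[a, b]]: [gamma] is constant on
   every set of times at which the length travelled from [a] is [u], so that the
   time that is picked does not matter. *)
Definition arclength_param (gamma : R -> 'rV[R]_n) (a b u : R) : 'rV[R]_n :=
  gamma (get [set t | (a <= t <= b)%R /\ path_length gamma a t = u%:E]).

Definition segment_integral (rho : 'rV[R]_n -> \bar R) (gamma : R -> 'rV[R]_n)
    (a b : R) : \bar R :=
  \int[@lebesgue_measure R]_(u in `[0%R, fine (path_length gamma a b)])
    rho (arclength_param gamma a b u).

(* Over a closed interval the supremum is attained by the whole path. *)
Definition line_integral (rho : 'rV[R]_n -> \bar R) (c : curve R n) : \bar R :=
  ereal_sup [set segment_integral rho c.2 p.1 p.2 | p in
    [set p : R * R | (p.1 <= p.2)%R /\ `[p.1, p.2] `<=` [set` c.1]]].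

Definition adm (Gamma : set (curve R n)) : set ('rV[R]_n -> \bar R) :=
  [set rho | [/\ borel_fun rho, forall x, 0 <= rho x &
    forall c, Gamma c -> locally_rectifiable c -> 1 <= line_integral rho c]].

Definition modulus (Gamma : set (curve R n)) : \bar R :=
  ereal_inf [set \int[lebesgue_rV R n]_x (rho x ^+ n) | rho in adm Gamma].

Definition map_paths (f : 'rV[R]_n -> 'rV[R]_n)
    (Gamma : set (curve R n)) : set (curve R n) :=
  [set (c.1, f \o c.2) | c in Gamma].

(* For [E], [F], [G] subsets of R^n the paths of [Gamma(E, F, G)] never take the
   value infinity. *)
Definition joining_paths (E F G : set 'rV[R]_n) : set (curve R n) :=
  [set c | exists a b : R, [/\ (a < b)%R, c.1 = `[a, b],
    {within `[a, b], continuous c.2}, E (c.2 a) /\ F (c.2 b) &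
    forall t : R, (a < t < b)%R -> G (c.2 t)]].

End Modulus.

(** * Domains and their boundaries *)

Section Domains.
Context {R : realType} {n : nat}.
Implicit Types (D G S A : set 'rV[R]_n) (x : 'rV[R]_n).

Definition domain D := [/\ D !=set0, open D & connected D].

Definition continuum A := compact A /\ connected A.

Definition nondegenerate_continuum A :=
  continuum A /\ forall x, A <> [set x].

Definition boundary S := closure S `\` S°.

Definition path_component S x : set 'rV[R]_n :=
  [set y | exists gamma : R -> 'rV[R]_n,
    [/\ {within `[0, 1], continuous gamma}, gamma 0 = x, gamma 1 = y &
        forall t : R, 0 <= t <= 1 -> S (gamma t)]].

Definition locally_connected_at G x :=
  forall U, open_nbhs x U ->
    exists V, [/\ open_nbhs x V, V `<=` U & connected (V `&` G)].

Definition weakly_flat_at G x :=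
  forall P : R, 0 < P -> forall U, open_nbhs x U ->
    exists V, [/\ open_nbhs x V, V `<=` U &
      forall E F, continuum E -> continuum F -> E `<=` G -> F `<=` G ->
        E `&` boundary U !=set0 -> E `&` boundary V !=set0 ->
        F `&` boundary U !=set0 -> F `&` boundary V !=set0 ->
        (P%:E < modulus (joining_paths E F G))%E].

Definition weakly_flat_boundary G :=
  forall x, boundary G x -> weakly_flat_at G x.

End Domains.

(** * Mapping classes *)

Section Mappings.
Context {R : realType} {n : nat}.
Implicit Types (D A : set 'rV[R]_n) (Q : 'rV[R]_n -> \bar R).
Implicit Types (f g h : 'rV[R]_n -> 'rV[R]_n).

(* [f] is a homeomorphism of [D] onto [D'] with inverse [g]; the values of [f]
   outside [D] and of [g] outside [D'] are irrelevant. *)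
Definition homeo_with_inverse D D' f g :=
  [/\ f @` D = D', forall x, D x -> g (f x) = x,
      {within D, continuous f} & {within D', continuous g}].

Definition S_class (delta : R) A Q D D' : set ('rV[R]_n -> 'rV[R]_n) :=
  [set g | exists f,
    [/\ homeo_with_inverse D D' f g, (delta%:E <= eucl_diam (f @` A))%E &
      forall Gamma : set (curve R n),
        (forall c, Gamma c -> path_in D c) ->
        forall rho, adm Gamma rho ->
          (modulus (map_paths f Gamma) <=
             \int[lebesgue_rV R n]_(x in D) (Q x * rho x ^+ n))%E]].

Definition extends_to_closure D D' g h :=
  [/\ {within closure D', continuous h}, h @` closure D' `<=` closure D &
      forall y, D' y -> h y = g y].

Definition S_class_closure (delta : R) A Q D D' :
    set ('rV[R]_n -> 'rV[R]_n) :=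
  [set h | exists2 g, S_class delta A Q D D' g & extends_to_closure D D' g h].

Definition equicontinuous_in (S : set 'rV[R]_n)
    (H : set ('rV[R]_n -> 'rV[R]_n)) :=
  forall x, S x -> forall eps : R, 0 < eps -> exists2 r : R, 0 < r &
    forall h, H h -> forall y, S y ->
      eucl_dist x y < r -> eucl_dist (h x) (h y) < eps.

End Mappings.

(* Main.v *)
Require Import Defs.
From HB Require Import structures.
From mathcomp Require Import all_boot all_order all_algebra.
From mathcomp Require Import all_classical all_reals all_analysis.
From mathcomp Require Import measurable_realfun.
From mathcomp Require Import ring lra.

(** Write [M(E, F)] for the modulus of the paths of [D'] that join [E] to [F].  All
    assertions follow from one bound that is uniform over the class: for [y0] in
    the closure of [D'] and [eps > 0], some neighborhood [V] of [y0] satisfies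
    [eucl_dist (g y) (g y') < eps] for all [g] of the class and all [y], [y'] in
    [V `&` D'].  Since the closure of [D] is compact, this bound gives [g] a limit
    at every boundary point ([limit_exists]).  It passes to the limits
    ([limits_oscillation]), where it says that the extensions are continuous, and
    equicontinuous as a family.  The image of an extension is compact and contains
    [D], hence is the closure of [D].

    The bound results from two estimates of [M(E, F)] for connected subsets [E]
    and [F] of [D'].  If [g E] and [g F] are at distance at least [d], the constant
    [1 / d] is admissible for the preimages of the paths, and [M(E, F)] is at most
    [d ^- n] times the integral of [Q], whatever [g] is ([modulus_bound]).  If on
    the other hand [E] and [F] both come very close to [y0] and both leave a fixed
    neighborhood of [y0], then [M(E, F)] is large: at boundary points this is the
    hypothesis of weak flatness, and at interior points it is a property of the
    space ([interior_weakly_flat]).  So [g y] and [g y'] are close to each other as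
    soon as their being far apart would allow to choose connected sets [E]
    through [y] and [F] through [y'] that leave a fixed neighborhood of [y0] while
    [g E] and [g F] stay far apart.

    At an interior point [y0], the sets [g E] and [g F] are pieces of opposite rays
    from [g y] and from [g y'], followed until they leave [D]
    ([oscillation_interior]).  At a boundary point they are small continua that
    join [g y] and [g y'] to finitely many points fixed in advance; they exist
    since [D] is locally connected at its boundary and has a compact closure
    ([oscillation_boundary]).  That their images leave a fixed neighborhood of [y0]
    means that the image of a fixed compact subset of [D] stays away from [y0],
    uniformly over the class ([image_avoids_boundary_point]).  This last point is
    where [A] and [delta] enter.  The compact set may be assumed to be connected and
    to contain [A], so that its image has diameter at least [delta]; if this image
    came close to [y0], it could serve as [E], and as [F] one would take continua of
    [D'] that follow the boundary component of [y0], which is not a single point.  These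
    exist because a weakly flat boundary makes [D'] locally connected
    ([weakly_flat_locally_connected], [boundary_shadow]).

    For the estimate at interior points, let [rho] be admissible.  If [rho ^ n] has
    a small integral over a cubic shell, then by Tonelli's theorem it has a small
    integral over some slice orthogonal to each axis, on either side of the center
    ([good_slice]).  A slice has dimension [n - 1 < n], so that by Morrey's argument
    any two of its points are joined by two segments on which [rho] is small
    ([integral_pencil_le], [slice_linked]).  Two connected sets that cross the shell
    both meet the box that the slices form, and the slices intersect; this yields
    a path between the two sets on which [rho] is too small.  Hence every shell
    contributes a fixed amount to the integral of [rho ^ n], and there are as many
    shells as desired ([shell_modulus], [interior_weakly_flat]). *)

Set Implicit Arguments.
Unset Strict Implicit.
Unset Printing Implicit Defensive.

Import Order.TTheory GRing.Theory Num.Theory.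
Import numFieldNormedType.Exports.
Local Open Scope classical_set_scope.
Local Open Scope ring_scope.

(** * Euclidean distance and arc length *)

Section EuclideanGeometry.
Context {R : realType} {n : nat}.
Implicit Types (x y z : 'rV[R]_n).

Lemma eucl_dist_ge0 x y : 0 <= eucl_dist x y.
Proof. exact: sqrtr_ge0. Qed.

Lemma eucl_distxx x : eucl_dist x x = 0.
Proof.
by rewrite /eucl_dist big1 ?sqrtr0// => i _; rewrite subrr expr0n.
Qed.

Lemma eucl_distC x y : eucl_dist x y = eucl_dist y x.
Proof. by rewrite /eucl_dist; congr Num.sqrt; apply: eq_bigr => i _; rewrite -sqrrN opprB. Qed.

Lemma coord_le_eucl_dist x y i : `|x 0 i - y 0 i| <= eucl_dist x y.
Proof.
rewrite -sqrtr_sqr ler_wsqrtr// (bigD1 i)//= lerDl sumr_ge0// => j _.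
exact: sqr_ge0.
Qed.

Lemma eucl_dist_le_coord x y (e : R) : (forall i, `|x 0 i - y 0 i| <= e) ->
  eucl_dist x y <= n%:R * e.
Proof.
move=> xye; case: n x y xye => [|m] x y xye.
  by rewrite /eucl_dist big_ord0 sqrtr0 mul0r.
have e0 : 0 <= e := le_trans (normr_ge0 _) (xye ord0).
rewrite -[leRHS]ger0_norm ?mulr_ge0// -sqrtr_sqr ler_wsqrtr//.
apply: (@le_trans _ _ (\sum_(i < m.+1) e ^+ 2)).
  apply: ler_sum => i _; rewrite -[leLHS]real_normK ?num_real//.
  by rewrite lerXn2r ?nnegrE.
rewrite sumr_const card_ord exprMn -[X in X <= _]mulr_natl ler_wpM2r ?sqr_ge0//.
by rewrite -natrX ler_nat; exact: leq_pmull.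
Qed.

Lemma sum_mul_le_sqrt (a b : 'I_n -> R) :
  \sum_i a i * b i <= Num.sqrt (\sum_i a i ^+ 2) * Num.sqrt (\sum_i b i ^+ 2).
Proof.
have sq0 (c : 'I_n -> R) : 0 <= \sum_i c i ^+ 2.
  by apply: sumr_ge0 => i _; exact: sqr_ge0.
rewrite -sqrtrM// (le_trans (ler_norm _))// -sqrtr_sqr ler_wsqrtr//.
rewrite -subr_ge0 -(pmulr_rge0 _ (ltr0n R 2)).
suff -> : 2%:R * ((\sum_i a i ^+ 2) * (\sum_i b i ^+ 2) -
    (\sum_i a i * b i) ^+ 2) =
    \sum_i \sum_j (a i * b j - a j * b i) ^+ 2.
  by apply: sumr_ge0 => i _; apply: sumr_ge0 => j _; exact: sqr_ge0.
have -> : \sum_i \sum_j (a i * b j - a j * b i) ^+ 2 =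
    \sum_i \sum_j (a i ^+ 2 * b j ^+ 2 + b i ^+ 2 * a j ^+ 2
      - (a i * b i * (a j * b j)) *+ 2).
  by apply: eq_bigr => i _; apply: eq_bigr => j _; ring.
have sum2 (c d : 'I_n -> R) :
    \sum_i \sum_j c i * d j = (\sum_i c i) * (\sum_j d j).
  by rewrite mulr_suml; apply: eq_bigr => i _; rewrite mulr_sumr.
under [RHS]eq_bigr do rewrite sumrB big_split/=.
rewrite sumrB big_split/= !sum2.
under [X in _ = _ - X]eq_bigr do rewrite sumrMnl.
by rewrite sumrMnl sum2; ring.
Qed.

Lemma eucl_dist_triangle y x z :
  eucl_dist x z <= eucl_dist x y + eucl_dist y z.
Proof.
have sq0 (c : 'I_n -> R) : 0 <= \sum_i c i ^+ 2.
  by apply: sumr_ge0 => i _; exact: sqr_ge0.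
have /ger0_norm <- : 0 <= eucl_dist x y + eucl_dist y z.
  by rewrite addr_ge0// eucl_dist_ge0.
rewrite -sqrtr_sqr ler_wsqrtr// sqrrD !sqr_sqrtr//.
have -> : \sum_(i < n) (x 0 i - z 0 i) ^+ 2 = \sum_(i < n) (x 0 i - y 0 i) ^+ 2
   + (\sum_(i < n) (x 0 i - y 0 i) * (y 0 i - z 0 i)) *+ 2
   + \sum_(i < n) (y 0 i - z 0 i) ^+ 2.
  by rewrite -sumrMnl -!big_split/=; apply: eq_bigr => i _; ring.
by rewrite lerD2r lerD2l lerMn2r sum_mul_le_sqrt orbT.
Qed.

Lemma eucl_dist_eq0 x y : eucl_dist x y = 0 -> x = y.
Proof.
move=> xy0; apply/rowP => i; apply/eqP; rewrite -subr_eq0 -normr_le0 -xy0.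
exact: coord_le_eucl_dist.
Qed.

Lemma near_eucl_dist x (e : R) : 0 < e -> \forall y \near x, eucl_dist x y < e.
Proof.
move=> e0; have d0 : 0 < e / n.+1%:R by rewrite divr_gt0.
apply/nbhs_ballP; exists (e / n.+1%:R) => //= y xy.
rewrite (le_lt_trans (@eucl_dist_le_coord _ _ (e / n.+1%:R) _))//.
  by move=> i; apply/ltW; exact: (xy.2 0 i).
by rewrite mulrCA gtr_pMr// ltr_pdivrMr// mul1r ltr_nat.
Qed.

Lemma nbhs_eucl_dist x (U : set 'rV[R]_n) : nbhs x U ->
  exists2 e, 0 < e & forall y, eucl_dist x y < e -> U y.
Proof.
move=> /nbhs_ballP[e /= e0 xeU]; exists e => // y xy; apply: xeU; split=> // i j.
by rewrite /ball/= (le_lt_trans _ xy)// (ord1 i) coord_le_eucl_dist.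
Qed.

Definition eucl_ball x (e : R) : set 'rV[R]_n := [set y | eucl_dist x y < e].

Lemma open_eucl_ball x e : open (eucl_ball x e).
Proof.
rewrite openE => y /= xy; have : 0 < e - eucl_dist x y by rewrite subr_gt0.
move=> /(near_eucl_dist y); apply: filterS => z yz /=.
by rewrite /eucl_ball/= (le_lt_trans (eucl_dist_triangle y _ _))// -ltrBrDl.
Qed.

Lemma eucl_ball_center x e : 0 < e -> eucl_ball x e x.
Proof. by rewrite /eucl_ball/= eucl_distxx. Qed.

Lemma open_nbhs_eucl_ball x e : 0 < e -> open_nbhs x (eucl_ball x e).
Proof. by move=> e0; split; [exact: open_eucl_ball|exact: eucl_ball_center]. Qed.

Lemma open_eucl_ballP (U : set 'rV[R]_n) x : open U -> U x ->
  exists2 e, 0 < e & eucl_ball x e `<=` U.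
Proof.
by move=> oU Ux; have /nbhs_eucl_dist : nbhs x U by exact: open_nbhs_nbhs.
Qed.

Lemma closed_eucl_ball x e : closed [set y | eucl_dist x y <= e].
Proof.
rewrite -[X in closed X]setCK; apply: open_closedC.
rewrite openE => y /= /negP; rewrite -ltNge => xy.
have : 0 < eucl_dist x y - e by rewrite subr_gt0.
move=> /(near_eucl_dist y); apply: filterS => z yz /=; apply/negP.
rewrite -ltNge; have := eucl_dist_triangle z x y.
by rewrite (eucl_distC z y); move: yz; lra.
Qed.

End EuclideanGeometry.

Section ArcLength.
Context {R : realType} {n : nat}.
Implicit Types (gamma : R -> 'rV[R]_n) (a b c t u : R) (s : seq R).
Local Open Scope ereal_scope.

Definition polygon_length gamma a s : R :=
  (\sum_(p <- zip (a :: s) s) eucl_dist (gamma p.1) (gamma p.2))%R.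

Lemma polygon_length_nil gamma a : polygon_length gamma a [::] = 0%R.
Proof. by rewrite /polygon_length big_nil. Qed.

Lemma polygon_length_cons gamma a c s : polygon_length gamma a (c :: s) =
  (eucl_dist (gamma a) (gamma c) + polygon_length gamma c s)%R.
Proof. by rewrite /polygon_length/= big_cons. Qed.

Lemma polygon_length_cat gamma a s1 s2 : polygon_length gamma a (s1 ++ s2) =
  (polygon_length gamma a s1 + polygon_length gamma (last a s1) s2)%R.
Proof.
elim: s1 a => [|c s1 ih] a /=; first by rewrite polygon_length_nil add0r.
by rewrite !polygon_length_cons ih addrA.
Qed.

Lemma polygon_length_ge0 gamma a s : (0 <= polygon_length gamma a s)%R.
Proof. by apply: sumr_ge0 => p _; exact: eucl_dist_ge0. Qed.

Lemma polygon_length_le gamma a b s : itv_partition a b s ->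
  (polygon_length gamma a s)%:E <= path_length gamma a b.
Proof. by move=> sab; apply: ereal_sup_ubound; exists s. Qed.

Lemma path_length_le gamma a b (x : \bar R) :
  (forall s, itv_partition a b s -> (polygon_length gamma a s)%:E <= x) ->
  path_length gamma a b <= x.
Proof. by move=> h; apply: ge_ereal_sup => _ [s sab <-]; exact: h. Qed.

Lemma itv_partition_cons a b s : (a < b)%R -> itv_partition a b s ->
  exists c s', [/\ s = c :: s', (a < c)%R & itv_partition c b s'].
Proof.
case: s => [ab [_ /= /eqP ab']|c s ab [/= /andP[ac cs] sb]].
  by rewrite ab' ltxx in ab.
by exists c, s; split.
Qed.

Lemma itv_partition_rcons a b s : (a < b)%R -> itv_partition a b s ->
  exists s', [/\ s = rcons s' b, itv_partition a (last a s') s' &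
    (last a s' < b)%R].
Proof.
case/lastP: s => [ab [_ /= /eqP ab']|s c ab []].
  by rewrite ab' ltxx in ab.
rewrite rcons_path last_rcons => /andP[ps cs] /eqP cb; subst c.
by exists s; split => //; split.
Qed.

Lemma itv_partition_or a b : (a <= b)%R -> exists s, itv_partition a b s.
Proof.
rewrite le_eqVlt => /predU1P[->|ab]; first by exists [::]; split.
by exists [:: b]; exact: itv_partition1.
Qed.

Lemma path_length_ge0 gamma a b : (a <= b)%R -> 0 <= path_length gamma a b.
Proof.
move=> /itv_partition_or[s sab]; apply: le_trans (polygon_length_le gamma sab).
by rewrite lee_fin polygon_length_ge0.
Qed.

Lemma path_lengthxx gamma a : path_length gamma a a = 0.
Proof.
apply/eqP; rewrite eq_le path_length_ge0// andbT.
by apply: path_length_le => s /itv_partitionxx ->; rewrite polygon_length_nil.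
Qed.

Lemma eucl_dist_le_path_length gamma a b : (a <= b)%R ->
  (eucl_dist (gamma a) (gamma b))%:E <= path_length gamma a b.
Proof.
rewrite le_eqVlt => /predU1P[->|ab].
  by rewrite eucl_distxx path_lengthxx.
apply: le_trans (polygon_length_le gamma (itv_partition1 ab)).
by rewrite polygon_length_cons polygon_length_nil addr0.
Qed.

Lemma path_length_superadditive gamma a c b : (a <= c)%R -> (c <= b)%R ->
  path_length gamma a c + path_length gamma c b <= path_length gamma a b.
Proof.
move=> ac cb; have [->|] := eqVneq (path_length gamma a b) +oo.
  by rewrite leey.
rewrite -ltey => ablt.
have abfin : path_length gamma a b \is a fin_num.
  by rewrite ge0_fin_numE// path_length_ge0// (le_trans ac).
have key s1 s2 : itv_partition a c s1 -> itv_partition c b s2 ->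
    (polygon_length gamma a s1)%:E + (polygon_length gamma c s2)%:E
      <= path_length gamma a b.
  move=> s1ac s2cb.
  apply: le_trans (polygon_length_le gamma (itv_partition_cat s1ac s2cb)).
  by case: s1ac => _ /eqP s1c; rewrite polygon_length_cat s1c EFinD.
have key2 s1 : itv_partition a c s1 ->
    (polygon_length gamma a s1)%:E + path_length gamma c b
      <= path_length gamma a b.
  move=> s1ac; rewrite -leeBrDl//; apply: path_length_le => s2 s2cb.
  by rewrite leeBrDl// key.
have cbfin : path_length gamma c b \is a fin_num.
  have [s1 s1ac] := itv_partition_or ac.
  rewrite ge0_fin_numE ?path_length_ge0//.
  apply: le_lt_trans ablt; apply: le_trans (key2 _ s1ac).
  by rewrite leeDr// lee_fin polygon_length_ge0.
rewrite -leeBrDr//; apply: path_length_le => s1 s1ac.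
by rewrite leeBrDr// key2.
Qed.

(** The polygons that bound the length may be assumed to have a vertex at [c]:
    by the triangle inequality, inserting it makes them longer. *)
Lemma path_length_subadditive gamma a c b : (a <= c)%R -> (c <= b)%R ->
  path_length gamma a b <= path_length gamma a c + path_length gamma c b.
Proof.
move=> ac cb; apply: path_length_le => s sab.
suff [s1 [s2 [s1ac s2cb]]] : exists s1 s2, [/\ itv_partition a c s1,
    itv_partition c b s2 & (polygon_length gamma a s <=
    polygon_length gamma a s1 + polygon_length gamma c s2)%R].
  rewrite -lee_fin EFinD => /le_trans; apply.
  by apply: leeD; exact: polygon_length_le.
elim: s a ac sab => [|x s ih] a ac sab.
  have ab : a = b by exact: itv_partition_nil sab.
  have {}ac : a = c by apply/eqP; rewrite eq_le ac ab cb.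
  subst b; subst c; exists [::], [::]; rewrite !polygon_length_nil addr0.
  by split => //; split.
have [ca|ca] := eqVneq a c.
  subst c; exists [::], (x :: s); split => //.
  by rewrite polygon_length_nil add0r.
have {ca}ac' : (a < c)%R by rewrite lt_neqAle ca ac.
have [/= /andP[ax xs] sb] := sab.
have [xc|cx] := leP x c.
  have [//|s1 [s2 [s1xc s2cb le12]]] := ih x xc.
  exists (x :: s1), s2; split => //.
    by case: s1xc => p1 l1; split => //=; rewrite ax.
  by rewrite !polygon_length_cons -addrA lerD2l.
exists [:: c], (x :: s); split; first exact: itv_partition1.
  by split => //=; rewrite cx.
rewrite !polygon_length_cons polygon_length_nil addr0 addrA lerD2r.
exact: eucl_dist_triangle.
Qed.

Lemma path_lengthD gamma a c b : (a <= c)%R -> (c <= b)%R ->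
  path_length gamma a b = path_length gamma a c + path_length gamma c b.
Proof.
move=> ac cb; apply/eqP; rewrite eq_le path_length_superadditive// andbT.
exact: path_length_subadditive.
Qed.

Lemma within_continuous_eucl_dist (A : set R) gamma t (e : R) :
  {within A, continuous gamma} -> A t -> (0 < e)%R ->
  exists2 d : R, (0 < d)%R & forall t', A t' -> (`|t - t'| < d)%R ->
    (eucl_dist (gamma t) (gamma t') < e)%R.
Proof.
move=> /subspace_continuousP/(_ t) ct At e0.
have /nbhs_ballP[d /= d0 tdA] := ct At _ (near_eucl_dist (gamma t) e0).
by exists d => // t' At' tt'; exact: tdA.
Qed.

(** Moving the last vertex of a polygon from [b] to a time just before costs
    as little as desired, so that the length does not jump at [b]. *)
Lemma path_length_lsc_right gamma a b u : (a < b)%R ->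
  {within `[a, b], continuous gamma} ->
  (forall t, (a <= t < b)%R -> path_length gamma a t <= u%:E) ->
  path_length gamma a b <= u%:E.
Proof.
move=> ab cg le_u; apply: path_length_le => s sab.
have [s' [-> s'a s'b]] := itv_partition_rcons ab sab.
have /= as' := itv_partition_le s'a.
rewrite -cats1 polygon_length_cat polygon_length_cons polygon_length_nil addr0.
rewrite lee_fin; apply/ler_addgt0Pr => e e0.
have bab : `[a, b]%classic b by rewrite /= in_itv/= lexx ltW.
have [d d0 bd] := within_continuous_eucl_dist cg bab e0.
pose p := last a s'; pose t := Num.max ((p + b) / 2%:R)%R (b - d / 2%:R)%R.
have pt : (p < t)%R by rewrite /t lt_max; apply/orP; left; move: s'b; rewrite -/p; lra.
have tb : (t < b)%R by rewrite /t gt_max; apply/andP; split; move: s'b; rewrite -/p; lra.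
have bt : (`|b - t| < d)%R.
  rewrite gtr0_norm ?subr_gt0// ltrBlDr -ltrBlDl /t lt_max; apply/orP; right.
  by lra.
have atb : (a <= t < b)%R by rewrite tb andbT (le_trans as')// ltW.
have at' : `[a, b]%classic t by rewrite /= in_itv/= (ltW tb) andbT; case/andP : atb.
have := le_u t atb; have := bd t at' bt.
have pt' := itv_partition_cat s'a (itv_partition1 pt).
move=> btd /(le_trans (polygon_length_le gamma pt')).
rewrite polygon_length_cat polygon_length_cons polygon_length_nil addr0 lee_fin.
have := eucl_dist_triangle (gamma t) (gamma p) (gamma b).
rewrite (eucl_distC (gamma t)) -/p; lra.
Qed.

Lemma path_length_lsc_left gamma a b u : (a < b)%R ->
  {within `[a, b], continuous gamma} ->
  (forall t, (a < t <= b)%R -> path_length gamma t b <= u%:E) ->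
  path_length gamma a b <= u%:E.
Proof.
move=> ab cg le_u; apply: path_length_le => s sab.
have [x [s' [-> ax s'xb]]] := itv_partition_cons ab sab.
have xb := itv_partition_le s'xb.
rewrite polygon_length_cons lee_fin; apply/ler_addgt0Pr => e e0.
have aab : `[a, b]%classic a by rewrite /= in_itv/= lexx ltW.
have [d d0 ad] := within_continuous_eucl_dist cg aab e0.
pose t := Num.min ((a + x) / 2%:R)%R (a + d / 2%:R)%R.
have ta : (a < t)%R by rewrite /t lt_min; apply/andP; split; lra.
have tx : (t < x)%R by rewrite /t gt_min; apply/orP; left; lra.
have ta' : (`|a - t| < d)%R.
  rewrite distrC gtr0_norm ?subr_gt0// ltrBlDr /t gt_min; apply/orP; right.
  by lra.
have atb : (a < t <= b)%R by rewrite ta (le_trans (ltW tx)).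
have at' : `[a, b]%classic t by rewrite /= in_itv/= (ltW ta); case/andP : atb.
have := le_u t atb; have := ad t at' ta'.
have pt' := itv_partition_cat (itv_partition1 tx) s'xb.
move=> btd /(le_trans (polygon_length_le gamma pt')).
rewrite polygon_length_cat polygon_length_cons polygon_length_nil addr0 lee_fin.
have := eucl_dist_triangle (gamma t) (gamma a) (gamma x).
by rewrite /=; lra.
Qed.

Lemma le_path_length gamma a c b : (a <= c)%R -> (c <= b)%R ->
  path_length gamma a c <= path_length gamma a b.
Proof.
by move=> ac cb; rewrite (path_lengthD gamma ac cb) leeDl// path_length_ge0.
Qed.

(** The last time at which the length travelled is at most [u] does it: the
    length jumps neither when this time is approached from the left nor when it
    is left to the right. *)
Lemma path_length_surjective gamma a b u : (a <= b)%R ->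
  {within `[a, b], continuous gamma} ->
  (0 <= u <= fine (path_length gamma a b))%R ->
  exists t, (a <= t <= b)%R /\ path_length gamma a t = u%:E.
Proof.
move=> ab cg /andP[u0 uL].
have [Loo|Lfin] := eqVneq (path_length gamma a b) +oo.
  rewrite Loo/= in uL; exists a; rewrite lexx ab path_lengthxx; split => //.
  by congr EFin; apply/eqP; rewrite eq_le u0 uL.
have {}Lfin : path_length gamma a b \is a fin_num.
  by rewrite ge0_fin_numE ?ltey// path_length_ge0.
have {}uL : u%:E <= path_length gamma a b by rewrite -(fineK Lfin) lee_fin.
pose T := [set t | (a <= t <= b)%R /\ path_length gamma a t <= u%:E].
have Ta : T a by rewrite /T/= lexx ab path_lengthxx lee_fin.
have supT : has_sup T.
  by split; [exists a|exists b => t [/andP[]]].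
pose t0 := sup T.
have at0 : (a <= t0)%R by exact: ub_le_sup supT.2 _ Ta.
have t0b : (t0 <= b)%R by apply: ge_sup => [|t [/andP[]]//]; exists a.
have subcont c d : (a <= c)%R -> (d <= b)%R -> {within `[c, d], continuous gamma}.
  move=> ac db; apply: continuous_subspaceW cg => z /=; rewrite !in_itv/=.
  by move=> /andP[cz zd]; rewrite (le_trans ac cz) (le_trans zd db).
exists t0; split; first by rewrite at0.
apply/eqP; rewrite eq_le; apply/andP; split.
  have [<-|neq_at0] := eqVneq a t0; first by rewrite path_lengthxx lee_fin.
  have {neq_at0}at0' : (a < t0)%R by rewrite lt_neqAle neq_at0.
  apply: path_length_lsc_right => //; first exact: subcont.
  move=> t /andP[a_t tt0].
  have [t' [/andP[at' t'b] t'u] tt'] := sup_gt supT.1 tt0.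
  by apply: le_trans t'u; apply: le_path_length => //; exact: ltW.
have [->//|neq_t0b] := eqVneq t0 b.
have {}t0b : (t0 < b)%R by rewrite lt_neqAle neq_t0b.
have t0bu : path_length gamma t0 b <= (fine (path_length gamma a b) - u)%:E.
  apply: path_length_lsc_left => //; first exact: subcont.
  move=> t /andP[t0t tb].
  have at1 : (a <= t)%R by rewrite (le_trans at0)// ltW.
  have ut : u%:E <= path_length gamma a t.
    rewrite leNgt; apply/negP => tu.
    have : T t by split; [rewrite at1 tb|exact: ltW].
    by move=> /(ub_le_sup supT.2); rewrite -/t0 leNgt t0t.
  rewrite EFinB fineK// leeBrDl//.
  by rewrite (path_lengthD gamma at1 tb) leeD2r.
have := path_length_subadditive gamma at0 (ltW t0b).
have f1 : path_length gamma a t0 \is a fin_num.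
  rewrite ge0_fin_numE ?path_length_ge0//.
  apply: (@le_lt_trans _ _ (path_length gamma a b)); last first.
    by rewrite ltey_eq Lfin.
  by apply: le_path_length => //; exact: ltW.
have f2 : path_length gamma t0 b \is a fin_num.
  rewrite ge0_fin_numE ?path_length_ge0 ?(ltW t0b)//.
  by rewrite (le_lt_trans t0bu)// ltry.
move: t0bu; rewrite -(fineK f1) -(fineK f2) -(fineK Lfin) -EFinD !lee_fin/=.
by lra.
Qed.

Lemma arclength_time gamma a b u : (a <= b)%R ->
  {within `[a, b], continuous gamma} ->
  (0 <= u <= fine (path_length gamma a b))%R ->
  exists t, [/\ (a <= t <= b)%R, path_length gamma a t = u%:E &
    arclength_param gamma a b u = gamma t].
Proof.
move=> ab cg uL; have ex := path_length_surjective ab cg uL.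
rewrite /arclength_param; set S := [set t | _].
by have [? ?] := @getPex _ S ex; exists (get S).
Qed.

Lemma eq_path_length gamma gamma' a b :
  (forall t, (a <= t <= b)%R -> gamma t = gamma' t) ->
  path_length gamma a b = path_length gamma' a b.
Proof.
move=> eqg; have eqp s : itv_partition a b s ->
    polygon_length gamma a s = polygon_length gamma' a s.
  suff h c : (a <= c)%R -> itv_partition c b s ->
      polygon_length gamma c s = polygon_length gamma' c s by exact: h.
  elim: s c => [|x s ih] c ac scb; rewrite ?polygon_length_nil//.
  rewrite !polygon_length_cons; have cb := itv_partition_le scb.
  have [/= /andP[cx xs] sb] := scb.
  have sxb : itv_partition x b s by [].
  have ax : (a <= x)%R by rewrite (le_trans ac)// ltW.
  by rewrite ih// !eqg ?ac ?ax// (itv_partition_le sxb).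
by apply/eqP; rewrite eq_le; apply/andP; split; apply: path_length_le => s sab;
  [rewrite (eqp _ sab)|rewrite -(eqp _ sab)]; exact: polygon_length_le.
Qed.

(** Every length up to that of the path is the length travelled at some time, so
    that the choice made by [arclength_param] never leaves the interval of times;
    hence values of the path elsewhere have no influence. *)
Lemma eq_segment_integral (rho : 'rV[R]_n -> \bar R) gamma gamma' a b :
  (a <= b)%R -> {within `[a, b], continuous gamma} ->
  (forall t, (a <= t <= b)%R -> gamma t = gamma' t) ->
  segment_integral rho gamma a b = segment_integral rho gamma' a b.
Proof.
move=> ab cg eqg; rewrite /segment_integral -(eq_path_length eqg).
apply: eq_integral => u; rewrite inE/= in_itv/= => uL; congr rho.
have [t [tab _]] := path_length_surjective ab cg uL.
rewrite /arclength_param.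
have -> : [set t | (a <= t <= b)%R /\ path_length gamma' a t = u%:E] =
    [set t | (a <= t <= b)%R /\ path_length gamma a t = u%:E].
  have eqx x : (a <= x <= b)%R -> path_length gamma a x = path_length gamma' a x.
    move=> /andP[ax xb]; apply: eq_path_length => y /andP[ay yx].
    by apply: eqg; rewrite ay (le_trans yx).
  by apply/seteqP; split => x [axb]; [rewrite -eqx//|rewrite eqx//].
by apply: eqg; have [] := @getPex _ _ (path_length_surjective ab cg uL).
Qed.

End ArcLength.

(** * Lebesgue measure and boxes *)

Lemma eq_measurable d (T : sigmaRingType d) (A B : set T) :
  A = B -> measurable B -> measurable A.
Proof. by move=> ->. Qed.

Section LebesgueBoxes.
Context {R : realType} {n : nat}.
Implicit Types (a b x : 'rV[R]_n).

(** Boxes with rational vertices are countably many and small enough. *)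
Lemma open_bigcup_box (U : set 'rV[R]_n) : open U ->
  exists F : nat -> 'rV[R]_n * 'rV[R]_n,
    U = \bigcup_(k in [set k | box (Some (F k)) `<=` U]) box (Some (F k)).
Proof.
move=> oU.
pose G k : 'rV[R]_n * 'rV[R]_n :=
  if unpickle k is Some p then
    (map_mx ratr (p : 'rV[rat]_n * 'rV[rat]_n).1, map_mx ratr p.2) else (0, 0).
exists G; apply/seteqP; split; last by move=> x [k /= kU kx]; exact: kU.
move=> x Ux; have /nbhs_ballP[e /= e0 xeU] : nbhs x U by exact: open_nbhs_nbhs.
have rata (i : 'I_n) : exists q : rat, x 0 i - e < ratr q <= x 0 i.
  have [q] := @rat_in_itvoo R (x 0 i - e) (x 0 i) ltac:(lra).
  by rewrite in_itv/= => /andP[q1 /ltW q2]; exists q; rewrite q1.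
have ratb (i : 'I_n) : exists q : rat, x 0 i <= ratr q < x 0 i + e.
  have [q] := @rat_in_itvoo R (x 0 i) (x 0 i + e) ltac:(lra).
  by rewrite in_itv/= => /andP[/ltW q1 q2]; exists q; rewrite q1.
have [fa faP] := choice rata; have [fb fbP] := choice ratb.
pose p : 'rV[rat]_n * 'rV[rat]_n := (\row_i fa i, \row_i fb i).
have Gp : G (pickle p) = (\row_i ratr (fa i), \row_i ratr (fb i)).
  by rewrite /G pickleK/=; congr pair; apply/rowP => i; rewrite !mxE.
exists (pickle p); rewrite /= Gp.
  move=> y /= ybox; apply: xeU; split => // i j; rewrite (ord1 i).
  have := ybox j; have := faP j; have := fbP j; rewrite !mxE /ball/=.
  by move=> /andP[? ?] /andP[? ?] /andP[? ?]; rewrite ltr_distl; lra.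
move=> i; rewrite !mxE; have := faP i; have := fbP i.
by move=> /andP[? ?] /andP[? ?]; lra.
Qed.

Lemma measurable_fun_borel d (T : measurableType d) (phi : T -> 'rV[R]_n) :
  (forall a b, measurable (phi @^-1` box (Some (a, b)))) ->
  measurable_fun setT (phi : T -> Borel_type R n).
Proof.
move=> mbox; apply: (@measurability _ _ T (Borel_type R n) setT phi (@open 'rV[R]_n)) => //.
move=> _ [U oU <-]; rewrite setTI.
have [F ->] := open_bigcup_box oU; rewrite preimage_bigcup.
by apply: bigcup_measurable => k _; case: (F k).
Qed.

Definition box_le (i : 'I_n) (c : R) (B : option ('rV[R]_n * 'rV[R]_n)) :=
  if B is Some (a, b) then
    Some (a, \row_j if j == i then Num.min (b 0 j) c else b 0 j)
  else None.

Definition box_ge (i : 'I_n) (c : R) (B : option ('rV[R]_n * 'rV[R]_n)) :=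
  if B is Some (a, b) then
    Some (\row_j if j == i then Num.max (a 0 j) c else a 0 j, b)
  else None.

Lemma sub_box_le i c B : box B `&` [set x | x 0 i <= c] `<=` box (box_le i c B).
Proof.
case: B => [[a b]|] x [/= Bx xc] // j; rewrite mxE; have := Bx j.
by case: eqP => [->|_] // /andP[-> xb] /=; rewrite le_min xb.
Qed.

Lemma sub_box_ge i c B : box B `&` [set x | c <= x 0 i] `<=` box (box_ge i c B).
Proof.
case: B => [[a b]|] x [/= Bx xc] // j; rewrite mxE; have := Bx j.
by case: eqP => [->|_] // /andP[ax ->]; rewrite ge_max ax xc.
Qed.

Lemma box_vol_split i c B :
  (box_vol (box_le i c B) + box_vol (box_ge i c B) = box_vol B)%E.
Proof.
case: B => [[a b]|] /=; last by rewrite adde0.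
rewrite -EFinD; congr EFin.
rewrite (bigD1 i)//= [X in _ + X = _](bigD1 i)//= [RHS](bigD1 i)//= !mxE eqxx.
under eq_bigr => j /negPf ji do rewrite mxE ji.
under [X in _ + _ * X]eq_bigr => j /negPf ji do rewrite mxE ji.
rewrite -mulrDl; congr (_ * _).
rewrite -/(0 : 'I_1); move: (b 0 i) (a 0 i) => y x; rewrite /Order.max /Order.min.
by case: (ltP y c) => ?; case: (ltP x c) => ?; do 3 ?[case: ltP => ?]; lra.
Qed.

(** A half-space cuts a box into two boxes whose volumes add up, so that it
    splits every cover without loss: this is the criterion of Caratheodory. *)
Lemma measurable_halfspace (i : 'I_n) (c : R) :
  @measurable _ (Leb_type R n) [set x | x 0 i <= c].
Proof.
apply: (@le_caratheodory_measurable _ _ (lebesgue_outer_measure R n)) => X.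
apply: le_ereal_inf_tmp => _ [F /= XF <-].
under eq_eseriesr => k _ do rewrite -(box_vol_split i c).
rewrite nneseriesD; try by move=> *; exact: box_vol_ge0.
apply: leeD; apply: ereal_inf_lbound.
  exists (fun k => box_le i c (F k)) => //= x [/XF[k _ Fx] xc].
  by exists k => //; exact: sub_box_le.
exists (fun k => box_ge i c (F k)) => //= x [/XF[k _ Fx] /= /negP xc].
by exists k => //; apply: sub_box_ge; split => //=; rewrite ltW// ltNge.
Qed.

Lemma measurable_box B : measurable (box B : set (Leb_type R n)).
Proof.
case: B => [[a b]|]; last exact: measurable0.
have mge (i : 'I_n) (c : R) : @measurable _ (Leb_type R n) [set x | c <= x 0 i].
  apply: (@eq_measurable _ (Leb_type R n) _
      (~` \bigcup_k [set x | x 0 i <= c - k.+1%:R^-1])); last first.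
    by apply/measurableC/bigcup_measurable => k _; exact: measurable_halfspace.
  apply/seteqP; split => x /=.
    move=> cx [k _ /= xk]; have := le_trans cx xk.
    by rewrite leNgt ltrBlDr ltrDl invr_gt0 ltr0n.
  move=> xn; rewrite leNgt; apply/negP => xc; apply: xn.
  have [k] := ltr_add_invr xc; rewrite -ltrBrDr => /ltW xk.
  by exists k.
apply: (@eq_measurable _ (Leb_type R n) _ (\bigcap_(i in [set: 'I_n])
    ([set x | a 0 i <= x 0 i] `&` [set x | x 0 i <= b 0 i]))).
  by apply/seteqP; split => [x xb i _|x xb i]; [have /andP[] := xb i|
    have [//= ? ?] := xb i I; apply/andP].
apply: fin_bigcap_measurable => // i _.
by apply: measurableI; [exact: mge|exact: measurable_halfspace].
Qed.

Lemma closed_box B : closed (box B : set 'rV[R]_n).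
Proof.
case: B => [[a b]|]; last exact: closed0.
have -> : box (Some (a, b)) = \bigcap_(i in [set: 'I_n])
    ((fun x => x 0 i) @^-1` `[a 0 i, b 0 i]%classic).
  apply/seteqP; split => [x xb i _|x xb i]; first by rewrite /= in_itv/= xb.
  by have /= := xb i I; rewrite in_itv.
apply: closed_bigI => i _; apply: preimage_closed; last exact: itv_closed.
by move=> x _; exact: coord_continuous.
Qed.

Lemma measurable_fun_id_borel :
  measurable_fun setT (id : Leb_type R n -> Borel_type R n).
Proof. by apply: measurable_fun_borel => a b; exact: measurable_box. Qed.

Lemma measurable_borel (A : set 'rV[R]_n) : measurable (A : set (Borel_type R n)) ->
  measurable (A : set (Leb_type R n)).
Proof. by move=> mA; have := measurable_fun_id_borel measurableT mA; rewrite setTI. Qed.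

Lemma open_borel (A : set 'rV[R]_n) : open A -> measurable (A : set (Borel_type R n)).
Proof. exact: sub_gen_smallest. Qed.

Lemma closed_borel (A : set 'rV[R]_n) : closed A -> measurable (A : set (Borel_type R n)).
Proof.
move=> cA; apply: (@eq_measurable _ (Borel_type R n) _ (~` ~` A)).
  by rewrite setCK.
have oA : @open 'rV[R]_n (~` A) by exact: closed_openC.
by apply: measurableC; exact: open_borel.
Qed.

Lemma measurable_fun_borel_leb (h : 'rV[R]_n -> \bar R) : borel_fun h ->
  measurable_fun [set: Leb_type R n] h.
Proof. by move=> mh; exact: (measurableT_comp mh measurable_fun_id_borel). Qed.

Lemma lebesgue_rV_box_le B : (lebesgue_rV R n (box B) <= box_vol B)%E.
Proof.
apply: ereal_inf_lbound; exists (fun k => if k == 0%N then B else None).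
  by move=> x Bx; exists 0%N.
rewrite (nneseries_split 0 1)//=; last by move=> *; exact: box_vol_ge0.
rewrite big_nat_recl//= big_geq// adde0 eseries0 ?adde0// => k /=.
by case: k.
Qed.

(** Lebesgue measure is the largest measure that gives every box at most its
    volume, so that integrals are compared by computing on boxes only.  The
    inequalities of Tonelli and for homotheties are instances. *)
Lemma le_integral_lebesgue d (T : measurableType d)
    (mu : {measure set T -> \bar R}) (phi : T -> 'rV[R]_n) (C : R) :
  0 < C ->
  (forall a b, measurable (phi @^-1` box (Some (a, b)))) ->
  (forall a b, mu (phi @^-1` box (Some (a, b))) <=
    C%:E * box_vol (Some (a, b)))%E ->
  forall h : 'rV[R]_n -> \bar R, borel_fun h -> (forall x, 0 <= h x)%E ->
    (\int[mu]_x h (phi x) <= C%:E * \int[lebesgue_rV R n]_x h x)%E.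
Proof.
move=> C0 mbox mubox h mh h0.
have mphi := measurable_fun_borel mbox.
pose nu0 : {measure set (Borel_type R n) -> \bar R} :=
  pushforward mu (phi : T -> Borel_type R n).
pose la0 : {measure set (Borel_type R n) -> \bar R} :=
  pushforward (lebesgue_rV R n) (id : Leb_type R n -> Borel_type R n).
pose nu := nu0 mphi; pose la := la0 measurable_fun_id_borel.
have C0' : (0 <= C)%R by exact: ltW.
pose Cla : {measure set (Borel_type R n) -> \bar R} := mscale (NngNum C0') la.
have nula S : measurable S -> (nu S <= Cla S)%E.
  move=> mS; rewrite /Cla/= /mscale/= -lee_pdivrMl//.
  apply: le_ereal_inf_tmp => _ [F /= SF <-].
  rewrite lee_pdivrMl// -nneseriesZl; last by move=> *; exact: box_vol_ge0.
  have mF k : measurable (box (F k) : set (Borel_type R n)).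
    by apply: closed_borel; exact: closed_box.
  apply: le_trans (measure_sigma_subadditive nu mF mS SF) _.
  apply: lee_nneseries => // k _.
  case: (F k) => [[a b]|] //=; first exact: mubox.
  by rewrite mule0 /pushforward preimage_set0 measure0.
rewrite -(@ge0_integral_pushforward _ _ _ _ _ _ mphi mu setT h)//.
have -> : (\int[lebesgue_rV R n]_x h x = \int[la]_x h x)%E.
  by rewrite (@ge0_integral_pushforward _ _ _ _ _ _ measurable_fun_id_borel).
have <- : (\int[Cla]_x h x = C%:E * \int[la]_x h x)%E.
  exact: (@ge0_integral_mscale _ _ _ la setT measurableT (NngNum C0')).
exact: (@ge0_le_measure_integral _ _ _ nu Cla nula).
Qed.

End LebesgueBoxes.

(** * Slices by coordinate hyperplanes *)

Section LebesgueSlices.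
Context {R : realType}.
Local Open Scope ereal_scope.

Lemma lebesgue_measure_itvcc (a b : R) :
  @lebesgue_measure R `[a, b]%classic = (Num.max 0 (b - a))%:E.
Proof.
rewrite lebesgue_measure_itv/= lte_fin; case: ifPn => [ab|].
  by rewrite -EFinD; congr EFin; apply/esym/max_idPr; rewrite subr_ge0 ltW.
by rewrite -leNgt => ba; congr EFin; apply/esym/max_idPl; rewrite subr_le0.
Qed.

Lemma lebesgue_rV_sigma_finite m : sigma_finite setT (lebesgue_rV R m).
Proof.
exists (fun k => box (Some (const_mx (- k%:R)%R, const_mx k%:R%R))).
  apply/seteqP; split => // x _.
  have [k xk] : exists k, forall i, (`|x ord0 i| <= k%:R)%R.
    exists (\max_i Num.bound `|x ord0 i|) => i; apply: ltW.
    apply: (lt_le_trans (archi_boundP (normr_ge0 _))).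
    by rewrite ler_nat; exact: leq_bigmax.
  by exists k => // i; rewrite !mxE -ler_norml.
move=> k; split; first exact: measurable_box.
by apply: (le_lt_trans (lebesgue_rV_box_le _)); rewrite /= ltry.
Qed.

(** The measure with a name of its own, to which the sigma-finite structure
    that Tonelli's theorem requires can be attached. *)
Definition lebesgue_sf m : set (Leb_type R m) -> \bar R := lebesgue_rV R m.
Arguments lebesgue_sf : clear implicits.

HB.instance Definition _ m := Measure.copy (lebesgue_sf m) (lebesgue_rV R m).
HB.instance Definition _ m := Measure_isSigmaFinite.Build _ _ _
  (lebesgue_sf m) (lebesgue_rV_sigma_finite m).

Definition insert_coord m (i : 'I_m.+1) (t : R) (w : 'rV[R]_m) : 'rV[R]_m.+1 :=
  \row_j if unlift i j is Some k then w ord0 k else t.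

Lemma insert_coordE m (i : 'I_m.+1) t (w : 'rV[R]_m) : insert_coord i t w ord0 i = t.
Proof. by rewrite mxE unlift_none. Qed.

Lemma insert_coord_lift m (i : 'I_m.+1) t (w : 'rV[R]_m) k :
  insert_coord i t w ord0 (lift i k) = w ord0 k.
Proof. by rewrite mxE liftK. Qed.

Definition remove_coord m (i : 'I_m.+1) (x : 'rV[R]_m.+1) : 'rV[R]_m :=
  \row_k x ord0 (lift i k).

Lemma insert_coordK m (i : 'I_m.+1) (x : 'rV[R]_m.+1) :
  insert_coord i (x ord0 i) (remove_coord i x) = x.
Proof.
apply/rowP => j; rewrite !mxE; case: unliftP => [k ->|->] //.
by rewrite mxE.
Qed.

Lemma preimage_insert_coord_box m (i : 'I_m.+1) (a b : 'rV[R]_m.+1) :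
  (fun p : R * 'rV[R]_m => insert_coord i p.1 p.2) @^-1` box (Some (a, b)) =
  `[a ord0 i, b ord0 i]%classic `*`
    box (Some (remove_coord i a, remove_coord i b)).
Proof.
apply/seteqP; split => [[t w]/= tw|[t w]/= [it iw] j].
  split; first by have := tw i; rewrite insert_coordE in_itv.
  by move=> k; rewrite !mxE; have := tw (lift i k); rewrite insert_coord_lift.
rewrite !mxE; case: unliftP => [k ->|->]; last by move: it; rewrite in_itv.
by have := iw k; rewrite !mxE.
Qed.

Lemma measurable_preimage_insert_coord m (i : 'I_m.+1) (a b : 'rV[R]_m.+1) :
  measurable ((fun p : R * Leb_type R m => insert_coord i p.1 p.2) @^-1`
    box (Some (a, b))).
Proof.
by rewrite preimage_insert_coord_box; apply: measurableX => //; exact: measurable_box.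
Qed.

Lemma measurable_insert_coord m (i : 'I_m.+1) (h : 'rV[R]_m.+1 -> \bar R) :
  borel_fun h ->
  measurable_fun setT (fun p : R * Leb_type R m => h (insert_coord i p.1 p.2)).
Proof.
move=> mh; apply: (measurableT_comp mh (measurable_fun_borel _)) => a b.
exact: measurable_preimage_insert_coord.
Qed.

Lemma box_vol_insert_coord m (i : 'I_m.+1) (a b : 'rV[R]_m.+1) :
  box_vol (Some (a, b)) =
  (Num.max 0 (b ord0 i - a ord0 i))%:E *
    box_vol (Some (remove_coord i a, remove_coord i b)).
Proof.
rewrite /= -EFinM; congr EFin; rewrite (bigD1_ord i)//=; congr *%R.
by apply: eq_bigr => k _; rewrite !mxE.
Qed.

Lemma measurable_slice_integral m (i : 'I_m.+1) (h : 'rV[R]_m.+1 -> \bar R) :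
  borel_fun h -> (forall x, 0 <= h x) ->
  measurable_fun setT (fun t => \int[lebesgue_rV R m]_w h (insert_coord i t w)).
Proof.
move=> mh h0; pose f (p : R * Leb_type R m) := h (insert_coord i p.1 p.2).
have mf : measurable_fun setT f by exact: measurable_insert_coord.
exact: (@measurable_fun_fubini_tonelli_F _ _ _ _ _ (lebesgue_sf m) f mf
  (fun=> h0 _)).
Qed.

(** The product of the measures on the two factors gives a box at most its
    volume, and [le_integral_lebesgue] applies. *)
Lemma tonelli_slice_le m (i : 'I_m.+1) (h : 'rV[R]_m.+1 -> \bar R) :
  borel_fun h -> (forall x, 0 <= h x) ->
  \int[@lebesgue_measure R]_t \int[lebesgue_rV R m]_w h (insert_coord i t w)
    <= \int[lebesgue_rV R m.+1]_x h x.
Proof.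
move=> mh h0; pose f (p : R * Leb_type R m) := h (insert_coord i p.1 p.2).
have mf : measurable_fun setT f by exact: measurable_insert_coord.
have := @fubini_tonelli1 _ _ _ _ _ (@lebesgue_measure R) (lebesgue_sf m) f mf
  (fun=> h0 _).
rewrite /fubini_F => <-.
rewrite -[leRHS]mul1e.
apply: (@le_integral_lebesgue _ _ _ _ ((@lebesgue_measure R) \x (lebesgue_sf m))
  (fun p => insert_coord i p.1 p.2) 1%R) => //.
  by move=> a b; exact: measurable_preimage_insert_coord.
move=> a b; have mB := measurable_box (Some (remove_coord i a, remove_coord i b)).
have mI : measurable (`[a ord0 i, b ord0 i]%classic : set R) by [].
apply: (@le_trans _ _ (((@lebesgue_measure R) \x (lebesgue_sf m))
    (`[a ord0 i, b ord0 i]%classic `*`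
     box (Some (remove_coord i a, remove_coord i b))))).
  by rewrite -preimage_insert_coord_box.
apply: (@le_trans _ _ (@lebesgue_measure R `[a ord0 i, b ord0 i]%classic *
    lebesgue_rV R m (box (Some (remove_coord i a, remove_coord i b))))).
  rewrite le_eqVlt; apply/predU1P; left.
  exact: (@product_measure1E _ _ _ _ _ (@lebesgue_measure R) (lebesgue_sf m)).
rewrite mul1e (box_vol_insert_coord i).
apply: lee_pmul => //; last exact: lebesgue_rV_box_le.
by rewrite lebesgue_measure_itvcc.
Qed.

(** By induction on the dimension: all slices of a box have the same measure,
    and integrating it over their heights bounds the measure of the box from
    below. *)
Lemma lebesgue_rV_box m (B : option ('rV[R]_m * 'rV[R]_m)) :
  lebesgue_rV R m (box B) = box_vol B.
Proof.
apply/eqP; rewrite eq_le lebesgue_rV_box_le/=.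
case: B => [[a b]|]; last exact: lebesgue_outer_ge0.
elim: m a b => [|m ih] a b.
  rewrite /= big_ord0; apply: le_ereal_inf_tmp => _ [F /= XF <-].
  have [k _ Fk] : (\bigcup_k box (F k)) a by apply: XF => -[].
  rewrite (nneseries_split 0 k.+1)//; last by move=> *; exact: box_vol_ge0.
  rewrite add0n big_nat_recr//=.
  have -> : box_vol (F k) = 1 by move: Fk; case: (F k) => [[c d]|]//= _; rewrite big_ord0.
  rewrite -addeA -addeCA leeDl// adde_ge0//.
    by apply: sume_ge0 => *; exact: box_vol_ge0.
  by apply: nneseries_ge0 => *; exact: box_vol_ge0.
have mB : measurable (box (Some (a, b)) : set (Borel_type R m.+1)).
  by apply: closed_borel; exact: closed_box.
have mI : borel_fun (EFin \o \1_(box (Some (a, b)))).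
  exact/measurable_EFinP/measurable_indic.
have I0 x : 0 <= (EFin \o \1_(box (Some (a, b)))) x :> \bar R by rewrite /= lee_fin.
have := tonelli_slice_le ord0 mI I0.
have := @integral_indic _ (Leb_type R m.+1) R (lebesgue_rV R m.+1) setT
  measurableT _ (measurable_box (Some (a, b))).
rewrite setIT => ->; apply: le_trans.
rewrite (box_vol_insert_coord ord0).
have B'0 := @measure_ge0 _ _ _ (lebesgue_rV R m) (box (Some (remove_coord ord0 a, remove_coord ord0 b))).
apply: (@le_trans _ _ (\int[@lebesgue_measure R]_(t in `[a ord0 ord0, b ord0 ord0])
  (lebesgue_rV R m (box (Some (remove_coord ord0 a, remove_coord ord0 b)))))).
  rewrite integral_cst// [leRHS]muleC; apply: lee_pmul.
  - by rewrite lee_fin le_max lexx.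
  - exact: box_vol_ge0.
  - by have := lebesgue_measure_itvcc (a ord0 ord0) (b ord0 ord0) => <-.
  - exact: ih.
rewrite integral_mkcond; apply: ge0_le_integral => //.
- by move=> t _; rewrite patchE; case: ifP.
- by apply/measurable_restrict => //; exact: measurable_cst.
- exact: (measurable_slice_integral ord0 mI I0).
move=> t _; rewrite patchE; case: ifPn => [|_]; last first.
  by apply: integral_ge0 => w _; rewrite lee_fin.
rewrite inE => tab.
have := @integral_indic _ (Leb_type R m) R (lebesgue_rV R m) setT measurableT _
  (measurable_box (Some (remove_coord ord0 a, remove_coord ord0 b))).
rewrite setIT => <-; rewrite le_eqVlt; apply/predU1P; left.
apply: eq_integral => w _; rewrite -[RHS]/(\1_(box (Some (a, b))) _)%:E !indicE.
have E : box (Some (a, b)) (insert_coord ord0 t w) =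
    (`[a ord0 ord0, b ord0 ord0]%classic `*`
      box (Some (remove_coord ord0 a, remove_coord ord0 b))) (t, w).
  by rewrite -preimage_insert_coord_box.
have [wB|wB] := pselect (box (Some (remove_coord ord0 a, remove_coord ord0 b)) w).
  by rewrite !mem_set// E.
by rewrite !memNset//; rewrite E => -[].
Qed.

Lemma integral_homothety_le m (x : 'rV[R]_m) (tau : R)
    (h : 'rV[R]_m -> \bar R) : (0 < tau)%R ->
  borel_fun h -> (forall x, 0 <= h x) ->
  \int[lebesgue_rV R m]_w h (x + tau *: (w - x))%R
    <= (tau ^- m)%:E * \int[lebesgue_rV R m]_w h w.
Proof.
move=> tau0 mh h0.
have pre (a b : 'rV[R]_m) : (fun w => x + tau *: (w - x))%R @^-1` box (Some (a, b)) =
    box (Some (x + tau^-1 *: (a - x), x + tau^-1 *: (b - x))%R).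
  have e1 (c d y : R) : (c <= d + tau * (y - d) = (d + tau^-1 * (c - d) <= y))%R.
    by rewrite -lerBlDl -ler_pdivrMl// -[RHS]lerBrDl.
  have e2 (c d y : R) : (d + tau * (y - d) <= c = (y <= d + tau^-1 * (c - d)))%R.
    by rewrite -lerBrDl -ler_pdivlMl// -[RHS]lerBlDl.
  by apply/seteqP; split => w /= wab j; have := wab j; rewrite !mxE e1 e2.
apply: le_integral_lebesgue => //.
- by rewrite invr_gt0 exprn_gt0.
- by move=> a b; rewrite pre; exact: measurable_box.
move=> a b; rewrite pre; apply: (le_trans (lebesgue_rV_box_le _)).
have -> : (tau ^- m = \prod_(i < m) tau^-1)%R by rewrite prodr_const card_ord exprVn.
rewrite /= -EFinM lee_fin -big_split/=.
rewrite le_eqVlt; apply/predU1P; left; apply: eq_bigr => i _.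
rewrite !mxE maxr_pMr ?invr_ge0 ?ltW// mulr0; congr Num.max; ring.
Qed.

End LebesgueSlices.

(** * Line integrals along Lipschitz paths *)

Section LipschitzPaths.
Context {R : realType}.
Local Open Scope ereal_scope.

Lemma le_integral_lebesgue1 d (T : measurableType d)
    (mu : {measure set T -> \bar R}) (phi : T -> R) (C : R) :
  (0 < C)%R -> measurable_fun setT phi ->
  (forall x y : R, (x < y)%R ->
     mu (phi @^-1` `]x, y]%classic) <= C%:E * (y - x)%:E) ->
  forall h : R -> \bar R, measurable_fun setT h -> (forall x, 0 <= h x) ->
    \int[mu]_x h (phi x) <= C%:E * \int[@lebesgue_measure R]_x h x.
Proof.
move=> C0 mphi muphi h mh h0.
have C0' : (0 <= C)%R by exact: ltW.
pose nu0 : {measure set (measurableTypeR R) -> \bar R} :=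
  pushforward mu (phi : T -> measurableTypeR R).
pose nu := nu0 mphi.
pose Cla : {measure set (measurableTypeR R) -> \bar R} :=
  mscale (NngNum C0') (@lebesgue_measure R).
have nula S : measurable S -> nu S <= Cla S.
  move=> mS; rewrite /Cla/= /mscale/= -lee_pdivrMl//.
  apply: le_ereal_inf_tmp => _ [F /= [mF SF] <-].
  rewrite lee_pdivrMl// -nneseriesZl; last by move=> *; exact: wlength_ge0.
  have mF' k : measurable (F k : set R) by apply: sub_sigma_algebra; exact: mF.
  apply: le_trans (measure_sigma_subadditive nu mF' mS SF) _.
  apply: lee_nneseries => // k _.
  have /ocitvP[->|[[x y] /= xy ->]] := mF k.
    by rewrite wlength0 mule0 measure0.
  rewrite wlength_itv/= lte_fin xy -EFinB; exact: muphi.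
rewrite -(@ge0_integral_pushforward _ _ T (measurableTypeR R) R phi mphi mu setT h)//.
have <- : (\int[Cla]_x h x = C%:E * \int[@lebesgue_measure R]_x h x)%E.
  exact: (@ge0_integral_mscale _ _ _ (@lebesgue_measure R) setT measurableT (NngNum C0')).
exact: (@ge0_le_measure_integral _ (measurableTypeR R) _ nu Cla nula h setT).
Qed.

Context {n : nat}.
Implicit Types (gamma : R -> 'rV[R]_n).

Definition lipschitz_on gamma (a b L : R) :=
  forall s t, (a <= s <= b)%R -> (a <= t <= b)%R ->
    (eucl_dist (gamma s) (gamma t) <= L * `|s - t|)%R.

Lemma lipschitz_on_continuous gamma a b L : lipschitz_on gamma a b L ->
  {within `[a, b], continuous gamma}.
Proof.
move=> lip; apply/subspace_continuousP => t; rewrite /= in_itv/= => tab.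
move=> U /nbhs_eucl_dist[e e0 eU].
have L10 : (0 < `|L| + 1)%R by rewrite ltr_wpDl.
apply/nbhs_ballP; exists (e / (`|L| + 1))%R; first by rewrite /= divr_gt0.
move=> s /= ts; rewrite in_itv/= => sab; apply: eU.
apply: (le_lt_trans (lip _ _ tab sab)).
apply: (@le_lt_trans _ _ ((`|L| + 1) * `|t - s|)%R).
  by rewrite ler_wpM2r// (le_trans (ler_norm L))// lerDl.
by rewrite mulrC -ltr_pdivlMr.
Qed.

Lemma path_length_lipschitz gamma a b L : (a <= b)%R -> (0 <= L)%R ->
  lipschitz_on gamma a b L ->
  path_length gamma a b <= (L * (b - a))%:E.
Proof.
move=> ab L0 lip; apply: path_length_le => s sab; rewrite lee_fin.
suff h c : (a <= c)%R -> itv_partition c b s ->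
    (polygon_length gamma c s <= L * (b - c))%R by exact: h.
elim: s {sab} c => [|x s ih] c ac scb.
  by rewrite polygon_length_nil mulr_ge0// subr_ge0 (itv_partition_le scb).
have cb := itv_partition_le scb.
have [/= /andP[cx xs] sb] := scb; have sxb : itv_partition x b s by [].
have xb := itv_partition_le sxb; have ax : (a <= x)%R by rewrite (le_trans ac)// ltW.
rewrite polygon_length_cons (le_trans (lerD (lip _ _ _ _) (ih _ ax sxb)))//.
- by rewrite ac.
- by rewrite ax.
by rewrite ltr0_norm ?subr_lt0// -mulrDr opprB addrC addrA subrK.
Qed.

Lemma lipschitz_on_sub gamma a b L c d : (a <= c)%R -> (d <= b)%R ->
  lipschitz_on gamma a b L -> lipschitz_on gamma c d L.
Proof.
move=> ac db lip s t /andP[cs sd] /andP[ct td]; apply: lip.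
  by rewrite (le_trans ac cs) (le_trans sd db).
by rewrite (le_trans ac ct) (le_trans td db).
Qed.

Definition clamp (a b t : R) := Num.min (Num.max a t) b.

Lemma clamp_id a b t : (a <= t <= b)%R -> clamp a b t = t.
Proof. by move=> /andP[a_t tb]; rewrite /clamp (max_idPr a_t) (min_idPl tb). Qed.

Lemma clamp_itv a b t : (a <= b)%R -> (a <= clamp a b t <= b)%R.
Proof. by move=> ab; rewrite /clamp le_min ab le_max lexx/= ge_min lexx orbT. Qed.

Lemma le_clamp a b s t : (s <= t)%R -> (clamp a b s <= clamp a b t)%R.
Proof.
move=> st; rewrite /clamp le_min ge_min; apply/andP; split.
  by rewrite ge_max !le_max lexx st !orbT.
by rewrite ge_min lexx orbT.
Qed.

Lemma clamp_dist a b s t : (`|clamp a b s - clamp a b t| <= `|s - t|)%R.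
Proof.
wlog st : s t / (s <= t)%R.
  move=> wl; have [/wl//|/ltW/wl] := leP s t.
  by rewrite distrC (distrC t).
rewrite !ler0_norm ?subr_le0 ?le_clamp//.
rewrite /clamp /Order.max /Order.min.
case: (ltP a s) => ?; case: (ltP a t) => ?; do 2 ?[case: ltP => ?]; lra.
Qed.

Lemma measurable_borel_path gamma a b L (rho : 'rV[R]_n -> \bar R) :
  (a <= b)%R -> lipschitz_on gamma a b L -> borel_fun rho ->
  measurable_fun setT (fun t => rho (gamma (clamp a b t))).
Proof.
move=> ab lip mrho; have cg : continuous (gamma \o clamp a b).
  move=> t U /nbhs_eucl_dist[e e0 eU].
  have L10 : (0 < `|L| + 1)%R by rewrite ltr_wpDl.
  apply/nbhs_ballP; exists (e / (`|L| + 1))%R; first by rewrite /= divr_gt0.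
  move=> s /= ts; apply: eU.
  apply: (le_lt_trans (lip _ _ (clamp_itv _ ab) (clamp_itv _ ab))).
  apply: (@le_lt_trans _ _ ((`|L| + 1) * `|t - s|)%R).
    apply: (@le_trans _ _ ((`|L| + 1) * `|clamp a b t - clamp a b s|)%R).
      by rewrite ler_wpM2r// (le_trans (ler_norm L))// lerDl.
    by rewrite ler_wpM2l ?clamp_dist// ltW.
  by rewrite mulrC -ltr_pdivlMr.
apply: (measurableT_comp mrho (measurable_fun_borel _)) => x y.
apply: closed_measurable; apply: preimage_closed; last exact: closed_box.
by move=> t _; exact: cg.
Qed.

(** As [L] bounds the speed, the time at which a given length is reached grows at
    least by [1 / L] per unit of length.  Hence this function of the length
    pushes Lebesgue measure forward to a measure that gives every interval at
    most [L] times its length. *)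
Lemma segment_integral_lipschitz gamma (a b L : R) (rho : 'rV[R]_n -> \bar R) :
  (a <= b)%R -> (0 < L)%R -> lipschitz_on gamma a b L ->
  borel_fun rho -> (forall x, 0 <= rho x) ->
  segment_integral rho gamma a b <=
    L%:E * \int[@lebesgue_measure R]_(t in `[a, b]) rho (gamma t).
Proof.
move=> ab L0 lip mrho rho0; have cg := lipschitz_on_continuous lip.
have plt : path_length gamma a b < +oo.
  by rewrite (le_lt_trans (path_length_lipschitz ab (ltW L0) lip))// ltry.
have fin c d : (a <= c)%R -> (c <= d)%R -> (d <= b)%R ->
    path_length gamma c d \is a fin_num.
  move=> ac cd db; rewrite ge0_fin_numE ?path_length_ge0//.
  apply: le_lt_trans plt; apply: (@le_trans _ _ (path_length gamma a d)).
    by rewrite (path_lengthD gamma ac cd) leeDr// path_length_ge0.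
  by apply: le_path_length => //; exact: le_trans ac cd.
pose len := fine (path_length gamma a b).
have len0 : (0 <= len)%R by rewrite fine_ge0// path_length_ge0.
pose theta u : R :=
  get [set t | (a <= t <= b)%R /\ path_length gamma a t = u%:E].
have thetaP (u : R) : (0 <= u <= len)%R ->
    (a <= theta u <= b)%R /\ path_length gamma a (theta u) = u%:E.
  by move=> ulen; exact: (getPex (path_length_surjective ab cg ulen)).
have theta_exp (u v : R) : (0 <= u <= len)%R -> (0 <= v <= len)%R -> (u <= v)%R ->
    (v - u <= L * (theta v - theta u))%R.
  move=> ulen vlen uv; have [/andP[au ub] lu] := thetaP u ulen.
  have [/andP[av vb] lv] := thetaP v vlen.
  have tuv : (theta u <= theta v)%R.
    rewrite leNgt; apply/negP => tvu.
    have := le_path_length gamma av (ltW tvu); rewrite lu lv lee_fin => vu.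
    have uv' : u = v by apply/eqP; rewrite eq_le uv vu.
    by rewrite uv' ltxx in tvu.
  have := path_lengthD gamma au tuv; rewrite lu lv.
  have := path_length_lipschitz tuv (ltW L0) (lipschitz_on_sub au vb lip).
  rewrite -(fineK (fin _ _ au tuv vb)) lee_fin -EFinD => h [vE].
  by rewrite lerBlDl [leLHS]vE lerD2l.
(* [theta] is continued with slope [1 / L] to a monotone function on the line *)
pose phi u := (theta (clamp 0 len u) + (u - clamp 0 len u) / L)%R.
have phi_exp u v : (u <= v)%R -> (v - u <= L * (phi v - phi u))%R.
  move=> uv; have := theta_exp _ _ (clamp_itv u len0) (clamp_itv v len0) (le_clamp 0 len uv).
  rewrite /phi => h.
  have -> : (L * (theta (clamp 0 len v) + (v - clamp 0 len v) / L -
     (theta (clamp 0 len u) + (u - clamp 0 len u) / L)) =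
     L * (theta (clamp 0 len v) - theta (clamp 0 len u)) +
     (v - clamp 0 len v) - (u - clamp 0 len u))%R by field; rewrite gt_eqF.
  by lra.
have phi_homo : {homo phi : u v / (u <= v)%R}.
  move=> u v uv; rewrite -subr_ge0 -(pmulr_rge0 _ L0).
  by apply: le_trans (phi_exp _ _ uv); rewrite subr_ge0.
have mphi : measurable_fun setT phi by exact: nondecreasing_measurable.
pose h := (fun t => rho (gamma (clamp a b t))) \_ `[a, b].
have mh : measurable_fun setT h.
  apply/(measurable_restrictT _ _).1 => //.
  apply: (@measurable_funS _ _ _ _ setT) => //.
  exact: measurable_borel_path lip mrho.
have h0 t : 0 <= h t by rewrite /h patchE; case: ifP.
have muphi (x y : R) : (x < y)%R ->
    @lebesgue_measure R (phi @^-1` `]x, y]%classic) <= L%:E * (y - x)%:E.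
  move=> xy; pose I := phi @^-1` `]x, y]%classic; rewrite -/I -EFinM.
  have d0 : (0 <= L * (y - x))%R by rewrite mulr_ge0 ?subr_ge0 ?ltW.
  have [->|/set0P[u0 Iu0]] := eqVneq I set0; first by rewrite measure0 lee_fin.
  have IE u : I u = (x < phi u <= y)%R :> Prop by rewrite /I/= in_itv.
  have itvI : is_interval I.
    move=> u v; rewrite !IE => /andP[xu uy] /andP[xv vy] w /andP[uw wv].
    by rewrite IE (lt_le_trans xu)/= ?phi_homo// (le_trans _ vy)// phi_homo.
  have diamI u v : I u -> I v -> (v - u <= L * (y - x))%R.
    have [uv|/ltW vu] := leP u v; last first.
      by move=> _ _; apply: le_trans d0; rewrite subr_le0.
    rewrite !IE => /andP[xu uy] /andP[xv vy].
    apply: (le_trans (phi_exp _ _ uv)); rewrite ler_pM2l//.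
    by rewrite lerB// ltW.
  have infI : has_inf I.
    by split; [exists u0|exists (u0 - L * (y - x))%R => v /diamI/(_ Iu0); lra].
  have II : I `<=` `[inf I, (inf I + L * (y - x))%R]%classic.
    move=> u Iu; rewrite /= in_itv/=; apply/andP; split.
      by apply: ge_inf => //; exact: infI.2.
    rewrite -lerBlDr; apply: lb_le_inf; first by exists u0.
    by move=> v /diamI/(_ Iu); lra.
  have mI : measurable (I : set R) by exact: is_interval_measurable.
  apply: (@le_trans _ _ (@lebesgue_measure R
     `[inf I, (inf I + L * (y - x))%R]%classic)).
    by apply: le_measure; rewrite ?inE.
  by rewrite lebesgue_measure_itvcc addrAC subrr add0r lee_fin ge_max d0 lexx.
have := @le_integral_lebesgue1 _ (measurableTypeR R) (@lebesgue_measure R) phi L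
  L0 mphi muphi h mh h0.
have -> : \int[@lebesgue_measure R]_(t in `[a, b]) rho (gamma t) =
    \int[@lebesgue_measure R]_t h t.
  rewrite integral_mkcond; apply: eq_integral => t _; rewrite /h !patchE.
  by case: ifPn => //; rewrite inE/= in_itv/= => tab; rewrite clamp_id.
apply: le_trans.
apply: (@le_trans _ _ (\int[@lebesgue_measure R]_(u in `[0%R, len]) h (phi u))).
  rewrite le_eqVlt; apply/predU1P; left; apply: eq_integral => u.
  rewrite inE/= in_itv/= => ulen; have [tab _] := thetaP u ulen.
  by rewrite /h /phi clamp_id// subrr mul0r addr0 patchE mem_set/= ?in_itv//= clamp_id.
apply: ge0_subset_integral => //.
exact: (measurableT_comp mh mphi).
Qed.

End LipschitzPaths.

(** * Pencils of segments *)

Section Pencils.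
Context {R : realType}.
Local Open Scope ereal_scope.

(** An antiderivative is available away from [0], and the intervals
    [[1 / (k + 2), 1]] exhaust the domain of integration. *)
Lemma integral_power_singularity (a : R) : (0 < a)%R ->
  \int[@lebesgue_measure R]_(t in `]0%R, 1%R]) (a * t `^ (a - 1))%:E <= 1.
Proof.
move=> a0; pose F k := `[(k.+2%:R^-1)%R : R, 1%R]%classic.
pose f (t : R) := (a * t `^ (a - 1))%R.
have inv0 k : (0 < k.+2%:R^-1 :> R)%R by rewrite invr_gt0.
have inv1 k : (k.+2%:R^-1 < 1 :> R)%R by rewrite invf_lt1 ?ltr1n.
have mf : measurable_fun setT (EFin \o f).
  have mp := measurable_powR (a - 1)%R.
  by apply/measurable_EFinP; apply: measurable_funM.
have f0 t : (0 <= f t)%R by rewrite mulr_ge0 ?powR_ge0// ltW.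
have cpowR (b t : R) : (0 < t)%R -> {for t, continuous (fun t => t `^ b)%R}.
  move=> t0; apply: differentiable_continuous; apply/derivable1_diffP.
  by have [] := is_derive1_powR b t0.
have Fle k : \int[@lebesgue_measure R]_(t in F k) (f t)%:E <= 1.
  rewrite /F (@continuous_FTC2 _ f (fun t => t `^ a)%R)//.
  - by rewrite powR1 -EFinB lee_fin gerBl powR_ge0.
  - apply: continuous_in_subspaceT => t /[!inE]/= /[!in_itv]/= /andP[kt _].
    apply: cvgM; first exact: cvg_cst.
    by apply: cpowR; exact: lt_le_trans kt.
  - split.
    + move=> t; rewrite in_itv/= => /andP[kt _].
      by have [] := is_derive1_powR a (lt_trans (inv0 k) kt).
    + by apply: cvg_at_right_filter; exact: cpowR.
    + by apply: cvg_at_left_filter; exact: cpowR.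
  - move=> t; rewrite in_itv/= => /andP[kt _].
    have t0 := lt_trans (inv0 k) kt.
    by rewrite powR_derive1// in_itv/= t0.
have -> : `]0%R, 1%R]%classic = \bigcup_k F k.
  apply/seteqP; split => [t|t [k _]]; rewrite /F/= !in_itv/=.
    move=> /andP[t0 t1]; have [k] := ltr_add_invr t0; rewrite add0r => kt.
    exists k => //; rewrite /= in_itv/= t1 andbT (le_trans _ (ltW kt))//.
    by rewrite lef_pV2 ?posrE// ler_nat.
  by move=> /andP[kt ->]; rewrite (lt_le_trans (inv0 k) kt).
have cvgF := @ge0_nondecreasing_set_cvg_integral _ (measurableTypeR R) _ F (EFin \o f) (@lebesgue_measure R).
have {}cvgF : \int[@lebesgue_measure R]_(t in F k) (f t)%:E @[k --> \oo] -->
    \int[@lebesgue_measure R]_(t in \bigcup_k F k) (f t)%:E.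
  apply: cvgF => //.
  - move=> i j ij; apply/subsetPset => t; rewrite /F/= !in_itv/= => /andP[it ->].
    by rewrite andbT (le_trans _ it)// lef_pV2 ?posrE// ler_nat !ltnS.
  - by move=> i; exact: measurable_itv.
  - by move=> i; exact: (measurable_funS measurableT _ mf).
  - by move=> i t _; rewrite lee_fin.
rewrite -(cvg_lim _ cvgF)//; apply: lime_le; first by apply/cvg_ex; eexists; exact: cvgF.
by apply: nearW => k; exact: Fle.
Qed.

(** An elementary form of Young's inequality: either [y] is at most [e], or it is
    at most [y * (y / e) ^ k]. *)
Lemma young_power (y : \bar R) (e : R) k : 0 <= y -> (0 < e)%R ->
  y <= e%:E + y ^+ k.+1 * (e ^- k)%:E.
Proof.
move=> y0 e0; have ek0 : (0 < e ^- k)%R by rewrite invr_gt0 exprn_gt0.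
case: y y0 => [y| |]//; last first.
  move=> _; have -> : +oo ^+ k.+1 = +oo :> \bar R.
    by elim: k {ek0} => [|k ih]; rewrite expeS ?expe0 ?mule1// ih mulyy.
  by rewrite gt0_mulye ?lte_fin// addeC leey.
rewrite lee_fin => y0; rewrite -EFin_expe -EFinM -EFinD lee_fin.
have [ye|ey] := leP y e.
  by rewrite ler_wpDr// mulr_ge0// ?exprn_ge0// ltW.
apply: ler_wpDl; first exact: ltW.
rewrite exprS -mulrA; apply: ler_peMr => //.
by rewrite ler_pdivlMr ?exprn_gt0// mul1r lerXn2r ?nnegrE// ltW.
Qed.

Lemma emeasurable_funX d (T : measurableType d) (f : T -> \bar R) k :
  measurable_fun setT f -> measurable_fun setT (fun x => f x ^+ k).
Proof.
move=> mf; elim: k => [|k ih].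
  under eq_fun do rewrite expe0; exact: measurable_cst.
by under eq_fun do rewrite expeS; exact: emeasurable_funM.
Qed.

Lemma measurable_coord m (j : 'I_m) :
  measurable_fun setT (fun w : Leb_type R m => w ord0 j : R).
Proof.
apply: (measurability _ (RGenOInfty.measurableE R)) => _ [_ [x ->] <-]; rewrite setTI.
apply: (@eq_measurable _ (Leb_type R m) _ (~` [set w | w ord0 j <= x]%R)).
  by apply/seteqP; split => w; rewrite /= in_itv/= andbT ltNge => /negP.
by apply: measurableC; exact: measurable_halfspace.
Qed.

Lemma measurable_borel_coords d (T : measurableType d) m (phi : T -> 'rV[R]_m)
    (h : 'rV[R]_m -> \bar R) :
  (forall j, measurable_fun setT (fun t => phi t ord0 j)) -> borel_fun h ->
  measurable_fun setT (h \o phi).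
Proof.
move=> mphi mh; apply: (measurableT_comp mh (measurable_fun_borel _)) => a b.
have -> : phi @^-1` box (Some (a, b)) = \bigcap_(i in [set: 'I_m])
    ((fun t => phi t ord0 i) @^-1` `[a ord0 i, b ord0 i]%classic).
  apply/seteqP; split => [x xb i _|x xb i]; first by rewrite /= in_itv/= xb.
  by have /= := xb i I; rewrite in_itv.
apply: fin_bigcap_measurable => // i _.
by rewrite -[X in measurable X]setTI; apply: mphi => //; exact: measurable_itv.
Qed.

Lemma measurable_pencil_fun m (psi : 'rV[R]_m -> \bar R) x : borel_fun psi ->
  measurable_fun setT
    (fun p : R * Leb_type R m => psi (x + p.1 *: ((p.2 : 'rV[R]_m) - x))%R).
Proof.
move=> mpsi; apply: (@measurable_borel_coords _ (R * Leb_type R m)%type m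
  (fun p => x + p.1 *: ((p.2 : 'rV[R]_m) - x))%R psi) => // j.
under eq_fun do rewrite !mxE.
apply: measurable_funD => //; apply: measurable_funM => //.
apply: measurable_funD => //.
exact: (measurableT_comp (measurable_coord j) measurable_snd).
Qed.

Lemma box_convex m (u v x w : 'rV[R]_m) (t : R) : (0 <= t <= 1)%R ->
  box (Some (u, v)) x -> box (Some (u, v)) w ->
  box (Some (u, v)) (x + t *: (w - x))%R.
Proof.
move=> /andP[t0 t1] xuv wuv i; have := xuv i; have := wuv i; rewrite !mxE.
move=> /andP[uw wv] /andP[ux xv]; apply/andP; split; nra.
Qed.

(** This is Morrey's argument: the power [k.+1] exceeds the dimension [k].  In
    dimension [k] the homothety of ratio [t] costs a factor [t ^- k]; Young's
    inequality with the parameter [e * t `^ (k.+1%:R^-1 - 1)] balances it, which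
    leaves a singularity at [0] that is integrable. *)
Lemma integral_pencil_le k (u v x : 'rV[R]_k) (psi : 'rV[R]_k -> \bar R)
    (V e : R) :
  box (Some (u, v)) x -> borel_fun psi -> (forall w, 0 <= psi w) ->
  (0 < e)%R -> lebesgue_rV R k (box (Some (u, v))) = V%:E ->
  \int[lebesgue_rV R k]_(w in box (Some (u, v))) (psi w ^+ k.+1) <=
    (e ^+ k.+1 * V)%:E ->
  \int[lebesgue_rV R k]_(w in box (Some (u, v)))
     \int[@lebesgue_measure R]_(t in `]0%R, 1%R]) psi (x + t *: (w - x))%R
  <= (2 * k.+1%:R * (e * V))%:E.
Proof.
set K := box (Some (u, v)) => Kx mpsi psi0 e0 KV psiV.
have mK : measurable (K : set (Leb_type R k)) by exact: measurable_box.
have mKb : measurable (K : set (Borel_type R k)).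
  by apply: closed_borel; exact: closed_box.
have V0 : (0 <= V)%R by rewrite -lee_fin -KV measure_ge0.
pose a : R := (k.+1%:R^-1)%R.
have a0 : (0 < a)%R by rewrite invr_gt0.
pose f (p : R * Leb_type R k) := psi (x + p.1 *: ((p.2 : 'rV[R]_k) - x))%R.
have mf : measurable_fun setT f by exact: measurable_pencil_fun.
pose D : set (R * Leb_type R k) := `]0%R, 1%R]%classic `*` K.
have mD : measurable D by apply: measurableX => //; exact: measurable_itv.
pose F := f \_ D.
have mF : measurable_fun setT F.
  apply/(measurable_restrictT _ _).1 => //.
  exact: (measurable_funS measurableT _ mf).
have F0 p : 0 <= F p by rewrite /F patchE; case: ifP => // _; exact: psi0.
have FE t w : F (t, w) = if (t \in `]0%R, 1%R]%classic) && (w \in K)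
    then f (t, w) else 0 by rewrite /F patchE in_setX.
have := @fubini_tonelli _ _ _ _ _ (@lebesgue_measure R) (@lebesgue_sf R k) F mF F0.
rewrite /fubini_F /fubini_G.
have -> : \int[@lebesgue_sf R k]_y \int[@lebesgue_measure R]_t F (t, y) =
    \int[lebesgue_rV R k]_(w in K)
      \int[@lebesgue_measure R]_(t in `]0%R, 1%R]) psi (x + t *: (w - x))%R.
  rewrite [RHS]integral_mkcond; apply: eq_integral => w _; rewrite patchE.
  case: ifPn => wK.
    rewrite [RHS]integral_mkcond; apply: eq_integral => t _; rewrite FE wK andbT.
    by rewrite patchE.
  by apply: integral0_eq => t _; rewrite FE (negbTE wK) andbF.
move=> <-.
have mp := measurable_powR (a - 1)%R.
have C0 : (0 <= 2 * k.+1%:R * (e * V))%R by rewrite !mulr_ge0// ltW.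
have mw : measurable_fun setT (fun t => (a * t `^ (a - 1))%:E * (2 * k.+1%:R * (e * V))%:E).
  apply: emeasurable_funM => //.
  by apply/measurable_EFinP; apply: measurable_funM.
have w0 t : 0 <= (a * t `^ (a - 1))%:E :> \bar R.
  by rewrite lee_fin mulr_ge0 ?powR_ge0// ltW.
apply: (@le_trans _ _ (\int[@lebesgue_measure R]_(t in `]0%R, 1%R])
   ((a * t `^ (a - 1))%:E * (2 * k.+1%:R * (e * V))%:E))); last first.
  rewrite ge0_integralZr//; last first.
    apply/measurable_EFinP; apply: measurable_funM => //.
    exact: (measurable_funS measurableT _ mp).
  rewrite -[leRHS]mul1e lee_wpmul2r//; exact: integral_power_singularity.
rewrite [leRHS]integral_mkcond; apply: ge0_le_integral => //.
- by move=> t _; apply: integral_ge0.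
- exact: measurable_fun_fubini_tonelli_F.
- apply/(measurable_restrictT _ _).1 => //.
  exact: (measurable_funS measurableT _ mw).
move=> t _; rewrite patchE; case: ifPn => tI; last first.
  rewrite le_eqVlt; apply/predU1P; left; apply: integral0_eq => w _.
  by rewrite FE (negbTE tI).
rewrite inE/= in_itv/= in tI; have /andP[t0 t1] := tI.
pose s := (t `^ (a - 1))%R; have s0 : (0 < s)%R by rewrite powR_gt0.
have es0 : (0 < e * s)%R by rewrite mulr_gt0.
pose h := (fun w => psi w ^+ k.+1) \_ K.
have mh : borel_fun h.
  apply/(measurable_restrictT _ _).1 => //.
  apply: (measurable_funS measurableT _ _) => //.
  exact: emeasurable_funX.
have h0 w : 0 <= h w.
  by rewrite /h patchE; case: ifP => // _; exact/expe_ge0/psi0.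
have hI : \int[lebesgue_rV R k]_w h w <= (e ^+ k.+1 * V)%:E.
  by apply: le_trans psiV; rewrite [leRHS]integral_mkcond.
have mht : measurable_fun setT (fun w : Leb_type R k => h (x + t *: ((w : 'rV[R]_k) - x))%R).
  exact: (measurableT_comp (measurable_pencil_fun x mh) (pair1_measurable t)).
have ht0 (w : Leb_type R k) : 0 <= h (x + t *: ((w : 'rV[R]_k) - x))%R by exact: h0.
have c0 : (0 <= (e * s) ^- k)%R by rewrite invr_ge0 exprn_ge0// ltW.
have mcht := measurable_funeM ((e * s) ^- k)%:E mht.
pose ck : Leb_type R k -> \bar R := (cst (e * s)%:E) \_ (K : set (Leb_type R k)).
have mcst : measurable_fun setT ck.
  by apply/(measurable_restrictT _ _).1.
have -> : \int[@lebesgue_sf R k]_w F (t, w) = \int[lebesgue_rV R k]_w F (t, w) by [].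
apply: (@le_trans _ _ (\int[lebesgue_rV R k]_w (ck w +
    ((e * s) ^- k)%:E * h (x + t *: (w - x))%R))).
  pose G1 (w : Leb_type R k) := F (t, w).
  pose G2 (w : Leb_type R k) :=
    ck w + ((e * s) ^- k)%:E * h (x + t *: ((w : 'rV[R]_k) - x))%R.
  have mG1 : measurable_fun setT G1.
    exact: (measurableT_comp mF (pair1_measurable t)).
  have mG2 : measurable_fun setT G2.
    exact: (emeasurable_funD mcst mcht).
  apply: (@ge0_le_integral _ _ _ (lebesgue_rV R k) setT measurableT G1 G2 _ mG1 mG2).
    by move=> w _; exact: F0.
  move=> w _; rewrite /G1 /G2 FE mem_set/= ?in_itv//= /ck patchE.
  case: ifPn => [wK|_]; last by rewrite adde_ge0 ?mule_ge0.
  rewrite inE in wK; rewrite muleC.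
  have -> : h (x + t *: ((w : 'rV[R]_k) - x))%R = f (t, w) ^+ k.+1.
    by rewrite /h patchE mem_set//; apply: box_convex => //; rewrite ltW.
  by apply: young_power => //; exact: psi0.
have ck0 w : 0 <= ck w by rewrite /ck patchE; case: ifP => // _; rewrite lee_fin ltW.
have cht0 (w : Leb_type R k) :
    0 <= ((e * s) ^- k)%:E * h (x + t *: ((w : 'rV[R]_k) - x))%R.
  by rewrite mule_ge0.
rewrite (@ge0_integralD _ _ _ (lebesgue_rV R k) setT measurableT ck _
  (fun w _ => ck0 w) mcst (fun w _ => cht0 w) mcht).
rewrite (@ge0_integralZl _ _ _ (lebesgue_rV R k) setT measurableT _ mht
  _ (fun w _ => ht0 w)) ?lee_fin//.
rewrite /ck -integral_mkcond integral_cst//.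
apply: (@le_trans _ _ ((e * s)%:E * V%:E +
   ((e * s) ^- k)%:E * ((t ^- k)%:E * (e ^+ k.+1 * V)%:E))).
  apply: leeD; first by rewrite -KV.
  rewrite lee_wpmul2l//; apply: (le_trans (integral_homothety_le x t0 mh h0)).
  by rewrite lee_wpmul2l// lee_fin invr_ge0 exprn_ge0// ltW.
rewrite -!EFinM -EFinD lee_fin.
have st : (s * t = t `^ a)%R.
  rewrite /s -[X in (_ * X)%R = _]powRr1 ?ltW// -powRD ?subrK//.
  by rewrite (gt_eqF t0) implybT.
have ak : (a * k.+1%:R = 1)%R by rewrite /a mulVf// pnatr_eq0.
have ts : (s ^- k * t ^- k = s)%R.
  rewrite -invfM -exprMn st -powR_mulrn ?powR_ge0// -powRrM -powRN /s.
  by congr (t `^ _)%R; move: ak; rewrite -natr1 mulrDr mulr1; lra.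
have -> : ((e * s) ^- k * (t ^- k * (e ^+ k.+1 * V)) = e * s * V)%R.
  rewrite exprMn invfM -[in RHS]ts exprS; field.
  by rewrite !gt_eqF ?exprn_gt0.
rewrite -/s le_eqVlt; apply/predU1P; left.
have -> : (a * s * (2 * k.+1%:R * (e * V)) = (a * k.+1%:R) * (2 * (e * s * V)))%R by ring.
by rewrite ak mul1r; ring.
Qed.

End Pencils.

(** * Joining points at small cost *)

Section Linking.
Context {R : realType}.
Local Open Scope ereal_scope.

Lemma integral_translate_le (h : R -> \bar R) (c : R) :
  measurable_fun setT h -> (forall t, 0 <= h t) ->
  \int[@lebesgue_measure R]_t h (t - c)%R <= \int[@lebesgue_measure R]_t h t.
Proof.
move=> mh h0; rewrite -[leRHS]mul1e.
apply: (@le_integral_lebesgue1 _ _ (measurableTypeR R) (@lebesgue_measure R)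
  (fun t => t - c)%R 1%R) => //.
  exact: measurable_funB.
move=> x y xy; have -> : (fun t => t - c)%R @^-1` `]x, y]%classic = `](x + c)%R, (y + c)%R]%classic.
  by apply/seteqP; split => t; rewrite /= !in_itv/= ltrBrDr lerBlDr.
have E : @lebesgue_measure R `](x + c)%R, (y + c)%R]%classic = (y - x)%:E.
  by rewrite lebesgue_measure_itv/= lte_fin ltrD2r xy -EFinB; congr EFin; lra.
by rewrite mul1e -E.
Qed.

Lemma integral_reflect_le (h : R -> \bar R) (c : R) :
  measurable_fun setT h -> (forall t, 0 <= h t) ->
  \int[@lebesgue_measure R]_t h (c - t)%R <= \int[@lebesgue_measure R]_t h t.
Proof.
move=> mh h0; rewrite -[leRHS]mul1e.
apply: (@le_integral_lebesgue1 _ _ (measurableTypeR R) (@lebesgue_measure R)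
  (fun t => c - t)%R 1%R) => //.
  exact: measurable_funB.
move=> x y xy; have -> : (fun t => c - t)%R @^-1` `]x, y]%classic = `[(c - y)%R, (c - x)%R[%classic.
  apply/seteqP; split => t; rewrite /= !in_itv/= => /andP[? ?]; apply/andP; split; lra.
have E : @lebesgue_measure R `[(c - y)%R, (c - x)%R[%classic = (y - x)%:E.
  by rewrite lebesgue_measure_itv/= lte_fin ltrD2l ltrN2 xy -EFinB; congr EFin; lra.
by rewrite mul1e -E.
Qed.

Context {n : nat}.
Implicit Types (rho : 'rV[R]_n -> \bar R) (gamma : R -> 'rV[R]_n)
  (p q : 'rV[R]_n) (S : set 'rV[R]_n).

Definition along rho gamma (m t : R) : \bar R :=
  ((fun t => rho (gamma (clamp 0 m t))) \_ `[0%R, m]%classic) t.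

Lemma alongE rho gamma (m t : R) : along rho gamma m t =
  if (0 <= t <= m)%R then rho (gamma t) else 0.
Proof.
rewrite /along patchE; case: ifPn => [|].
  by rewrite inE/= in_itv/= => tm; rewrite clamp_id// tm.
by rewrite notin_setE/= in_itv/= => /negP/negbTE ->.
Qed.

Lemma along_ge0 rho gamma (m t : R) : (forall x, 0 <= rho x) ->
  0 <= along rho gamma m t.
Proof. by move=> rho0; rewrite alongE; case: ifP. Qed.

Lemma measurable_along rho gamma (m L : R) : (0 <= m)%R ->
  lipschitz_on gamma 0 m L -> borel_fun rho ->
  measurable_fun setT (along rho gamma m).
Proof.
move=> m0 lip mrho; apply/(measurable_restrictT _ _).1 => //.
apply: (@measurable_funS _ _ _ _ setT) => //.
exact: measurable_borel_path lip mrho.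
Qed.

Lemma integral_along rho gamma (m : R) :
  \int[@lebesgue_measure R]_(t in `[0%R, m]) rho (gamma t) =
  \int[@lebesgue_measure R]_t along rho gamma m t.
Proof.
rewrite integral_mkcond; apply: eq_integral => t _.
by rewrite alongE patchE mem_setE/= in_itv.
Qed.

(** The cost is measured with respect to time instead of arc length: paths of
    this kind can be reversed and concatenated without regard to their lengths,
    and the speed [L] enters only when a cost is turned into a line integral. *)
Definition linked rho S (L : R) p q (e : R) := exists (m : R) gamma,
  [/\ (0 < m)%R, gamma 0%R = p /\ gamma m = q, lipschitz_on gamma 0 m L,
      forall t : R, (0 <= t <= m)%R -> S (gamma t) &
      \int[@lebesgue_measure R]_(t in `[0%R, m]) rho (gamma t) <= e%:E].

Lemma linked_sub rho S S' L p q e : S `<=` S' ->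
  linked rho S L p q e -> linked rho S' L p q e.
Proof.
by move=> SS' [m [g [m0 gpq lip gS ge]]]; exists m, g; split => // t /gS/SS'.
Qed.

Lemma linked_le rho S L p q (e e' : R) : (e <= e')%R ->
  linked rho S L p q e -> linked rho S L p q e'.
Proof.
move=> ee' [m [g [m0 gpq lip gS ge]]]; exists m, g; split => //.
by apply: (le_trans ge); rewrite lee_fin.
Qed.

Lemma linked_sym rho S L p q e : borel_fun rho -> (forall x, 0 <= rho x) ->
  linked rho S L p q e -> linked rho S L q p e.
Proof.
move=> mrho rho0 [m [g [m0 [g0 gm] lip gS ge]]].
exists m, (fun t => g (m - t)%R); split => //.
- by rewrite subr0 subrr.
- move=> s t /andP[s0 sm] /andP[t0 tm].
  have -> : (`|s - t| = `|(m - s) - (m - t)|)%R by rewrite (distrC s); congr (`| _ |)%R; ring.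
  by apply: lip; apply/andP; split; lra.
- by move=> t /andP[t0 tm]; apply: gS; apply/andP; split; lra.
apply: le_trans ge; rewrite !integral_along.
apply: le_trans (integral_reflect_le m (measurable_along (ltW m0) lip mrho)
  (fun t => along_ge0 g m t rho0)).
rewrite le_eqVlt; apply/predU1P; left; apply: eq_integral => t _.
by rewrite !alongE; congr (if _ then _ else _); apply/idP/idP => /andP[? ?];
  apply/andP; split; lra.
Qed.

Lemma linked_trans rho S L q p z e1 e2 : (0 <= L)%R ->
  borel_fun rho -> (forall x, 0 <= rho x) ->
  linked rho S L p q e1 -> linked rho S L q z e2 -> linked rho S L p z (e1 + e2).
Proof.
move=> L0 mrho rho0 [m1 [g1 [m10 [g10 g1m] lip1 g1S ge1]]].
move=> [m2 [g2 [m20 [g20 g2m] lip2 g2S ge2]]].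
pose g t := if (t <= m1)%R then g1 t else g2 (t - m1)%R.
have m120 : (0 < m1 + m2)%R by rewrite addr_gt0.
have lip : lipschitz_on g 0 (m1 + m2) L.
  have cross (s t : R) : (0 <= s <= m1)%R -> (m1 < t <= m1 + m2)%R ->
      (eucl_dist (g1 s) (g2 (t - m1)) <= L * `|s - t|)%R.
    move=> /andP[s0 sm] /andP[mt tm].
    have := eucl_dist_triangle q (g1 s) (g2 (t - m1)%R) => /le_trans; apply.
    have h1 := lip1 s m1 ltac:(by rewrite s0 sm) ltac:(by rewrite lexx ltW).
    have h2 := lip2 0%R (t - m1)%R ltac:(by rewrite lexx ltW) ltac:(apply/andP; split; lra).
    rewrite g1m in h1; rewrite g20 in h2.
    apply: (le_trans (lerD h1 h2)); rewrite -mulrDr ler_wpM2l//.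
    rewrite !ler0_norm; lra.
  move=> s t /andP[s0 sm] /andP[t0 tm]; rewrite /g.
  case: (leP s m1) => sm1; case: (leP t m1) => tm1.
  - by apply: lip1; rewrite ?s0 ?t0.
  - by apply: cross; rewrite ?s0 ?tm1.
  - by rewrite eucl_distC distrC; apply: cross; rewrite ?t0 ?sm1.
  - have -> : (s - t = (s - m1) - (t - m1))%R by lra.
    by apply: lip2; apply/andP; split; lra.
exists (m1 + m2)%R, g; split => //.
- rewrite /g (ltW m10) g10; split => //.
  by rewrite leNgt ltrDl m20/= addrAC subrr add0r.
- move=> t /andP[t0 tm]; rewrite /g; case: (leP t m1) => tm1.
    by apply: g1S; rewrite t0.
  by apply: g2S; apply/andP; split; lra.
have mh1 := measurable_along (ltW m10) lip1 mrho.
have mh2 := measurable_along (ltW m20) lip2 mrho.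
have h10 t := along_ge0 g1 m1 t rho0; have h20 t := along_ge0 g2 m2 t rho0.
have mh2' : measurable_fun setT (fun t : R => along rho g2 m2 (t - m1)%R).
  by apply: (measurableT_comp mh2); exact: measurable_funB.
rewrite integral_along EFinD.
apply: (@le_trans _ _ (\int[@lebesgue_measure R]_t (along rho g1 m1 t + along rho g2 m2 (t - m1)%R))).
  apply: ge0_le_integral => //.
  - by move=> t _; exact: along_ge0.
  - exact: (measurable_along (ltW m120) lip mrho).
  - exact: emeasurable_funD.
  move=> t _; rewrite alongE; case: ifPn => [/andP[t0 tm]|_]; last by rewrite adde_ge0.
  rewrite /g; case: (leP t m1) => tm1.
    by rewrite alongE t0 tm1 leeDl.
  rewrite [X in _ + X]alongE; have -> : (0 <= t - m1 <= m2)%R by apply/andP; split; lra.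
  by rewrite leeDr.
rewrite ge0_integralD//; apply: leeD; first by rewrite -integral_along.
apply: (le_trans (integral_translate_le _ mh2 h20)).
by rewrite -integral_along.
Qed.

Lemma eucl_dist_segment (x y : 'rV[R]_n) (s t : R) :
  eucl_dist (x + s *: (y - x))%R (x + t *: (y - x))%R = (eucl_dist x y * `|s - t|)%R.
Proof.
rewrite /eucl_dist -[`|_|%R]sqrtr_sqr -sqrtrM; last first.
  by apply: sumr_ge0 => i _; exact: sqr_ge0.
rewrite mulr_suml; congr Num.sqrt; apply: eq_bigr => i _.
by rewrite !mxE -exprMn -[LHS]sqrrN; congr (_ ^+ 2)%R; ring.
Qed.

Lemma line_integral_lipschitz rho gamma (m L : R) :
  (0 < L)%R -> lipschitz_on gamma 0 m L -> borel_fun rho ->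
  (forall x, 0 <= rho x) ->
  line_integral rho (`[0%R, m], gamma) <=
    L%:E * \int[@lebesgue_measure R]_(t in `[0%R, m]) rho (gamma t).
Proof.
move=> L0 lip mrho rho0; apply: ge_ereal_sup => _ [[a b] /= [ab abm] <-].
have a0 : (0 <= a)%R by have /= := abm a; rewrite !in_itv/= lexx ab => /(_ isT)/andP[].
have bm : (b <= m)%R by have /= := abm b; rewrite !in_itv/= lexx ab => /(_ isT)/andP[].
have m0 : (0 <= m)%R by rewrite (le_trans a0)// (le_trans ab).
apply: (le_trans (segment_integral_lipschitz ab L0 (lipschitz_on_sub a0 bm lip) mrho rho0)).
apply: lee_wpmul2l; first by rewrite lee_fin ltW.
have e1 : \int[@lebesgue_measure R]_(t in `[a, b]) rho (gamma t) =
    \int[@lebesgue_measure R]_(t in `[a, b]) along rho gamma m t.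
  apply: eq_integral => t; rewrite inE/= in_itv/= => /andP[a_t tb].
  by rewrite alongE (le_trans a0 a_t) (le_trans tb bm).
rewrite e1 integral_along; apply: ge0_subset_integral => //.
  exact: (measurable_along m0 lip mrho).
by move=> t _; exact: along_ge0.
Qed.

(** The line integral along the path is at most [L] times its cost. *)
Lemma linked_not_adm rho S (L : R) p q e (E F G : set 'rV[R]_n) :
  (0 < L)%R -> (L * e < 1)%R -> linked rho S L p q e -> S `<=` G -> E p -> F q ->
  ~ adm (joining_paths E F G) rho.
Proof.
move=> L0 Le [m [g [m0 [g0 gm] lip gS ge]]] SG Ep Fq [mrho rho0 admrho].
have cg := lipschitz_on_continuous lip.
have : 1 <= line_integral rho (`[0%R, m], g).
  apply: admrho.
    exists 0%R, m; split => //=; first by rewrite g0 gm.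
    by move=> t /andP[t0 tm]; apply/SG/gS; rewrite !ltW.
  move=> a b ab /= abm.
  have a0 : (0 <= a)%R by have /= := abm a; rewrite !in_itv/= lexx ab => /(_ isT)/andP[].
  have bm : (b <= m)%R by have /= := abm b; rewrite !in_itv/= lexx ab => /(_ isT)/andP[].
  apply: (le_lt_trans (path_length_lipschitz ab (ltW L0) (lipschitz_on_sub a0 bm lip))).
  by rewrite ltry.
apply/negP; rewrite -ltNge; apply: (le_lt_trans (line_integral_lipschitz L0 lip mrho rho0)).
apply: (@le_lt_trans _ _ (L%:E * e%:E)); first by rewrite lee_wpmul2l// lee_fin ltW.
by rewrite -EFinM lte_fin.
Qed.

End Linking.

Section SliceLinking.
Context {R : realType} {k : nat}.
Local Open Scope ereal_scope.
Implicit Types (rho : 'rV[R]_k.+1 -> \bar R) (p q : 'rV[R]_k.+1).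

Lemma remove_coordK (i : 'I_k.+1) (t : R) (w : 'rV[R]_k) :
  remove_coord i (insert_coord i t w) = w.
Proof. by apply/rowP => j; rewrite mxE insert_coord_lift. Qed.

Lemma insert_coord_boxP (i : 'I_k.+1) (t : R) (w : 'rV[R]_k) a b :
  box (Some (a, b)) (insert_coord i t w) <->
  `[a ord0 i, b ord0 i]%classic t /\
    box (Some (remove_coord i a, remove_coord i b)) w.
Proof.
have := preimage_insert_coord_box i a b.
by move=> /(congr1 (fun S : set (R * 'rV[R]_k) => S (t, w))) /= ->.
Qed.

Lemma borel_insert_coord (i : 'I_k.+1) (t : R) rho : borel_fun rho ->
  borel_fun (fun w : 'rV[R]_k => rho (insert_coord i t w)).
Proof.
move=> mrho; apply: (measurableT_comp mrho (measurable_fun_borel _)) => a b.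
have [tab|tab] := pselect (`[a ord0 i, b ord0 i]%classic t).
  apply: (@eq_measurable _ (Borel_type R k) _
      (box (Some (remove_coord i a, remove_coord i b)))); last first.
    by apply: closed_borel; exact: closed_box.
  by apply/seteqP; split => w; [move=> /insert_coord_boxP[]|
    move=> wB; apply/insert_coord_boxP].
apply: (@eq_measurable _ (Borel_type R k) _ set0); last exact: measurable0.
by apply/seteqP; split => // w /insert_coord_boxP[].
Qed.

(** The segments from [p], and those from [q], to all points of the slice cost
    little on average; hence for some common end point both segments cost
    little. *)
Lemma slice_linked rho (i : 'I_k.+1) (s : R) (u v : 'rV[R]_k) (V L e : R) p q :
  borel_fun rho -> (forall x, 0 <= rho x) -> (0 < V)%R -> (0 < e)%R ->
  lebesgue_rV R k (box (Some (u, v))) = V%:E ->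
  (forall x y, box (Some (u, v)) x -> box (Some (u, v)) y ->
     (eucl_dist (insert_coord i s x) (insert_coord i s y) <= L)%R) ->
  \int[lebesgue_rV R k]_(w in box (Some (u, v))) (rho (insert_coord i s w) ^+ k.+1)
    <= (e ^+ k.+1 * V)%:E ->
  p ord0 i = s -> q ord0 i = s ->
  box (Some (u, v)) (remove_coord i p) -> box (Some (u, v)) (remove_coord i q) ->
  linked rho [set x : 'rV[R]_k.+1 | x ord0 i = s /\ box (Some (u, v)) (remove_coord i x)] L p q
    (5 * k.+1%:R * e)%R.
Proof.
set K := box (Some (u, v)) => mrho rho0 V0 e0 KV diamK rhoV pis qis Kp Kq.
pose psi w := rho (insert_coord i s w).
have mpsi : borel_fun psi by exact: borel_insert_coord.
have psi0 w : 0 <= psi w by exact: rho0.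
pose J (x w : 'rV[R]_k) :=
  \int[@lebesgue_measure R]_(t in `]0%R, 1%R]) psi (x + t *: (w - x))%R.
have mK : measurable (K : set (Leb_type R k)) by exact: measurable_box.
have Jle x : K x -> \int[lebesgue_rV R k]_(w in K) J x w <= (2 * k.+1%:R * (e * V))%:E.
  by move=> Kx; exact: integral_pencil_le.
have J0 x w : 0 <= J x w by exact: integral_ge0.
have mJ x : measurable_fun setT (J x : Leb_type R k -> \bar R).
  pose f (tw : R * Leb_type R k) := psi (x + tw.1 *: ((tw.2 : 'rV[R]_k) - x))%R.
  have mf : measurable_fun setT f by exact: measurable_pencil_fun.
  pose D : set (R * Leb_type R k) := `]0%R, 1%R]%classic `*` setT.
  have mD : measurable D by apply: measurableX => //; exact: measurable_itv.
  have mF : measurable_fun setT (f \_ D).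
    apply/(measurable_restrictT _ _).1 => //.
    exact: (measurable_funS measurableT _ mf).
  have F0 tw : 0 <= (f \_ D) tw.
    by rewrite patchE; case: ifP => // _; exact: psi0.
  have := @measurable_fun_fubini_tonelli_G _ _ _ _ _ (@lebesgue_measure R) _ mF F0.
  apply: eq_measurable_fun => w _; rewrite /fubini_G /J [RHS]integral_mkcond.
  apply: eq_integral => t _; rewrite !patchE in_setX.
  by rewrite [w \in _]mem_set// andbT.
set x := remove_coord i p; set y := remove_coord i q.
(* each pencil has average at most [2 * k.+1%:R * e]; 5 exceeds 2 + 2 *)
have [w Kw Jw] : exists2 w, K w & J x w + J y w <= (5 * k.+1%:R * e)%:E.
  apply: contrapT => noW.
  have big w : K w -> (5 * k.+1%:R * e)%:E <= J x w + J y w.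
    move=> Kw; rewrite leNgt; apply/negP => /ltW Jw; apply: noW.
    by exists w.
  have := leeD (Jle x Kp) (Jle y Kq).
  have mJK z : measurable_fun (K : set (Leb_type R k)) (J z : Leb_type R k -> \bar R).
    exact: (measurable_funS measurableT _ (mJ z)).
  have mJJ := emeasurable_funD (mJK x) (mJK y).
  apply/negP; rewrite -ltNge.
  rewrite -(@ge0_integralD _ _ _ (lebesgue_rV R k) _ mK _ _ (fun w _ => J0 x w)
    (mJK x) (fun w _ => J0 y w) (mJK y)).
  apply: (@lt_le_trans _ _ (\int[lebesgue_rV R k]_(w in K) (5 * k.+1%:R * e)%:E)).
    rewrite integral_cst// [X in _ < _ * X]KV -EFinM -EFinD lte_fin.
    have : (0 < k.+1%:R * (e * V) :> R)%R by rewrite !mulr_gt0// ltr0n.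
    by nra.
  have c0 : 0 <= (5 * k.+1%:R * e)%:E by rewrite lee_fin !mulr_ge0// ltW.
  have mc : measurable_fun (K : set (Leb_type R k)) (cst (5 * k.+1%:R * e)%:E : Leb_type R k -> \bar R).
    exact: measurable_cst.
  exact: (@ge0_le_integral _ _ _ (lebesgue_rV R k) _ mK _ _ (fun _ _ => c0) mc mJJ).
have pE : insert_coord i s x = p by rewrite -pis insert_coordK.
have qE : insert_coord i s y = q by rewrite -qis insert_coordK.
have mseg z z' (j : 'I_k) : measurable_fun setT
    (fun t : measurableTypeR R => (z + t *: (z' - z) : 'rV[R]_k)%R ord0 j).
  under eq_fun do rewrite !mxE.
  by apply: measurable_funD => //; apply: measurable_funM.
have seg z c : K z -> J z w <= c%:E ->
    linked rho [set x : 'rV[R]_k.+1 | x ord0 i = s /\ K (remove_coord i x)] L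
      (insert_coord i s z) (insert_coord i s w) c.
  move=> Kz Jc; exists 1%R, (fun t => insert_coord i s (z + t *: (w - z))%R).
  have segE t : insert_coord i s (z + t *: (w - z))%R =
      (insert_coord i s z + t *: (insert_coord i s w - insert_coord i s z))%R.
    apply/rowP => j; rewrite !mxE; case: unliftP => [l _|_]; rewrite ?mxE//.
    by rewrite subrr mulr0 addr0.
  split => //.
  - by rewrite scale0r addr0 scale1r addrC subrK.
  - move=> a b _ _; rewrite !segE eucl_dist_segment ler_wpM2r//.
    exact: diamK.
  - move=> t t01; rewrite /= insert_coordE remove_coordK; split => //.
    exact: box_convex.
  apply: le_trans Jc; rewrite /J -integral_itv_obnd_cbnd//.
  apply: (measurable_funS measurableT) => //.
  exact: (@measurable_borel_coords _ _ (measurableTypeR R) k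
    (fun t => z + t *: (w - z))%R psi (mseg z w) mpsi).
have L0 : (0 <= L)%R by apply: le_trans (diamK _ _ Kw Kw); exact: eucl_dist_ge0.
have [cx [cy [hx hy cxy]]] : exists cx cy : R,
    [/\ J x w <= cx%:E, J y w <= cy%:E & (cx + cy <= 5 * k.+1%:R * e)%R].
  move: (J0 x w) (J0 y w) Jw; move: (J x w) (J y w) => [a| |] [b| |]//.
  by rewrite -EFinD lee_fin => _ _ abe; exists a, b.
apply: (linked_le cxy); rewrite -pE -qE.
apply: (@linked_trans _ _ _ _ _ (insert_coord i s w)) => //.
  exact: (seg x _ Kp hx).
apply: linked_sym => //; exact: (seg y _ Kq hy).
Qed.

End SliceLinking.

(** * Weak flatness at interior points *)

Lemma connected_boundary (T : topologicalType) (E S : set T) : connected E ->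
  E `&` S !=set0 -> ~ (E `<=` S) -> exists2 x, E x & (closure S `\` S°) x.
Proof.
move=> cE [x [Ex Sx]] nES; apply: contrapT => noB.
have ES z : E z -> closure S z -> S° z.
  by move=> Ez Sz; apply: contrapT => nSz; apply: noB; exists z.
apply: nES; have -> : E = E `&` S°.
  apply/esym/cE.
  - by exists x; split => //; apply: ES => //; exact: subset_closure.
  - by exists S° => //; exact: open_interior.
  - exists (closure S); first exact: closed_closure.
    apply/seteqP; split => z [Ez Sz]; split => //; last exact: ES.
    by apply: subset_closure; exact: interior_subset.
by move=> z [_]; exact: interior_subset.
Qed.

Section Cubes.
Context {R : realType} {n : nat}.
Implicit Types (x y : 'rV[R]_n) (r : R).

Definition cube y r : set 'rV[R]_n :=
  [set x | forall i, `|x ord0 i - y ord0 i| <= r].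

Lemma cube_box y r : cube y r = box (Some (y - const_mx r, y + const_mx r)).
Proof.
by apply/seteqP; split => x xr i; have := xr i; rewrite !mxE ler_distl.
Qed.

Lemma le_cube y r r' : r <= r' -> cube y r `<=` cube y r'.
Proof. by move=> rr' x xr i; exact: le_trans (xr i) rr'. Qed.

Lemma closed_cube y r : closed (cube y r).
Proof. by rewrite cube_box; exact: closed_box. Qed.

Lemma borel_cube y r : measurable (cube y r : set (Borel_type R n)).
Proof. by apply: closed_borel; exact: closed_cube. Qed.

Lemma cube_diam y r x x' : cube y r x -> cube y r x' ->
  eucl_dist x x' <= n%:R * (2 * r).
Proof.
move=> xr x'r; apply: eucl_dist_le_coord => i.
have := xr i; have := x'r i; rewrite !ler_norml => /andP[? ?] /andP[? ?].
by apply/andP; split; lra.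
Qed.

Lemma cube_eucl_dist y r x : eucl_dist y x <= r -> cube y r x.
Proof. by move=> yx i; rewrite distrC (le_trans (coord_le_eucl_dist _ _ _)). Qed.

Lemma nbhs_cube x (U : set 'rV[R]_n) : nbhs x U ->
  exists2 r, 0 < r & cube x r `<=` U.
Proof.
move=> /nbhs_ballP[e /= e0 xeU]; exists (e / 2); first by rewrite divr_gt0.
move=> y xy; apply: xeU; split => // i j; rewrite (ord1 i) /ball/= distrC.
by apply: (le_lt_trans (xy j)); rewrite ltr_pdivrMr// ltr_pMr// ltr1n.
Qed.

Lemma open_coord_lt (j : 'I_n) (c : R) : open [set x : 'rV[R]_n | x ord0 j < c].
Proof.
have -> : [set x : 'rV[R]_n | x ord0 j < c] = (fun x => x ord0 j) @^-1` `]-oo, c[%classic.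
  by apply/seteqP; split => x; rewrite /= in_itv.
by apply: open_comp => // x _; exact: coord_continuous.
Qed.

Lemma open_coord_gt (j : 'I_n) (c : R) : open [set x : 'rV[R]_n | c < x ord0 j].
Proof.
have -> : [set x : 'rV[R]_n | c < x ord0 j] = (fun x => x ord0 j) @^-1` `]c, +oo[%classic.
  by apply/seteqP; split => x; rewrite /= in_itv/= andbT.
by apply: open_comp => // x _; exact: coord_continuous.
Qed.

Lemma boundary_box u v x : boundary (box (Some (u, v))) x ->
  box (Some (u, v)) x /\ exists i, x ord0 i = u ord0 i \/ x ord0 i = v ord0 i.
Proof.
move=> [clx nint]; have xB : box (Some (u, v)) x.
  exact: (closed_box clx).
split => //; apply: contrapT => nex; apply: nint.
have : \forall z \near x, forall i, u ord0 i < (z : 'rV[R]_n) ord0 i < v ord0 i.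
  apply: (@filter_forall _ _ (fun i (z : 'rV[R]_n) =>
    u ord0 i < z ord0 i < v ord0 i : Prop) (nbhs x)) => i.
  have := xB i; rewrite !le_eqVlt.
  move=> /andP[/predU1P[ui|ui] /predU1P[vi|vi]];
    try by exfalso; apply: nex; exists i; auto.
  have U1 := open_nbhs_nbhs (conj (@open_coord_gt i (u ord0 i)) ui).
  have U2 := open_nbhs_nbhs (conj (@open_coord_lt i (v ord0 i)) vi).
  by apply: filterS (filterI U1 U2) => z [/= -> ->].
by apply: filterS => z zi i; have /andP[? ?] := zi i; rewrite !ltW.
Qed.

End Cubes.

Section Shells.
Context {R : realType} {k : nat}.
Local Open Scope ereal_scope.
Implicit Types (rho : 'rV[R]_k.+1 -> \bar R) (p q y : 'rV[R]_k.+1).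

Definition shell y (r : R) : set 'rV[R]_k.+1 := cube y (2 * r) `\` cube y r.

Lemma shellP y r x : shell y r x <->
  cube y (2 * r) x /\ exists i, (r < `|x ord0 i - y ord0 i|)%R.
Proof.
split=> [[xr /existsNP[i /negP]]|[xr [i xi]]].
  by rewrite -ltNge => xi; split => //; exists i.
by split => // /(_ i); rewrite leNgt xi.
Qed.

Lemma borel_shell y r : measurable (shell y r : set (Borel_type R k.+1)).
Proof. by apply: measurableD; exact: borel_cube. Qed.

Lemma cube_slice y r (i : 'I_k.+1) t (w : 'rV[R]_k) :
  cube y r (insert_coord i t w) <->
  (`|t - y ord0 i| <= r)%R /\ cube (remove_coord i y) r w.
Proof.
split=> [h|[ti wr] j].
  split; first by have := h i; rewrite insert_coordE.
  by move=> j; have := h (lift i j); rewrite insert_coord_lift mxE.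
rewrite mxE; case: unliftP => [l ->|->//].
by have := wr l; rewrite mxE.
Qed.

Lemma lebesgue_cube m (y : 'rV[R]_m) (r : R) : (0 <= r)%R ->
  lebesgue_rV R m (cube y r) = ((2 * r) ^+ m)%:E.
Proof.
move=> r0; rewrite cube_box [LHS]lebesgue_rV_box/=; congr EFin.
rewrite (eq_bigr (fun=> 2 * r)%R); first by rewrite prodr_const card_ord.
move=> i _; rewrite !mxE; have -> : (y ord0 i + r - (y ord0 i - r) = 2 * r)%R by ring.
by apply/max_idPr; rewrite mulr_ge0.
Qed.

(** Slices at heights between [a] and [a + r]: if all of them carried much mass,
    the shell would by Tonelli carry too much. *)
Lemma good_slice rho y (r a eta : R) (i : 'I_k.+1) :
  borel_fun rho -> (forall x, 0 <= rho x) -> (0 < r)%R -> (0 < eta)%R ->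
  (forall t, (a < t < a + r)%R -> (r < `|t - y ord0 i| <= 2 * r)%R) ->
  \int[lebesgue_rV R k.+1]_(x in shell y r) (rho x ^+ k.+1) <
    (eta ^+ k.+1 * 4 ^+ k)%:E ->
  exists2 t, (a < t < a + r)%R &
    \int[lebesgue_rV R k]_(w in cube (remove_coord i y) (2 * r))
      (rho (insert_coord i t w) ^+ k.+1)
      <= ((eta / r) ^+ k.+1 * (4 * r) ^+ k)%:E.
Proof.
move=> mrho rho0 r0 eta0 ar small; apply: contrapT => noT.
pose h := (fun x => rho x ^+ k.+1) \_ (shell y r).
have mh : borel_fun h.
  apply/(measurable_restrictT _ _).1; first exact: borel_shell.
  apply: (measurable_funS measurableT _ _) => //.
  exact: emeasurable_funX.
have h0 x : 0 <= h x.
  by rewrite /h patchE; case: ifP => // _; exact/expe_ge0/rho0.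
pose c : R := ((eta / r) ^+ k.+1 * (4 * r) ^+ k)%R.
have cr : (c * r = eta ^+ k.+1 * 4 ^+ k)%R.
  rewrite /c !exprMn exprVn exprS [(r ^+ k.+1)%R]exprS; field.
  by rewrite !gt_eqF ?exprn_gt0.
have c0 : (0 <= c)%R by rewrite mulr_ge0// exprn_ge0// ?divr_ge0 ?mulr_ge0// ltW.
have := tonelli_slice_le i mh h0.
have -> : \int[lebesgue_rV R k.+1]_x h x =
    \int[lebesgue_rV R k.+1]_(x in shell y r) (rho x ^+ k.+1).
  by rewrite [RHS]integral_mkcond.
move=> /le_lt_trans/(_ small); apply/negP; rewrite -leNgt -cr.
have mI : measurable (`]a, (a + r)%R[%classic : set R) by exact: measurable_itv.
apply: (@le_trans _ _ (\int[@lebesgue_measure R]_(t in `]a, (a + r)%R[) c%:E)).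
  have E : @lebesgue_measure R `]a, (a + r)%R[%classic = r%:E.
    by rewrite lebesgue_measure_itv/= lte_fin ltrDl r0 -EFinB; congr EFin; ring.
  by rewrite integral_cst// [X in _ <= _ * X]E -EFinM.
rewrite integral_mkcond; apply: ge0_le_integral => //.
- by move=> t _; rewrite patchE; case: ifP.
- by apply/(measurable_restrictT _ _).1.
- exact: measurable_slice_integral.
move=> t _; rewrite patchE; case: ifPn => [|_]; last exact: integral_ge0.
rewrite inE/= in_itv/= => tI; apply: ltW; rewrite ltNge; apply/negP => le_c.
apply: noT; exists t => //; apply: le_trans le_c.
rewrite integral_mkcond le_eqVlt; apply/predU1P; left; apply: eq_integral => w _.
have /andP[rt tr] := ar t tI; rewrite /h !patchE.
have [Kw|Kw] := pselect (cube (remove_coord i y) (2 * r) w).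
  rewrite !mem_set//; apply/shellP; split; first exact/cube_slice.
  by exists i; rewrite insert_coordE.
by rewrite !memNset// => /shellP[/cube_slice[]].
Qed.

Lemma remove_coord_cube y r (i : 'I_k.+1) x : cube y r x ->
  cube (remove_coord i y) r (remove_coord i x).
Proof. by move=> xr j; rewrite !mxE; exact: xr. Qed.

Lemma linked_in_slice rho y (r s eta : R) (i : 'I_k.+1) p q :
  borel_fun rho -> (forall x, 0 <= rho x) -> (0 < r)%R -> (0 < eta)%R ->
  (r < `|s - y ord0 i| <= 2 * r)%R ->
  \int[lebesgue_rV R k]_(w in cube (remove_coord i y) (2 * r))
    (rho (insert_coord i s w) ^+ k.+1)
    <= ((eta / r) ^+ k.+1 * (4 * r) ^+ k)%:E ->
  p ord0 i = s -> q ord0 i = s -> cube y (2 * r) p -> cube y (2 * r) q ->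
  linked rho (shell y r) (k.+1%:R * (4 * r)) p q (5 * k.+1%:R * (eta / r))%R.
Proof.
move=> mrho rho0 r0 eta0 /andP[rs sr] small pis qis pr qr.
have r2 : (0 <= 2 * r)%R by rewrite mulr_ge0// ltW.
have vol := lebesgue_cube (remove_coord i y) r2.
have e4 : (2 * (2 * r) = 4 * r)%R by ring.
rewrite e4 in vol.
have pr' := remove_coord_cube i pr; have qr' := remove_coord_cube i qr.
rewrite cube_box in small vol pr' qr'.
have V0 : (0 < (4 * r) ^+ k)%R by rewrite exprn_gt0// mulr_gt0.
have diam x x' : box (Some ((remove_coord i y - const_mx (2 * r))%R,
      (remove_coord i y + const_mx (2 * r))%R)) x ->
    box (Some ((remove_coord i y - const_mx (2 * r))%R,
      (remove_coord i y + const_mx (2 * r))%R)) x' ->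
    (eucl_dist (insert_coord i s x) (insert_coord i s x') <= k.+1%:R * (4 * r))%R.
  rewrite -cube_box => xr x'r; rewrite -e4; apply: (@cube_diam _ _ y).
    exact/cube_slice.
  exact/cube_slice.
have er0 : (0 < eta / r)%R by rewrite divr_gt0.
apply: linked_sub (slice_linked mrho rho0 V0 er0 vol diam small pis qis pr' qr').
move=> x [xis]; rewrite -cube_box => xr; apply/shellP; split.
  rewrite -(insert_coordK i x) xis; exact/cube_slice.
by exists i; rewrite xis.
Qed.

(** The constant 61 exceeds 60 = 4 * 3 * 5: in a shell of radius [r], paths with
    Lipschitz constant [4 * r * k.+1%:R] run through at most three slices, at a
    cost of [5 * k.+1%:R * (small_slope / r)] in each. *)
Definition small_slope : R := (61 * k.+1%:R ^+ 2)^-1%R.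

Definition shell_bound : R := (small_slope ^+ k.+1 * 4 ^+ k)%R.

Lemma small_slope_gt0 : (0 < small_slope)%R.
Proof. by rewrite invr_gt0 mulr_gt0// exprn_gt0// ltr0n. Qed.

Lemma shell_bound_gt0 : (0 < shell_bound)%R.
Proof. by rewrite mulr_gt0// exprn_gt0// small_slope_gt0. Qed.

(** If [rho ^ k.+1] had a small integral over the shell, a box with all its faces
    in good slices would surround the inner cube, and both connected sets would
    meet its boundary.  Slices orthogonal to different axes intersect, and two
    slices orthogonal to the same axis both meet a third one, as the dimension is
    at least two; so the two sets would be joined through good slices at a cost
    too small for [rho] to be admissible. *)
Lemma shell_modulus rho y (r : R) (E F G : set 'rV[R]_k.+1) :
  (0 < k)%N -> (0 < r)%R -> connected E -> connected F ->
  E `&` cube y r !=set0 -> ~ (E `<=` cube y (2 * r)) ->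
  F `&` cube y r !=set0 -> ~ (F `<=` cube y (2 * r)) ->
  cube y (2 * r) `<=` G -> adm (joining_paths E F G) rho ->
  shell_bound%:E <= \int[lebesgue_rV R k.+1]_(x in shell y r) (rho x ^+ k.+1).
Proof.
move=> k0 r0 cE cF Er nEr Fr nFr yG arho; rewrite leNgt; apply/negP => small.
have [mrho rho0 _] := arho.
pose eta := small_slope; have eta0 : (0 < eta)%R := small_slope_gt0.
pose good (i : 'I_k.+1) (s : R) := (r < `|s - y ord0 i| <= 2 * r)%R /\
  \int[lebesgue_rV R k]_(w in cube (remove_coord i y) (2 * r))
    (rho (insert_coord i s w) ^+ k.+1)
    <= ((eta / r) ^+ k.+1 * (4 * r) ^+ k)%:E.
have lower (i : 'I_k.+1) : exists s,
    (y ord0 i - 2 * r < s < y ord0 i - r)%R /\ good i s.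
  have ar (t : R) : (y ord0 i - 2 * r < t < y ord0 i - 2 * r + r)%R ->
      (r < `|t - y ord0 i| <= 2 * r)%R.
    by move=> /andP[? ?]; rewrite ltr0_norm; [apply/andP; split|]; lra.
  have [t tI tg] := good_slice mrho rho0 r0 eta0 ar small.
  exists t; split; last by split => //; exact: ar.
  by move: tI => /andP[? ?]; apply/andP; split; lra.
have upper (i : 'I_k.+1) : exists s,
    (y ord0 i + r < s < y ord0 i + 2 * r)%R /\ good i s.
  have ar (t : R) : (y ord0 i + r < t < y ord0 i + r + r)%R ->
      (r < `|t - y ord0 i| <= 2 * r)%R.
    by move=> /andP[? ?]; rewrite gtr0_norm; [apply/andP; split|]; lra.
  have [t tI tg] := good_slice mrho rho0 r0 eta0 ar small.
  exists t; split; last by split => //; exact: ar.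
  by move: tI => /andP[? ?]; apply/andP; split; lra.
have [fu fuP] := choice lower; have [fv fvP] := choice upper.
pose u : 'rV[R]_k.+1 := \row_i fu i; pose v : 'rV[R]_k.+1 := \row_i fv i.
have uvr : box (Some (u, v)) `<=` cube y (2 * r).
  move=> x xuv i; have := xuv i; rewrite !mxE ler_norml => /andP[? ?].
  have [/andP[? ?] _] := fuP i; have [/andP[? ?] _] := fvP i.
  by apply/andP; split; lra.
have ruv : cube y r `<=` box (Some (u, v)).
  move=> x xr i; have := xr i; rewrite !mxE ler_norml => /andP[? ?].
  have [/andP[? ?] _] := fuP i; have [/andP[? ?] _] := fvP i.
  by apply/andP; split; lra.
have face (H : set 'rV[R]_k.+1) : connected H -> H `&` cube y r !=set0 ->
    ~ (H `<=` cube y (2 * r)) ->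
    exists p i, [/\ H p, cube y (2 * r) p & good i (p ord0 i)].
  move=> cH [x [Hx xr]] nH.
  have HB : H `&` box (Some (u, v)) !=set0 by exists x; split => //; exact: ruv.
  have nHB : ~ (H `<=` box (Some (u, v))).
    by move=> HB'; apply: nH; apply: subset_trans uvr.
  have [p Hp /boundary_box[puv [i pi]]] := connected_boundary cH HB nHB.
  exists p, i; split => //; first exact: uvr.
  by case: pi => ->; rewrite mxE; [have [] := fuP i|have [] := fvP i].
have link1 p q i s : p ord0 i = s -> q ord0 i = s -> good i s ->
    cube y (2 * r) p -> cube y (2 * r) q ->
    linked rho (shell y r) (k.+1%:R * (4 * r)) p q (5 * k.+1%:R * (eta / r))%R.
  by move=> pis qis [rs sm] pr qr; exact: (linked_in_slice _ _ _ _ rs sm).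
have L0 : (0 < k.+1%:R * (4 * r))%R by rewrite !mulr_gt0// ltr0n.
pose e := (5 * k.+1%:R * (eta / r))%R.
have e0 : (0 < e)%R by rewrite !mulr_gt0// ?invr_gt0// ltr0n.
have [p [i [Ep pr pg]]] := face E cE Er nEr.
have [q [j [Fq qr qg]]] := face F cF Fr nFr.
have pq : linked rho (shell y r) (k.+1%:R * (4 * r)) p q (e + e + e)%R.
  have r2 : (0 <= 2 * r)%R by rewrite mulr_ge0// ltW.
  have [ij|ij] := eqVneq i j; last first.
    pose z : 'rV[R]_k.+1 :=
      \row_l if l == i then p ord0 l else if l == j then q ord0 l else y ord0 l.
    have zi : z ord0 i = p ord0 i by rewrite mxE eqxx.
    have zj : z ord0 j = q ord0 j by rewrite mxE eq_sym (negbTE ij) eqxx.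
    have zr : cube y (2 * r) z.
      move=> l; rewrite mxE; case: ifP => _; first exact: pr.
      by case: ifP => _; [exact: qr|rewrite subrr normr0].
    apply: (@linked_le _ _ _ _ _ _ _ (e + e)%R); first by rewrite lerDl ltW.
    apply: (@linked_trans _ _ _ _ _ z) => //; first exact: ltW.
      exact: (link1 _ _ i (p ord0 i)).
    exact: (link1 _ _ j (q ord0 j)).
  subst j.
  have [l li] : exists l : 'I_k.+1, l != i.
    have [->|i0] := eqVneq i ord0; last by exists ord0; rewrite eq_sym.
    by exists (lift ord0 (Ordinal k0)).
  pose z (x : 'rV[R]_k.+1) : 'rV[R]_k.+1 :=
    \row_m if m == i then x ord0 m else if m == l then v ord0 m else y ord0 m.
  have zi x : z x ord0 i = x ord0 i by rewrite mxE eqxx.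
  have zl x : z x ord0 l = v ord0 l by rewrite mxE (negbTE li) eqxx.
  have zr x : cube y (2 * r) x -> cube y (2 * r) (z x).
    move=> xr m; rewrite mxE; case: ifP => _; first exact: xr.
    case: ifP => _; last by rewrite subrr normr0.
    by rewrite mxE; have [_ [/andP[_ ?] _]] := fvP m.
  have vg : good l (v ord0 l) by rewrite mxE; have [] := fvP l.
  apply: (@linked_trans _ _ _ _ _ (z q)) => //; first exact: ltW.
    apply: (@linked_trans _ _ _ _ _ (z p)) => //; first exact: ltW.
      by apply: (link1 _ _ i (p ord0 i)) => //; exact: zr.
    by apply: (link1 _ _ l (v ord0 l)) => //; exact: zr.
  by apply: (link1 _ _ i (q ord0 i)) => //; exact: zr.
have sG : shell y r `<=` G by move=> x [xr _]; exact: yG.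
apply: (linked_not_adm L0 _ pq sG Ep Fq arho).
have -> : (k.+1%:R * (4 * r) * (e + e + e) = 60 * k.+1%:R ^+ 2 * eta)%R.
  by rewrite /e; field; rewrite gt_eqF.
rewrite /eta /small_slope ltr_pdivrMr ?mulr_gt0// ?exprn_gt0// ?ltr0n//.
by rewrite mul1r ltr_pM2r ?exprn_gt0 ?ltr0n// ltr_nat.
Qed.

(** Nested shells are disjoint, and each contributes at least [shell_bound] to the
    integral of [rho ^ k.+1], whatever its radius. *)
Lemma interior_weakly_flat y (R0 P : R) (G : set 'rV[R]_k.+1) :
  (0 < k)%N -> (0 < R0)%R -> cube y R0 `<=` G ->
  exists2 s : R, (0 < s)%R & forall E F, connected E -> connected F ->
    E `&` cube y s !=set0 -> ~ (E `<=` cube y R0) ->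
    F `&` cube y s !=set0 -> ~ (F `<=` cube y R0) ->
    P%:E <= modulus (joining_paths E F G).
Proof.
move=> k0 R00 yG; pose N := Num.bound `|P / shell_bound|%R.
have PN : (P <= N%:R * shell_bound)%R.
  rewrite -ler_pdivrMr ?shell_bound_gt0// (le_trans (ler_norm _))// ltW//.
  exact/archi_boundP/normr_ge0.
exists (R0 / 2 ^+ N)%R; first by rewrite divr_gt0// exprn_gt0.
set s := (R0 / 2 ^+ N)%R => E F cE cF Es nE Fs nF.
have s0 : (0 < s)%R by rewrite divr_gt0// exprn_gt0.
apply: le_ereal_inf_tmp => _ [rho arho <-].
have [mrho rho0 _] := arho.
have mX : measurable_fun setT (fun x : Leb_type R k.+1 => rho x ^+ k.+1).
  by apply: emeasurable_funX; exact: measurable_fun_borel_leb.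
have X0 x : 0 <= rho x ^+ k.+1 by apply: expe_ge0.
have mC t : measurable (cube y t : set (Leb_type R k.+1)).
  by apply: measurable_borel; exact: borel_cube.
have step j : (j <= N)%N -> (j%:R * shell_bound)%:E <=
    \int[lebesgue_rV R k.+1]_(x in cube y (2 ^+ j * s)) (rho x ^+ k.+1).
  elim: j => [_|j ih jN]; first by rewrite mul0r integral_ge0.
  pose r := (2 ^+ j * s)%R.
  have r0 : (0 < r)%R by rewrite mulr_gt0// exprn_gt0.
  have r2 : (2 ^+ j.+1 * s = 2 * r)%R by rewrite exprS /r mulrA.
  have r2R : (2 * r <= R0)%R.
    rewrite -r2 /s mulrCA ger_pMr// ler_pdivrMr ?exprn_gt0// mul1r.
    by rewrite ler_eXn2l// ltr1n.
  have sr : (s <= r)%R by rewrite /r; apply: ler_peMl; [exact: ltW|rewrite exprn_ege1// ler1n].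
  have small (H : set 'rV[R]_k.+1) : H `&` cube y s !=set0 -> H `&` cube y r !=set0.
    by move=> [x [Hx xs]]; exists x; split => //; exact: le_cube xs.
  have large (H : set 'rV[R]_k.+1) : ~ (H `<=` cube y R0) -> ~ (H `<=` cube y (2 * r)).
    by move=> nH HR; apply: nH; apply: (subset_trans HR); exact: le_cube.
  have sh := shell_modulus k0 r0 cE cF (small _ Es) (large _ nE) (small _ Fs)
    (large _ nF) (subset_trans (le_cube r2R) yG) arho.
  rewrite r2; have -> : cube y (2 * r) = cube y r `|` shell y r.
    by rewrite setDUK//; apply: le_cube; lra.
  rewrite (@ge0_integral_setU _ _ _ (lebesgue_rV R k.+1) _ _ (mC r)).
  - rewrite -natr1 mulrDl mul1r EFinD; apply: leeD => //.
    by apply: ih; exact: ltnW.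
  - by apply: measurable_borel; exact: borel_shell.
  - exact: (measurable_funS measurableT _ mX).
  - by move=> x _; exact: X0.
  - by apply/disj_setPS => x [xr []].
apply: (@le_trans _ _ (N%:R * shell_bound)%:E); first by rewrite lee_fin.
apply: (le_trans (step N (leqnn _))).
exact: (@ge0_subset_integral _ _ _ (lebesgue_rV R k.+1) _ _ (mC _) measurableT
  _ mX (fun x _ => X0 x)).
Qed.

End Shells.

Lemma interior_points_weakly_flat (R : realType) (n : nat) (y : 'rV[R]_n)
    (r P : R) (G : set 'rV[R]_n) :
  (2 <= n)%N -> 0 < r -> cube y r `<=` G ->
  exists2 s : R, 0 < s & forall E F, connected E -> connected F ->
    E `&` cube y s !=set0 -> ~ (E `<=` cube y r) ->
    F `&` cube y s !=set0 -> ~ (F `<=` cube y r) ->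
    (P%:E <= modulus (joining_paths E F G))%E.
Proof. by case: n y G => [|k] y G // k0; exact: interior_weakly_flat. Qed.

(** * Continua and moduli in a domain *)

Lemma within_continuousE (T U : topologicalType) (A : set T) (f : T -> U) :
  {within A, continuous f} <->
  forall x, A x -> forall W, nbhs (f x) W -> nbhs x [set z | A z -> W (f z)].
Proof. by split=> [/subspace_continuousP|] h; [|apply/subspace_continuousP]. Qed.

Section Continua.
Context {R : realType} {n : nat}.
Implicit Types (x y z : 'rV[R]_n) (A C O : set 'rV[R]_n).

Lemma continuum1 x : continuum [set x].
Proof. by split; [exact: compact_set1|exact: connected1]. Qed.

Lemma continuum_path (gamma : R -> 'rV[R]_n) (a b : R) :
  {within `[a, b], continuous gamma} -> continuum (gamma @` `[a, b]).
Proof.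
move=> cg; split.
  by apply: continuous_compact => //; exact: segment_compact.
by apply: connected_continuous_connected => //; exact: segment_connected.
Qed.

Lemma continuumU A C z : continuum A -> continuum C -> A z -> C z ->
  continuum (A `|` C).
Proof.
move=> [kA cA] [kC cC] Az Cz; split; first exact: compactU.
by apply: connectedU => //; exists z.
Qed.

Definition segment x y : set 'rV[R]_n := (fun t => x + t *: (y - x)) @` `[0, 1].

Lemma continuum_segment x y : continuum (segment x y).
Proof.
apply: continuum_path; apply: (@lipschitz_on_continuous _ _ _ _ _ (eucl_dist x y)).
by move=> s t _ _; rewrite eucl_dist_segment.
Qed.

Lemma segment_left x y : segment x y x.
Proof. by exists 0; rewrite /= ?in_itv/= ?lexx ?ler01// scale0r addr0. Qed.

Lemma segment_right x y : segment x y y.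
Proof. by exists 1; rewrite /= ?in_itv/= ?lexx ?ler01// scale1r addrC subrK. Qed.

Lemma segment_eucl_ball x y r : eucl_ball x r y -> segment x y `<=` eucl_ball x r.
Proof.
move=> xyr _ [t /= /[!in_itv]/= /andP[t0 t1] <-]; rewrite /eucl_ball/=.
rewrite -[X in eucl_dist X _](addr0 x) -[X in eucl_dist (x + X) _](scale0r (y - x)).
rewrite eucl_dist_segment sub0r normrN ger0_norm//.
by apply: le_lt_trans xyr; rewrite ler_piMr// eucl_dist_ge0.
Qed.

(** The component of [x] in [O], when [O] is open; continua take the place of
    paths because weak flatness speaks of continua. *)
Definition reach O x : set 'rV[R]_n :=
  [set z | exists C, [/\ continuum C, C `<=` O, C x & C z]].

Lemma reach_refl O x : O x -> reach O x x.
Proof.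
by move=> Ox; exists [set x]; split => //; [exact: continuum1|move=> _ ->].
Qed.

Lemma reach_sub O x : reach O x `<=` O.
Proof. by move=> z [C [_ CO _ Cz]]; exact: CO. Qed.

Lemma reach_sym O x z : reach O x z -> reach O z x.
Proof. by move=> [C [? ? ? ?]]; exists C. Qed.

Lemma reach_trans O y x z : reach O x y -> reach O y z -> reach O x z.
Proof.
move=> [C [cC CO Cx Cy]] [B [cB BO By Bz]]; exists (C `|` B); split.
- exact: continuumU Cy By.
- by move=> w [/CO|/BO].
- by left.
- by right.
Qed.

Lemma reach_in O O' x z : O `<=` O' -> reach O x z -> reach O' x z.
Proof.
by move=> OO' [C [cC CO Cx Cz]]; exists C; split => //; exact: subset_trans OO'.
Qed.

Lemma open_reach O x : open O -> open (reach O x).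
Proof.
move=> oO; rewrite openE => z xz.
have [e e0 zeO] := open_eucl_ballP oO (reach_sub xz).
have : nbhs z (eucl_ball z e) by exact/open_nbhs_nbhs/open_nbhs_eucl_ball.
apply: filterS => w zw; apply: reach_trans xz _.
exists (segment z w); split.
- exact: continuum_segment.
- by apply: subset_trans zeO; exact: segment_eucl_ball.
- exact: segment_left.
- exact: segment_right.
Qed.

Lemma reach_closed O x z : open O -> O z -> closure (reach O x) z -> reach O x z.
Proof.
move=> oO Oz clz; have [w [xw zw]] : reach O x `&` reach O z !=set0.
  by apply: clz; apply: open_nbhs_nbhs; split; [exact: open_reach|exact: reach_refl].
exact: reach_trans xw (reach_sym zw).
Qed.

Lemma connected_reach O x : connected (reach O x).
Proof.
have [Ox|nOx] := pselect (O x); last first.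
  rewrite (_ : reach O x = set0); first exact: connected0.
  by apply/seteqP; split => // z [C [_ CO Cx _]]; apply: nOx; exact: CO.
have -> : reach O x = \bigcup_(C in [set C | [/\ continuum C, C `<=` O & C x]]) C.
  apply/seteqP; split => [z [C [cC CO Cx Cz]]|z [C [cC CO Cx] Cz]].
    by exists C.
  by exists C.
apply: bigcup_connected; first by exists x => C [].
by move=> C [[]].
Qed.

Lemma clopen_connected (D B : set 'rV[R]_n) : connected D -> B !=set0 -> B `<=` D ->
  open B -> (forall z, D z -> closure B z -> B z) -> B = D.
Proof.
move=> cD B0 BD oB clB; apply: cD => //.
  by exists B => //; apply/seteqP; split => [z Bz|z []//]; split => //; exact: BD.
exists (closure B); first exact: closed_closure.
by apply/seteqP; split => [z Bz|z [Dz]]; [split; [exact: BD|exact: subset_closure]|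
  exact: clB].
Qed.

Lemma open_connected_reach O x z : open O -> connected O -> O x -> O z ->
  reach O x z.
Proof.
move=> oO cO Ox Oz; suff -> : reach O x = O by [].
apply: clopen_connected => //.
- by exists x; exact: reach_refl.
- exact: reach_sub.
- exact: open_reach.
- by move=> w Ow; exact: reach_closed.
Qed.

End Continua.

Section ModulusBounds.
Context {R : realType} {n : nat}.
Local Open Scope ereal_scope.
Implicit Types (rho : 'rV[R]_n -> \bar R) (gamma : R -> 'rV[R]_n).

(** A path that moves as far as [d] has length at least [d], and integrating a
    constant with respect to arc length gives a multiple of the length. *)
Lemma line_integral_constant_ge1 rho gamma (a b t d : R) : (a <= t <= b)%R ->
  {within `[a, b], continuous gamma} ->
  locally_rectifiable (`[a, b], gamma) -> (0 < d)%R ->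
  (forall s, (a <= s <= b)%R -> rho (gamma s) = (d^-1)%:E) ->
  (d <= eucl_dist (gamma a) (gamma t))%R ->
  1 <= line_integral rho (`[a, b], gamma).
Proof.
move=> /andP[a_t tb] cg rect d0 rhoE dt.
have ab : (a <= b)%R := le_trans a_t tb.
have fin := rect a b ab (fun _ => id).
have Lfin : path_length gamma a b \is a fin_num.
  by rewrite ge0_fin_numE// path_length_ge0.
apply: (@le_trans _ _ (segment_integral rho gamma a b)); last first.
  by apply: ereal_sup_ubound; exists (a, b) => //; split.
rewrite /segment_integral; set L := fine _.
have L0 : (0 <= L)%R by rewrite fine_ge0// path_length_ge0.
have dL : (d <= L)%R.
  rewrite -lee_fin fineK//; apply: (@le_trans _ _ (path_length gamma a t)).
    apply: le_trans (eucl_dist_le_path_length gamma a_t); by rewrite lee_fin.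
  exact: le_path_length.
have -> : \int[@lebesgue_measure R]_(u in `[0%R, L]) rho (arclength_param gamma a b u) =
    \int[@lebesgue_measure R]_(u in `[0%R, L]) (d^-1)%:E.
  apply: eq_integral => u; rewrite inE/= in_itv/= => uL.
  by have [s [sab _ ->]] := arclength_time ab cg uL; exact: rhoE.
have E : @lebesgue_measure R `[0%R, L]%classic = L%:E.
  by rewrite lebesgue_measure_itvcc subr0; congr EFin; apply/max_idPr.
by rewrite integral_cst// [X in _ <= _ * X]E -EFinM lee_fin mulrC ler_pdivlMr// mul1r.
Qed.

Lemma eq_line_integral rho gamma gamma' (a b : R) :
  {within `[a, b], continuous gamma} ->
  (forall t, (a <= t <= b)%R -> gamma t = gamma' t) ->
  line_integral rho (`[a, b], gamma) = line_integral rho (`[a, b], gamma').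
Proof.
move=> cg eqg; rewrite /line_integral; congr ereal_sup.
apply: eq_imagel => -[c d] /= [cd cdab].
apply: eq_segment_integral => //; first exact: continuous_subspaceW cdab cg.
by move=> t tcd; apply: eqg; have /= := cdab t; rewrite !in_itv; exact.
Qed.

Lemma eq_locally_rectifiable gamma gamma' (a b : R) :
  (forall t, (a <= t <= b)%R -> gamma t = gamma' t) ->
  locally_rectifiable (`[a, b], gamma) -> locally_rectifiable (`[a, b], gamma').
Proof.
move=> eqg rect c d cd cdab; rewrite -(@eq_path_length _ _ gamma); first exact: rect.
by move=> t tcd; apply: eqg; have /= := cdab t; rewrite !in_itv; exact.
Qed.

(** The preimages of the paths move from [g E] to [g F], so that the constant
    [1 / d] is admissible for them.  The family of their images under [f] is as
    good as the given one: as the values of [f] and [g] outside of the domains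
    are arbitrary, the paths agree on their intervals of times only. *)
Lemma modulus_joining_le (D D' E F : set 'rV[R]_n) f g (Q : 'rV[R]_n -> \bar R) (d : R) :
  homeo_with_inverse D D' f g ->
  (forall Gamma : set (curve R n), (forall c, Gamma c -> path_in D c) ->
     forall rho, adm Gamma rho ->
       modulus (map_paths f Gamma) <=
         \int[lebesgue_rV R n]_(x in D) (Q x * rho x ^+ n)) ->
  E `<=` D' -> F `<=` D' -> (0 < d)%R ->
  (forall x y, E x -> F y -> (d <= eucl_dist (g x) (g y))%R) ->
  modulus (joining_paths E F D') <=
    \int[lebesgue_rV R n]_(x in D) (Q x * (d^-1)%:E ^+ n).
Proof.
move=> [fD gf cf cg] fgQ ED' FD' d0 dEF.
have fg y : D' y -> f (g y) = y by rewrite -fD => -[x Dx <-]; rewrite gf.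
have gD y : D' y -> D (g y) by rewrite -fD => -[x Dx <-]; rewrite gf.
pose Gamma : set (curve R n) := [set (c.1, g \o c.2) | c in joining_paths E F D'].
have inD' gamma (a b : R) t : E (gamma a) -> F (gamma b) ->
    (forall t : R, (a < t < b)%R -> D' (gamma t)) -> (a <= t <= b)%R -> D' (gamma t).
  move=> Ea Fb Gt /andP[]; rewrite le_eqVlt => /predU1P[<- _|a_t]; first exact: ED'.
  rewrite le_eqVlt => /predU1P[->|tb]; first exact: FD'.
  by apply: Gt; rewrite a_t.
have cgg gamma (a b : R) : {within `[a, b], continuous gamma} ->
    (forall t, (a <= t <= b)%R -> D' (gamma t)) ->
    {within `[a, b], continuous (g \o gamma)}.
  move=> cgamma D'g; apply/within_continuousE => t tab U nU.
  have D't : D' (gamma t) by apply: D'g; rewrite /= in_itv in tab.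
  have nV := (within_continuousE _ _).1 cg _ D't _ nU.
  have := (within_continuousE _ _).1 cgamma _ tab _ nV.
  apply: filterS => s sU sab; apply: (sU sab); apply: D'g.
  by rewrite /= in_itv in sab.
apply: (@le_trans _ _ (modulus (map_paths f Gamma))).
  apply: ereal_inf_le_tmp => _ [rho [mrho rho0 arho] <-]; exists rho => //.
  split => // -[I gamma] [a [b [ab /= -> cgamma [Ea Fb] Gt]]] rect.
  have D'g t : (a <= t <= b)%R -> D' (gamma t) by exact: inD'.
  have eqg t : (a <= t <= b)%R -> gamma t = (f \o (g \o gamma)) t.
    by move=> tab; rewrite /= fg//; exact: D'g.
  rewrite (eq_line_integral _ cgamma eqg); apply: arho; last first.
    exact: eq_locally_rectifiable rect.
  exists (`[a, b], g \o gamma) => //; exists (`[a, b], gamma) => //.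
  by exists a, b.
apply: (fgQ _ _ (cst (d^-1)%:E)).
  move=> _ [[I gamma] [a [b [ab /= -> cgamma [Ea Fb] Gt]]] <-] /=.
  have D'g t : (a <= t <= b)%R -> D' (gamma t) by exact: inD'.
  split => /=; first by exists a, b; split.
    exact: cgg.
  by move=> t; rewrite in_itv/= => tab; apply: gD; exact: D'g.
split.
- exact: measurable_cst.
- by move=> x; rewrite lee_fin invr_ge0 ltW.
move=> _ [[I gamma] [a [b [ab /= -> cgamma [Ea Fb] Gt]]] <-] /= rect.
have D'g t : (a <= t <= b)%R -> D' (gamma t) by exact: inD'.
apply: (@line_integral_constant_ge1 _ _ a b b d) => //.
- by rewrite lexx ltW.
- exact: cgg.
- exact: dEF.
Qed.

Lemma compact_sub_cube (A : set 'rV[R]_n) : compact A ->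
  exists2 M : R, (0 <= M)%R & A `<=` cube 0 M.
Proof.
move=> kA; have cov : A `<=` \bigcup_(k in [set: nat]) eucl_ball 0%R k%:R.
  by move=> x _; exists (Num.bound (eucl_dist 0%R x)) => //; apply: archi_boundP;
    exact: eucl_dist_ge0.
have := kA; rewrite compact_cover => /(_ _ setT (fun k : nat => eucl_ball 0%R k%:R)).
case=> [k _|//|D _ AD]; first exact: open_eucl_ball.
exists (\max_(k <- finmap.enum_fset D) k)%:R => // x /AD[k kD xk].
apply: cube_eucl_dist; rewrite (le_trans (ltW xk))// ler_nat.
exact: (@leq_bigmax_seq _ _ xpredT id).
Qed.

(** Points near [y0] that could not be joined near [y0] would lie on long
    continua separated by the region between two spheres around [y0]; the
    modulus of the paths joining these is bounded, which weak flatness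
    forbids. *)
Lemma weakly_flat_locally_connected (D' : set 'rV[R]_n) (y0 : 'rV[R]_n) :
  (0 < n)%N -> domain D' -> compact (closure D') -> boundary D' y0 ->
  weakly_flat_at D' y0 -> locally_connected_at D' y0.
Proof.
move=> n0 [[q D'q] oD' cD'] kD' [cly0 ny0] flat U [oU Uy0].
have D'y0 : ~ D' y0 by move=> D'y0; apply: ny0; exact: open_nbhs_nbhs.
have [e e0 eU] := open_eucl_ballP oU Uy0.
have y0q : (0 < eucl_dist y0 q)%R.
  rewrite lt_neqAle eucl_dist_ge0 andbT eq_sym; apply/eqP => /eucl_dist_eq0 y0q.
  by rewrite y0q in D'y0.
pose r := Num.min e (eucl_dist y0 q).
have r0 : (0 < r)%R by rewrite lt_min e0.
have re : (r <= e)%R by rewrite ge_min lexx.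
have rq : (r <= eucl_dist y0 q)%R by rewrite ge_min lexx orbT.
have [M M0 D'M] := compact_sub_cube kD'.
pose d := (r / 3)%R; have d0 : (0 < d)%R by rewrite divr_gt0.
pose P : R := ((d^-1) ^+ n * (2 * M) ^+ n + 1)%R.
have P0 : (0 < P)%R.
  by rewrite ltr_wpDl// mulr_ge0// exprn_ge0 ?invr_ge0 ?mulr_ge0// ltW.
have [V [[oV Vy0] VU1 flatV]] := flat P P0 _ (open_nbhs_eucl_ball y0 d0).
pose O2 := D' `&` eucl_ball y0 (d + d); pose O3 := D' `&` eucl_ball y0 r.
have oO2 : open O2 by apply: openI => //; exact: open_eucl_ball.
have oO3 : open O3 by apply: openI => //; exact: open_eucl_ball.
have O23 : O2 `<=` O3.
  by move=> x [D'x xd]; split => //; apply: (lt_trans xd); rewrite /d; lra.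
have O2V x : V x -> D' x -> O2 x.
  move=> /VU1 xd D'x; split => //; apply: (lt_trans xd); rewrite /d; lra.
have far x : V x -> D' x -> exists E, [/\ continuum E, E `<=` O2, E x,
    E `&` boundary (eucl_ball y0 d) !=set0 & E `&` boundary V !=set0].
  move=> Vx D'x; have O2x := O2V x Vx D'x.
  have [z [zx dz]] : exists z, reach O2 x z /\ (d <= eucl_dist y0 z)%R.
    apply: contrapT => nz.
    have near_y0 z : reach O2 x z -> (eucl_dist y0 z <= d)%R.
      by move=> xz; rewrite leNgt; apply/negP => /ltW dz; apply: nz; exists z.
    have D'E : reach O2 x = D'.
      apply: clopen_connected => //.
      - by exists x; exact: reach_refl.
      - by move=> z /reach_sub[].
      - exact: open_reach.
      move=> z D'z clz; apply: reach_closed => //; split => //.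
      have : closure [set z | (eucl_dist y0 z <= d)%R] z by exact: closureS clz.
      move=> /(@closed_eucl_ball _ _ y0 d) /= zd; apply: (le_lt_trans zd).
      by rewrite ltrDl.
    have := near_y0 q; rewrite D'E => /(_ D'q) /(le_trans rq).
    by rewrite leNgt /d; apply/negP/negPn; lra.
  have [E [cE EO2 Ex Ez]] := zx; exists E; split => //.
    have [|zE|w Ew bw] := connected_boundary cE.2 (S := eucl_ball y0 d).
    - by exists x; split => //; exact: VU1.
    - by have := zE z Ez; rewrite /eucl_ball/= ltNge dz.
    by exists w.
  have [|zE|w Ew bw] := connected_boundary cE.2 (S := V).
  - by exists x.
  - by have := VU1 _ (zE z Ez); rewrite /eucl_ball/= ltNge dz.
  by exists w.
have VO3 x x' : V x -> D' x -> V x' -> D' x' -> reach O3 x x'.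
  move=> Vx D'x Vx' D'x'.
  have [E [cE EO2 Ex EU EV]] := far x Vx D'x.
  have [F [cF FO2 Fx' FU FV]] := far x' Vx' D'x'.
  apply: contrapT => nxx'.
  have ED' : E `<=` D' by move=> z /EO2[].
  have FD' : F `<=` D' by move=> z /FO2[].
  have := flatV E F cE cF ED' FD' EU EV FU FV; apply/negP; rewrite -leNgt.
  pose rho : 'rV[R]_n -> \bar R := (cst (d^-1)%:E) \_ (cube 0%R M).
  have mrho : borel_fun rho.
    by apply/(measurable_restrictT _ _).1; [exact: borel_cube|exact: measurable_cst].
  have rho0 z : 0 <= rho z.
    by rewrite /rho patchE; case: ifP => // _; rewrite lee_fin invr_ge0 ltW.
  apply: (@le_trans _ _ (\int[lebesgue_rV R n]_z (rho z ^+ n))).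
    apply: ereal_inf_lbound; exists rho => //; split => //.
    move=> [I gamma] [a [b [ab /= -> cgamma [Ea Fb] Gt]]] rect.
    have D'g t : (a <= t <= b)%R -> D' (gamma t).
      move=> /andP[]; rewrite le_eqVlt => /predU1P[<- _|a_t]; first exact: ED'.
      rewrite le_eqVlt => /predU1P[->|tb]; first exact: FD'.
      by apply: Gt; rewrite a_t.
    have [t [tab rt]] : exists t, (a <= t <= b)%R /\ (r <= eucl_dist y0 (gamma t))%R.
      apply: contrapT => nt; apply: nxx'.
      have gO3 : gamma @` `[a, b] `<=` O3.
        move=> z [t /=]; rewrite in_itv/= => tab <-; split; first exact: D'g.
        by rewrite /eucl_ball/= ltNge; apply/negP => rt; apply: nt; exists t.
      apply: (@reach_trans _ _ _ (gamma a)).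
        by exists E; split => //; exact: subset_trans O23.
      apply: (@reach_trans _ _ _ (gamma b)).
        exists (gamma @` `[a, b]); split => //; first exact: continuum_path.
          by exists a; rewrite //= in_itv/= lexx ltW.
        by exists b; rewrite //= in_itv/= lexx ltW.
      by exists F; split => //; exact: subset_trans O23.
    apply: (@line_integral_constant_ge1 _ _ _ _ t d) => //.
      move=> s sab; rewrite /rho patchE mem_set//.
      by apply: D'M; apply: subset_closure; exact: D'g.
    have [_ ad] := EO2 _ Ea; have := eucl_dist_triangle (gamma a) y0 (gamma t).
    by move: ad rt; rewrite /eucl_ball/= /d; lra.
  have -> : \int[lebesgue_rV R n]_z (rho z ^+ n) =
      \int[lebesgue_rV R n]_(z in cube 0%R M) ((d^-1) ^+ n)%:E.
    rewrite [RHS]integral_mkcond; apply: eq_integral => z _.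
    rewrite /rho !patchE; case: ifP => _; first by rewrite EFin_expe.
    by rewrite -(prednK n0) expeS mul0e.
  rewrite integral_cst; last by apply: measurable_borel; exact: borel_cube.
  have -> : lebesgue_rV R n (cube 0%R M) = ((2 * M) ^+ n)%:E by exact: lebesgue_cube.
  by rewrite -EFinM lee_fin lerDl.
have [x [D'x Vx]] : D' `&` V !=set0 by apply: cly0; exact: open_nbhs_nbhs.
exists (reach O3 x `|` V); split.
- by split; [apply: openU => //; exact: open_reach|right].
- move=> z [/reach_sub[_ zr]|/VU1 zd]; apply: eU.
    by apply: (lt_le_trans zr).
  by apply: (lt_le_trans zd); rewrite (le_trans _ re)// /d; lra.
have -> : (reach O3 x `|` V) `&` D' = reach O3 x.
  apply/seteqP; split => [z [[//|Vz] D'z]|z xz]; first exact: VO3.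
  by split; [left|have [] := reach_sub xz].
exact: connected_reach.
Qed.

End ModulusBounds.

(** * Images of a fixed continuum *)

Section Shadow.
Context {R : realType} {n : nat}.
Implicit Types (x y z : 'rV[R]_n) (D N : set 'rV[R]_n).

(** Every point of [K] has a small neighborhood that meets [D] in a connected set.
    The points of [K] whose neighborhoods are reached from that of [y] inside
    [D `&` N] form a subset that is open and closed in [K], hence all of [K]. *)
Lemma boundary_shadow D N (K : set 'rV[R]_n) y z (N1 N2 : set 'rV[R]_n) :
  open D -> connected K -> K `<=` boundary D ->
  (forall x, K x -> locally_connected_at D x) -> open N -> K `<=` N ->
  K y -> K z -> open_nbhs y N1 -> open_nbhs z N2 ->
  exists a b, [/\ N1 a, N2 b & reach (D `&` N) a b].
Proof.
move=> oD cK KD lc oN KN Ky Kz yN1 zN2.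
have lcN x : exists V, K x -> [/\ open_nbhs x V, V `<=` N & connected (V `&` D)].
  have [Kx|nKx] := pselect (K x); last by exists setT.
  by have [V ?] := lc x Kx N (conj oN (KN x Kx)); exists V.
have [V VP] := choice lcN.
have meet x W : K x -> open_nbhs x W -> (D `&` W) !=set0.
  by move=> /KD[clx _] xW; apply: clx; exact: open_nbhs_nbhs.
have [a [Da [N1a Va]]] : (D `&` (N1 `&` V y)) !=set0.
  by apply: (meet y _ Ky); apply: open_nbhsI => //; have [] := VP y Ky.
have VDreach x u w : K x -> V x u -> D u -> V x w -> D w -> reach (D `&` N) u w.
  move=> Kx Vu Du Vw Dw; have [[oV _] VN cV] := VP x Kx.
  apply: (@reach_in _ _ (V x `&` D)); first by move=> p [/VN].
  by apply: open_connected_reach => //; exact: openI.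
pose T := [set x | K x /\ exists w, [/\ V x w, D w & reach (D `&` N) a w]].
have TV x x' : K x -> K x' -> V x x' -> (T x <-> T x').
  move=> Kx Kx' Vxx'; have [Vx _ _] := VP x Kx; have [Vx' _ _] := VP x' Kx'.
  have [w [Dw [Vw V'w]]] : (D `&` (V x `&` V x')) !=set0.
    by apply: (meet x' _ Kx'); apply: open_nbhsI => //; split => //; exact: Vx.1.
  split=> -[_ [u [Vu Du au]]]; split => //; exists w; split => //.
    by apply: reach_trans au _; exact: (VDreach x).
  by apply: reach_trans au _; exact: (VDreach x').
have TK : T = K.
  apply: cK.
  - exists y; split => //; exists a; split => //.
    apply: reach_refl; split => //; have [_ VN _] := VP y Ky; exact: VN.
  - exists (\bigcup_(x in T) V x).
      by apply: bigcup_open => x [Kx _]; have [[]] := VP x Kx.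
    apply/seteqP; split => [x Tx|x [Kx [x' Tx' x'x]]].
      split; first exact: Tx.1.
      by exists x => //; have [[]] := VP x Tx.1.
    by apply/(TV x' x) => //; exact: Tx'.1.
  exists (~` \bigcup_(x in K `\` T) V x).
    apply: open_closedC; apply: bigcup_open => x [Kx _].
    by have [[]] := VP x Kx.
  apply/seteqP; split => [x Tx|x [Kx nx]].
    split; first exact: Tx.1.
    by move=> [x' [Kx' nTx'] x'x]; apply: nTx'; apply/(TV x' x) => //; exact: Tx.1.
  apply: contrapT => nTx; apply: nx; exists x => //.
  by have [[]] := VP x Kx.
have [_ [w [Vw Dw aw]]] : T z by rewrite TK.
have [b [Db [N2b Vb]]] : (D `&` (N2 `&` V z)) !=set0.
  by apply: (meet z _ Kz); apply: open_nbhsI => //; have [] := VP z Kz.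
exists a, b; split => //; apply: reach_trans aw _; exact: (VDreach z).
Qed.

Lemma compact_open_gap (A D : set 'rV[R]_n) : compact A -> open D -> A `<=` D ->
  exists2 d, 0 < d & forall a x, A a -> eucl_dist a x < d -> D x.
Proof.
move=> kA oD AD.
pose f (k : nat) : set 'rV[R]_n := [set a | eucl_ball a (k.+1%:R^-1) `<=` D]°.
have Af : A `<=` \bigcup_(k in [set: nat]) f k.
  move=> a /AD Da; have [e e0 aeD] := open_eucl_ballP oD Da.
  have e20 : 0 < e / 2 by rewrite divr_gt0.
  have [k] := ltr_add_invr e20; rewrite add0r => ke.
  exists k => //; have : nbhs a (eucl_ball a (e / 2)).
    exact/open_nbhs_nbhs/open_nbhs_eucl_ball.
  apply: filterS => b ab c bc; apply: aeD; rewrite /eucl_ball/=.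
  apply: (le_lt_trans (eucl_dist_triangle b _ _)).
  by rewrite [ltRHS]splitr; apply: ltrD => //; exact: lt_trans bc ke.
have := kA; rewrite compact_cover => /(_ _ setT f).
case=> [k _|//|s _ As]; first exact: open_interior.
pose m := (\max_(k <- finmap.enum_fset s) k)%N.
exists (m.+1%:R^-1); first by rewrite invr_gt0.
move=> a x Aa ax; have [k ks ak] := As a Aa.
apply: (interior_subset ak); apply: (lt_le_trans ax).
rewrite lef_pV2 ?posrE// ler_nat ltnS; exact: (@leq_bigmax_seq _ _ xpredT id).
Qed.

End Shadow.

Section MappingClass.
Context {R : realType} {n : nat} {D D' : set 'rV[R]_n}.
Variable Q : 'rV[R]_n -> \bar R.
Hypothesis domD : domain D.
Hypothesis domD' : domain D'.
Hypothesis Q1 : forall x, D x -> (1 <= Q x)%E.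
Hypothesis intQ : (lebesgue_rV R n).-integrable D Q.

Lemma homeo_values f g : homeo_with_inverse D D' f g ->
  [/\ forall x, D x -> D' (f x), forall x, D x -> g (f x) = x,
      forall y, D' y -> D (g y) & forall y, D' y -> f (g y) = y].
Proof.
move=> [fD gf _ _]; split => // [x Dx|y|y]; first by rewrite -fD; exists x.
  by rewrite -fD => -[x Dx <-]; rewrite gf.
by rewrite -fD => -[x Dx <-]; rewrite gf.
Qed.

Lemma modulus_bound : exists2 q : R, 0 <= q &
  forall delta A g E F d, S_class delta A Q D D' g -> E `<=` D' -> F `<=` D' ->
    0 < d -> (forall x y, E x -> F y -> d <= eucl_dist (g x) (g y)) ->
    (modulus (joining_paths E F D') <= (q * d^-1 ^+ n)%:E)%E.
Proof.
have [mQ fQ] := integrableP _ _ _ intQ.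
have Q0 x : D x -> (0 <= Q x)%E by move=> /Q1; apply: le_trans; rewrite lee_fin.
have mD : measurable (D : set (Leb_type R n)).
  by apply: measurable_borel; apply: open_borel; case: domD.
have IQ : (\int[lebesgue_rV R n]_(x in D) Q x)%E \is a fin_num.
  rewrite ge0_fin_numE; last exact: integral_ge0.
  apply: le_lt_trans fQ; rewrite le_eqVlt; apply/predU1P; left.
  by apply: eq_integral => x; rewrite inE => Dx; rewrite gee0_abs ?Q0.
exists (fine (\int[lebesgue_rV R n]_(x in D) Q x)%E).
  by rewrite fine_ge0// integral_ge0.
move=> delta A g E F d [f [fg _ mod_le]] ED' FD' d0 dEF.
apply: (le_trans (modulus_joining_le fg mod_le ED' FD' d0 dEF)).
rewrite (@ge0_integralZr _ _ _ (lebesgue_rV R n) D mD Q mQ)//; last first.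
  by rewrite expe_ge0// lee_fin invr_ge0 ltW.
by rewrite EFinM EFin_expe (fineK IQ).
Qed.

Lemma homeo_continuum f g C : homeo_with_inverse D D' f g -> continuum C ->
  C `<=` D -> continuum (f @` C) /\ f @` C `<=` D'.
Proof.
move=> fg [kC cC] CD; have [fD _ _ _] := homeo_values fg.
have [_ _ cf _] := fg; have cfC := continuous_subspaceW CD cf.
split; last by move=> _ [x Cx <-]; apply: fD; exact: CD.
split; first exact: continuous_compact.
exact: connected_continuous_connected.
Qed.

Lemma rV_hausdorff : hausdorff_space 'rV[R]_n.
Proof.
move=> x y clxy; apply: eucl_dist_eq0; apply/eqP; rewrite eq_le eucl_dist_ge0 andbT.
rewrite leNgt; apply/negP => xy; have d0 : 0 < eucl_dist x y / 2 by rewrite divr_gt0.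
have [z [xz yz]] := clxy _ _ (open_nbhs_nbhs (open_nbhs_eucl_ball x d0))
  (open_nbhs_nbhs (open_nbhs_eucl_ball y d0)).
have := eucl_dist_triangle z x y; rewrite (eucl_distC z).
by move: xz yz; rewrite /eucl_ball/=; lra.
Qed.

(** Otherwise the image of [A], whose diameter is at least [delta], would come
    close to [y0].  So do continua of [D'] that accompany the path component of
    [y0] in the boundary, which is not a point; they can be taken disjoint from
    the image of a compact neighborhood of [A], which means that their preimages
    stay away from [A].  Weak flatness at [y0] and [modulus_bound] then
    contradict each other. *)
Lemma image_avoids_boundary_point delta A y0 :
  (0 < n)%N -> 0 < delta -> continuum A -> A `<=` D ->
  compact (closure D) -> compact (closure D') -> weakly_flat_boundary D' ->
  (forall x, boundary D' x ->
     nondegenerate_continuum (path_component (boundary D') x)) ->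
  boundary D' y0 ->
  exists2 V, open_nbhs y0 V & forall g y, S_class delta A Q D D' g ->
    V y -> D' y -> ~ A (g y).
Proof.
move=> n0 delta0 cA AD kD kD' flat nondeg by0.
have [_ oD _] := domD; have [_ oD' _] := domD'.
have [q q0 modq] := modulus_bound.
have bD' x : boundary D' x -> ~ D' x.
  by move=> [_ nx] D'x; apply: nx; exact: open_nbhs_nbhs.
have [[_ cK] nK] := nondeg y0 by0; set K := path_component _ _ in cK nK.
have Ky0 : K y0.
  by exists (cst y0); split => //; apply: continuous_subspaceT => x; exact: cvg_cst.
have KD' : K `<=` boundary D'.
  by move=> x [gam [_ _ <-]]; apply; rewrite ler01 lexx.
have [z [Kz zy0]] : exists z, K z /\ z <> y0.
  apply: contrapT => nz; apply: (nK y0); apply/seteqP; split => [z Kz|_ -> //].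
  by apply: contrapT => zy0; apply: nz; exists z.
have y0z : 0 < eucl_dist y0 z.
  rewrite lt_neqAle eucl_dist_ge0 andbT eq_sym; apply/eqP => /eucl_dist_eq0 y0z.
  exact: zy0.
have [d0 d00 gap] := compact_open_gap cA.1 oD AD.
pose d := d0 / 2; have dgt0 : 0 < d by rewrite divr_gt0.
pose B := closure [set x | exists2 a, A a & eucl_dist a x < d].
have BD : B `<=` D.
  move=> x clx; have [x' [[a Aa ax'] xx']] := clx _
    (open_nbhs_nbhs (open_nbhs_eucl_ball x dgt0)).
  apply: (gap a) => //; apply: (le_lt_trans (eucl_dist_triangle x' _ _)).
  by move: ax' xx'; rewrite /eucl_ball/= (eucl_distC x) /d; lra.
have kB : compact B.
  apply: (subclosed_compact _ kD); first exact: closed_closure.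
  by move=> x /BD Dx; exact: subset_closure.
(* the ball of radius [r] contains neither a set of diameter [delta] nor [z] *)
pose r := Num.min (delta / 3) (eucl_dist y0 z / 2).
have r0 : 0 < r by rewrite lt_min !divr_gt0.
have rdelta : r <= delta / 3 by rewrite ge_min lexx.
have rz : r <= eucl_dist y0 z / 2 by rewrite ge_min lexx orbT.
pose P := q * d^-1 ^+ n + 1.
have P0 : 0 < P by rewrite ltr_wpDl// mulr_ge0// exprn_ge0// invr_ge0 ltW.
have [V [yV VU flatV]] := flat y0 by0 P P0 _ (open_nbhs_eucl_ball y0 r0).
exists V => // g y Sg Vy D'y Agy; have [f [fg diamA _]] := Sg.
have [fD gf gD' fgK] := homeo_values fg.
have [cE ED'] := homeo_continuum fg cA AD.
have nEU : ~ (f @` A `<=` eucl_ball y0 r).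
  move=> EU; suff : (eucl_diam (f @` A) < delta%:E)%E by rewrite ltNge diamA.
  apply: (@le_lt_trans _ _ (2 * r)%:E); last by rewrite lte_fin; lra.
  apply: ge_ereal_sup => _ [[u v] /= [/EU Eu /EU Ev] <-]; rewrite lee_fin.
  apply: (le_trans (eucl_dist_triangle y0 _ _)); rewrite (eucl_distC u).
  by move: Eu Ev; rewrite /eucl_ball/=; lra.
have Ey : (f @` A) y by exists (g y) => //; exact: fgK.
have kfB : compact (f @` B).
  apply: continuous_compact => //; have [_ _ cf _] := fg.
  exact: continuous_subspaceW BD cf.
have oN : open (~` (f @` B)).
  by apply: closed_openC; apply: compact_closed => //; exact: rV_hausdorff.
have KN : K `<=` ~` (f @` B).
  by move=> x /KD'/bD' nD'x [b Bb bx]; apply: nD'x; rewrite -bx; apply: fD; exact: BD.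
have lcK x : K x -> locally_connected_at D' x.
  by move=> /KD' bx; apply: weakly_flat_locally_connected => //; exact: flat.
have oFar : open (~` [set x | eucl_dist y0 x <= r]).
  by apply: closed_openC; exact: closed_eucl_ball.
have zFar : open_nbhs z (~` [set x | eucl_dist y0 x <= r]).
  by split => //= zr; move: zr rz y0z; lra.
have [a [b [Va nUb [F [cF FDN Fa Fb]]]]] :=
  boundary_shadow oD' cK KD' lcK oN KN Ky0 Kz yV zFar.
have nFU : ~ (F `<=` eucl_ball y0 r) by move=> /(_ b Fb) br; apply: nUb; exact: ltW.
have Vin (H : set 'rV[R]_n) : ~ (H `<=` eucl_ball y0 r) -> ~ (H `<=` V).
  by move=> nH HV; apply: nH; exact: subset_trans VU.
have FD' : F `<=` D' by move=> x /FDN[].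
have meets (H : set 'rV[R]_n) (S : set 'rV[R]_n) w : connected H -> H w -> S w ->
    ~ (H `<=` S) -> H `&` boundary S !=set0.
  move=> cH Hw Sw nHS; have HS : H `&` S !=set0 by exists w.
  by have [x Hx bx] := connected_boundary cH HS nHS; exists x.
have := flatV _ F cE cF ED' FD' (meets _ _ y cE.2 Ey (VU _ Vy) nEU)
  (meets _ _ y cE.2 Ey Vy (Vin _ nEU)) (meets _ _ a cF.2 Fa (VU _ Va) nFU)
  (meets _ _ a cF.2 Fa Va (Vin _ nFU)).
apply/negP; rewrite -leNgt.
apply: (le_trans (modq _ _ _ _ _ d Sg ED' FD' dgt0 _)); last by rewrite lee_fin lerDl.
move=> _ w [p Ap <-] Fw; rewrite gf; last exact: AD.
rewrite leNgt; apply/negP => pw; have [D'w] := FDN w Fw; apply.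
exists (g w); last exact: fgK.
by apply: subset_closure; exists p.
Qed.

End MappingClass.

(** * Oscillation of the mappings *)

Section Rays.
Context {R : realType} {n : nat}.
Implicit Types (x v : 'rV[R]_n) (D : set 'rV[R]_n).

Lemma eucl_dist_line x v (s t : R) :
  eucl_dist (x + s *: v) (x + t *: v) = eucl_dist 0 v * `|s - t|.
Proof.
have := eucl_dist_segment x (x + v) s t; rewrite addrAC subrr add0r => ->.
by congr (_ * _); rewrite /eucl_dist; congr Num.sqrt; apply: eq_bigr => i _;
  rewrite !mxE; ring.
Qed.

Definition ray_times D x v : set R :=
  [set t | 0 <= t /\ forall s, 0 <= s <= t -> D (x + s *: v)].

Definition ray D x v : set 'rV[R]_n := (fun t => x + t *: v) @` ray_times D x v.

Lemma ray_times_interval D x v : is_interval (ray_times D x v).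
Proof.
move=> s t [s0 _] [_ tD] u /andP[su ut]; split; first exact: le_trans su.
by move=> w /andP[w0 wu]; apply: tD; rewrite w0 (le_trans wu).
Qed.

Lemma ray_sub D x v : ray D x v `<=` D.
Proof. by move=> _ [t [t0 tD] <-]; apply: tD; rewrite t0 lexx. Qed.

Lemma ray_origin D x v : D x -> ray D x v x.
Proof.
move=> Dx; exists 0; last by rewrite scale0r addr0.
split => // s s0; have -> : s = 0 by apply/eqP; rewrite eq_le andbC.
by rewrite scale0r addr0.
Qed.

Lemma connected_ray D x v : connected (ray D x v).
Proof.
apply: connected_continuous_connected.
  by apply/connected_intervalP; exact: ray_times_interval.
apply/within_continuousE => t _ U /nbhs_eucl_dist[e e0 eU].
have v1 : 0 < eucl_dist 0 v + 1 by rewrite ltr_wpDl// eucl_dist_ge0.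
apply/nbhs_ballP; exists (e / (eucl_dist 0 v + 1)); first by rewrite /= divr_gt0.
move=> s /= ts _; apply: eU; rewrite eucl_dist_line.
apply: (@le_lt_trans _ _ ((eucl_dist 0 v + 1) * `|t - s|)).
  by rewrite ler_wpM2r// lerDl.
by rewrite mulrC -ltr_pdivlMr.
Qed.

(** As [D] is bounded, the ray is; if it stayed in a closed subset of [D], its far
    end would belong to [D], where it could be continued. *)
Lemma ray_leaves_compact D x v (G : set 'rV[R]_n) : open D -> compact (closure D) ->
  D x -> 0 < eucl_dist 0 v -> closed G -> G `<=` D -> ~ (ray D x v `<=` G).
Proof.
move=> oD kD Dx v0 cG GD rG; pose T := ray_times D x v.
have T0 : T 0.
  split => // s s0; have -> : s = 0 by apply/eqP; rewrite eq_le andbC.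
  by rewrite scale0r addr0.
have [M M0 DM] := compact_sub_cube kD.
have DMx y : D y -> cube 0 M y by move=> Dy; apply: DM; exact: subset_closure.
have supT : has_sup T.
  split; first by exists 0.
  exists (n%:R * (2 * M) / eucl_dist 0 v) => t [t0 tD].
  rewrite ler_pdivlMr// mulrC.
  have Dt : D (x + t *: v) by apply: tD; rewrite t0 lexx.
  have := eucl_dist_line x v 0 t; rewrite scale0r addr0 sub0r normrN ger0_norm// => <-.
  by apply: (@cube_diam _ _ 0); exact: DMx.
pose t0 := sup T; have t00 : 0 <= t0 by exact: ub_le_sup supT.2 _ T0.
have below s : 0 <= s -> s < t0 -> D (x + s *: v).
  move=> s0 st0; have [t [_ tD] st] := sup_gt supT.1 st0.
  by apply: tD; rewrite s0 ltW.
have Gt0 : G (x + t0 *: v).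
  apply: contrapT => nG; have oG : open (~` G) by exact: closed_openC.
  have [e e0 eG] := open_eucl_ballP oG nG.
  pose h := e / eucl_dist 0 v; have h0 : 0 < h by rewrite divr_gt0.
  have th : t0 - h < t0 by rewrite ltrBlDr ltrDl.
  have [t Tt tt0] := sup_gt supT.1 th.
  have tle : t <= t0 by exact: ub_le_sup supT.2 _ Tt.
  apply: (eG (x + t *: v)); last by apply: rG; exists t.
  rewrite /eucl_ball/= eucl_dist_line mulrC -ltr_pdivlMr// ger0_norm ?subr_ge0//.
  by rewrite ltrBlDr -ltrBlDl.
have [e e0 eD] := open_eucl_ballP oD (GD _ Gt0).
pose h := e / eucl_dist 0 v; have h0 : 0 < h by rewrite divr_gt0.
have : T (t0 + h / 2).
  split; first by rewrite addr_ge0// divr_ge0// ltW.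
  move=> s /andP[s0 sh]; have [st0|t0s] := ltP s t0; first exact: below.
  apply: eD; rewrite /eucl_ball/= eucl_dist_line mulrC -ltr_pdivlMr// -/h.
  by rewrite ler0_norm; lra.
move=> /(ub_le_sup supT.2); rewrite -/t0; lra.
Qed.

End Rays.

Section Oscillation.
Context {R : realType} {n : nat} {D D' : set 'rV[R]_n}.
Variable Q : 'rV[R]_n -> \bar R.
Hypothesis domD : domain D.
Hypothesis domD' : domain D'.
Hypothesis Q1 : forall x, D x -> (1 <= Q x)%E.
Hypothesis intQ : (lebesgue_rV R n).-integrable D Q.
Hypothesis kD : compact (closure D).
Hypothesis kD' : compact (closure D').

(** If [g y] and [g y'] are far apart, the two opposite rays that they emit along
    their common line stay far apart until they leave [D].  The images of the
    rays in [D'] start near [y0] and leave every compact subset of [D'], so that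
    weak flatness at [y0] makes the modulus between them too large. *)
Lemma oscillation_interior delta A y0 eps : (2 <= n)%N -> 0 < eps -> D' y0 ->
  exists2 V, open_nbhs y0 V & forall g y y', S_class delta A Q D D' g ->
    V y -> D' y -> V y' -> D' y' -> eucl_dist (g y) (g y') < eps.
Proof.
move=> n2 eps0 D'y0; have [_ oD _] := domD; have [_ oD' _] := domD'.
have [q q0 modq] := modulus_bound (D' := D') domD Q1 intQ.
have [r r0 rD'] := nbhs_cube (open_nbhs_nbhs (conj oD' D'y0)).
pose P := q * eps^-1 ^+ n + 1.
have [s s0 sP] := interior_points_weakly_flat P n2 r0 rD'.
exists (eucl_ball y0 s); first exact: open_nbhs_eucl_ball.
move=> g y y' Sg sy D'y sy' D'y'; rewrite ltNge; apply/negP => far.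
have [f [fg _ _]] := Sg; have [fD gf gD' fgK] := homeo_values fg.
have [_ _ cf cg] := fg.
pose x := g y; pose x' := g y'; pose v := x - x'; pose v' := x' - x.
have Dx : D x by exact: gD'. have Dx' : D x' by exact: gD'.
have vE : eucl_dist 0 v = eucl_dist x x'.
  by rewrite /eucl_dist /v; congr Num.sqrt; apply: eq_bigr => i _; rewrite !mxE; ring.
have v'E : eucl_dist 0 v' = eucl_dist x x'.
  by rewrite /eucl_dist /v'; congr Num.sqrt; apply: eq_bigr => i _; rewrite !mxE; ring.
have xx'0 : 0 < eucl_dist x x' by exact: lt_le_trans far.
have v0 : 0 < eucl_dist 0 v by rewrite vE.
have v'0 : 0 < eucl_dist 0 v' by rewrite v'E.
pose E := f @` ray D x v; pose F := f @` ray D x' v'.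
have conn z w : connected (f @` ray D z w).
  apply: connected_continuous_connected; first exact: connected_ray.
  by apply: continuous_subspaceW cf; exact: ray_sub.
have near_y0 z w u : f z = u -> D z -> eucl_ball y0 s u ->
    (f @` ray D z w) `&` cube y0 s !=set0.
  move=> fzu Dz us; exists u; split; first by exists z => //; exact: ray_origin.
  by apply: cube_eucl_dist; exact: ltW.
have leaves z w : D z -> 0 < eucl_dist 0 w -> ~ (f @` ray D z w `<=` cube y0 r).
  move=> Dz w0 sub; apply: (@ray_leaves_compact _ _ D z w (g @` cube y0 r)) => //.
  - apply: compact_closed; first exact: rV_hausdorff.
    apply: continuous_compact; first exact: continuous_subspaceW rD' cg.
    apply: (subclosed_compact _ kD'); first exact: closed_cube.
    by move=> p /rD' D'p; exact: subset_closure.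
  - by move=> _ [p /rD' D'p <-]; exact: gD'.
  move=> p rp; exists (f p); first by apply: sub; exists p.
  by apply: gf; exact: ray_sub rp.
have inD' z w : f @` ray D z w `<=` D'.
  by move=> _ [p /ray_sub Dp <-]; exact: fD.
have := sP E F (conn _ _) (conn _ _) (near_y0 _ _ y (fgK _ D'y) Dx sy)
  (leaves _ _ Dx v0) (near_y0 _ _ y' (fgK _ D'y') Dx' sy')
  (leaves _ _ Dx' v'0).
apply/negP; rewrite -ltNge.
apply: (@le_lt_trans _ _ (q * eps^-1 ^+ n)%:E); last by rewrite lte_fin ltrDl.
apply: (modq _ _ _ _ _ _ Sg (inD' _ _) (inD' _ _) eps0).
move=> _ _ [p rp <-] [p' rp' <-]; rewrite !gf; try exact: ray_sub rp'; try exact: ray_sub rp.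
have [t [t0 _] <-] := rp; have [t' [t'0 _] <-] := rp'.
have -> : x + t *: v = x' + (1 + t) *: v.
  by rewrite scalerDl scale1r addrA /v (addrC x') subrK.
have -> : x' + t' *: v' = x' + (- t') *: v.
  by rewrite /v' -opprB scalerN scaleNr.
rewrite eucl_dist_line vE opprK ger0_norm; last by rewrite !addr_ge0.
by apply: (le_trans far); rewrite ler_peMr ?eucl_dist_ge0// -addrA lerDl addr_ge0.
Qed.

Lemma continuum_extend A (s : seq 'rV[R]_n) : continuum A -> A `<=` D ->
  A !=set0 -> (forall p, p \in s -> D p) ->
  exists B, [/\ continuum B, B `<=` D, A `<=` B & forall p, p \in s -> B p].
Proof.
move=> cA AD [a Aa]; have [_ oD cD] := domD.
elim: s => [|p s ih] sD; first by exists A; split.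
have [p'|B [cB BD AB sB]] := ih; first by move=> p's; apply: sD; rewrite inE p's orbT.
have Dp : D p by apply: sD; rewrite inE eqxx.
have [C [cC CD Ca Cp]] := open_connected_reach oD cD (AD _ Aa) Dp.
exists (B `|` C); split.
- exact: continuumU (AB _ Aa) Ca.
- by move=> w [/BD|/CD].
- by move=> w /AB; left.
- by move=> w; rewrite inE => /predU1P[->|/sB]; [right|left].
Qed.

(** Finitely many sets, small and connected inside [D], cover [D]; a point is
    fixed in each of them, and the images of these points stay away from [y0].
    So every [g y] with [y] near [y0] lies on a small continuum whose image goes
    from [y] out of a fixed neighborhood of [y0].  If [g y] and [g y'] are far
    apart, so are their continua, and weak flatness is contradicted. *)
Lemma oscillation_boundary delta A y0 eps :
  (0 < n)%N -> 0 < delta -> continuum A -> A `<=` D ->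
  (forall x, boundary D x -> locally_connected_at D x) ->
  weakly_flat_boundary D' ->
  (forall x, boundary D' x ->
     nondegenerate_continuum (path_component (boundary D') x)) ->
  0 < eps -> boundary D' y0 ->
  exists2 V, open_nbhs y0 V & forall g y y', S_class delta A Q D D' g ->
    V y -> D' y -> V y' -> D' y' -> eucl_dist (g y) (g y') < eps.
Proof.
move=> n0 delta0 cA AD lcD flat nondeg eps0 by0.
have [_ oD _] := domD; have [_ oD' _] := domD'.
have [q q0 modq] := modulus_bound (D' := D') domD Q1 intQ.
have [->|/set0P A0] := eqVneq A set0.
  (* no image of the empty set has diameter at least [delta] *)
  exists setT; first by split => //; exact: openT.
  move=> g y y' [f [_ + _]]; rewrite image_set0 => diam0.
  have E0 : eucl_diam (set0 : set 'rV[R]_n) = -oo%E.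
    rewrite /eucl_diam (_ : [set _ | _ in _] = set0) ?ereal_sup0//.
    by rewrite -subset0 => x [p [p1 _] _].
  by rewrite E0 in diam0.
(* Continua within [2 * e] of [g y] and of [g y'] leave a gap of [eps / 2]. *)
pose e := eps / 8; have e0 : 0 < e by rewrite divr_gt0.
have smallN x : exists N, closure D x -> [/\ open_nbhs x N, N `<=` eucl_ball x e &
    forall a b, N a -> D a -> N b -> D b -> reach (D `&` eucl_ball x e) a b].
  have [clx|] := pselect (closure D x); last by exists setT.
  have [Dx|nDx] := pselect (D x).
    have oDe : open (D `&` eucl_ball x e).
      by apply: openI => //; exact: open_eucl_ball.
    have [r r0 rDe] := open_eucl_ballP oDe (conj Dx (eucl_ball_center x e0)).
    exists (eucl_ball x r) => _; split; first exact: open_nbhs_eucl_ball.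
      by move=> z /rDe[].
    have xr a : eucl_ball x r a -> reach (D `&` eucl_ball x e) x a.
      move=> xa; exists (segment x a); split; first exact: continuum_segment.
      - by apply: subset_trans rDe; exact: segment_eucl_ball.
      - exact: segment_left.
      - exact: segment_right.
    by move=> a b xa _ xb _; apply: reach_trans (reach_sym (xr a xa)) (xr b xb).
  have bx : boundary D x by split => // /interior_subset.
  have [V [xV Ve cV]] := lcD x bx _ (open_nbhs_eucl_ball x e0).
  exists V => _; split => // a b Va Da Vb Db.
  apply: (@reach_in _ _ (V `&` D)); first by move=> p [/Ve].
  by apply: open_connected_reach => //; apply: openI => //; exact: xV.1.
have [N NP] := choice smallN.
have pick x : exists p, closure D x -> N x p /\ D p.
  have [clx|] := pselect (closure D x); last by exists 0.
  have [xN _ _] := NP x clx; have [p [Dp Np]] := clx _ (open_nbhs_nbhs xN).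
  by exists p.
have [c cP] := choice pick.
have := kD; rewrite compact_cover => /(_ _ (closure D) N).
case=> [x clx|x clx|s sD Ds].
- by have [[]] := NP x clx.
- by exists x => //; have [[]] := NP x clx.
pose l := [seq c x | x <- finmap.enum_fset s].
have lD p : p \in l -> D p.
  by move=> /mapP[x xs ->]; apply: (cP x _).2; exact/set_mem/sD.
(* A single continuum contains [A] and the fixed points, so that one
   neighborhood of [y0] avoids the images of all of them. *)
have [B [cB BD AB lB]] := continuum_extend cA AD A0 lD.
have SB g : S_class delta A Q D D' g -> S_class delta B Q D D' g.
  move=> [f [fg diamA modf]]; exists f; split => //; apply: (le_trans diamA).
  apply: ge_ereal_sup => _ [[u v] /= [[a Aa <-] [b Ab <-]] <-].
  apply: ereal_sup_ubound; exists (f a, f b) => //=.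
  by split; [exists a => //; exact: AB|exists b => //; exact: AB].
have [U yU UB] := image_avoids_boundary_point domD domD' Q1 intQ n0 delta0 cB BD
  kD kD' flat nondeg by0.
pose d := eps / 2; have d0 : 0 < d by rewrite divr_gt0.
pose P := q * d^-1 ^+ n + 1.
have P0 : 0 < P by rewrite ltr_wpDl// mulr_ge0// exprn_ge0// invr_ge0 ltW.
have [V [yV VU flatV]] := flat y0 by0 P P0 U yU.
exists V => // g y y' Sg Vy D'y Vy' D'y'; rewrite ltNge; apply/negP => far.
have [f [fg _ _]] := Sg; have [fD gf gD' fgK] := homeo_values fg.
have long u : V u -> D' u -> exists2 E, [/\ continuum E, E `<=` D', E u,
    E `&` boundary U !=set0 & E `&` boundary V !=set0] &
    forall w, E w -> eucl_dist (g u) (g w) < 2 * e.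
  move=> Vu D'u; have Dgu := gD' u D'u.
  have [x xs Nx] := Ds (g u) (subset_closure Dgu).
  have clx : closure D x by exact/set_mem/sD.
  have [_ Ne Nreach] := NP x clx; have [Nc Dc] := cP x clx.
  have [C [cC CDe Cu Cc]] := Nreach _ _ Nx Dgu Nc Dc.
  have CD : C `<=` D by move=> p /CDe[].
  have [cE ED'] := homeo_continuum fg cC CD.
  have Eu : (f @` C) u by exists (g u) => //; exact: fgK.
  have nU : ~ U (f (c x)).
    move=> Ufc; apply: (UB g (f (c x)) (SB g Sg) Ufc (fD _ Dc)).
    by rewrite gf//; apply: lB; exact: map_f.
  have Efc : (f @` C) (f (c x)) by exists (c x).
  have meets (S : set 'rV[R]_n) : S `<=` U -> S u -> (f @` C) `&` boundary S !=set0.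
    move=> SU Su; have ES : (f @` C) `&` S !=set0 by exists u.
    have nES : ~ (f @` C `<=` S) by move=> /(_ _ Efc)/SU.
    by have [w Ew bw] := connected_boundary cE.2 ES nES; exists w.
  exists (f @` C); first by split => //; apply: meets => //; exact: VU.
  move=> _ [p Cp <-]; rewrite gf; last exact: CD.
  have [_ xp] := CDe p Cp; have xu := Ne _ Nx.
  apply: (le_lt_trans (eucl_dist_triangle x _ _)); rewrite (eucl_distC (g u)).
  by move: xp xu; rewrite /eucl_ball/=; lra.
have [E [cE ED' _ EU EV] Eg] := long y Vy D'y.
have [F [cF FD' _ FU FV] Fg] := long y' Vy' D'y'.
have := flatV E F cE cF ED' FD' EU EV FU FV; apply/negP; rewrite -leNgt.
apply: (le_trans (modq _ _ _ _ _ d Sg ED' FD' d0 _)); last by rewrite lee_fin lerDl.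
move=> w w' /Eg gw /Fg gw'.
have := eucl_dist_triangle (g w) (g y) (g y').
have := eucl_dist_triangle (g w') (g w) (g y').
rewrite (eucl_distC (g w') (g y')); move: gw gw' far; rewrite /d /e; lra.
Qed.

End Oscillation.

(** * Extension to the closure *)

Section Extension.
Context {R : realType} {n : nat}.
Implicit Types (D : set 'rV[R]_n) (g h : 'rV[R]_n -> 'rV[R]_n).

Definition oscillates_less (D' : set 'rV[R]_n) y eps (S : set ('rV[R]_n -> 'rV[R]_n)) :=
  exists2 V, open_nbhs y V & forall g w w', S g ->
    V w -> D' w -> V w' -> D' w' -> eucl_dist (g w) (g w') < eps.

Definition has_limit (D' : set 'rV[R]_n) g y l := forall eps, 0 < eps ->
  exists2 V, open_nbhs y V & forall w, V w -> D' w -> eucl_dist l (g w) < eps.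

(** Compactness provides a cluster point, which small oscillation makes a
    limit. *)
Lemma limit_exists D (D' : set 'rV[R]_n) g y S : compact (closure D) -> closure D' y ->
  (forall w, D' w -> D (g w)) -> S g ->
  (forall eps, 0 < eps -> oscillates_less D' y eps S) ->
  exists2 l, closure D l & has_limit D' g y l.
Proof.
move=> kD cly gD Sg osc.
have FP : ProperFilter (g @ within D' (nbhs y)).
  by apply: fmap_proper_filter; exact: within_nbhs_proper.
have [|l [Dl cll]] := kD (g @ within D' (nbhs y)) FP.
  by apply: (@nearW _ (nbhs y)) => w D'w; exact/subset_closure/gD.
exists l => // eps eps0; have eps2 : 0 < eps / 2 by rewrite divr_gt0.
have [V yV oscV] := osc _ eps2; exists V => // w Vw D'w.
have nW : (g @ within D' (nbhs y)) [set u | exists2 z, V z /\ D' z & u = g z].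
  by apply: filterS (open_nbhs_nbhs yV) => z Vz D'z; exists z.
have [_ [[z [Vz D'z] ->] lz]] := cll _ _ nW (open_nbhs_nbhs (open_nbhs_eucl_ball l eps2)).
apply: (le_lt_trans (eucl_dist_triangle (g z) _ _)); rewrite [ltRHS]splitr.
by apply: ltrD => //; exact: oscV.
Qed.

Lemma has_limit_unique (D' : set 'rV[R]_n) g y l : D' y -> has_limit D' g y l -> l = g y.
Proof.
move=> D'y lim; apply: eucl_dist_eq0; apply/eqP; rewrite eq_le eucl_dist_ge0 andbT.
rewrite leNgt; apply/negP => ly; have [V [_ Vy] Vl] := lim _ ly.
by have := Vl y Vy D'y; rewrite ltxx.
Qed.

Lemma extension_has_limit D (D' : set 'rV[R]_n) g h y : closure D' y ->
  extends_to_closure D D' g h -> has_limit D' g y (h y).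
Proof.
move=> cly [ch _ hg] eps eps0.
have := (within_continuousE _ _).1 ch y cly _ (near_eucl_dist (h y) eps0).
rewrite nbhsE => -[V yV Vh]; exists V => // w Vw D'w.
by rewrite -hg//; apply: Vh => //; exact: subset_closure.
Qed.

Lemma limits_oscillation (D' : set 'rV[R]_n) y eps S : oscillates_less D' y eps S ->
  exists2 V, open_nbhs y V & forall g w w' l l', S g ->
    V w -> closure D' w -> has_limit D' g w l ->
    V w' -> closure D' w' -> has_limit D' g w' l' -> eucl_dist l l' <= eps.
Proof.
move=> [V yV osc]; exists V => // g w w' l l' Sg Vw clw lw Vw' clw' lw'.
have near u m eta : V u -> closure D' u -> has_limit D' g u m -> 0 < eta ->
    exists z, [/\ V z, D' z & eucl_dist m (g z) < eta].
  move=> Vu clu lu eta0; have [W uW Wm] := lu eta eta0.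
  have [z [D'z [Vz Wz]]] : (D' `&` (V `&` W)) !=set0.
    apply: clu; apply: open_nbhs_nbhs; apply: open_nbhsI => //.
    by split => //; exact: yV.1.
  by exists z; split => //; exact: Wm.
apply/ler_addgt0Pr => eta eta0; have eta2 : 0 < eta / 2 by rewrite divr_gt0.
have [z [Vz D'z lz]] := near w l _ Vw clw lw eta2.
have [z' [Vz' D'z' lz']] := near w' l' _ Vw' clw' lw' eta2.
have := eucl_dist_triangle (g z) l l'; have := eucl_dist_triangle (g z') (g z) l'.
have := osc g z z' Sg Vz D'z Vz' D'z'; rewrite (eucl_distC (g z') l'); lra.
Qed.

End Extension.

Theorem theorem1p2 (R : realType) (n : nat) (D D' A : set 'rV[R]_n)
    (delta : R) (Q : 'rV[R]_n -> \bar R) :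
  (2 <= n)%N ->
  domain D -> domain D' ->
  0 < delta ->
  continuum A -> A `<=` D ->
  lebesgue_measurable_fun Q ->
  (forall x, D x -> (1 <= Q x)%E) -> (forall x, ~ D x -> Q x = 0%E) ->
  (forall x, boundary D x -> locally_connected_at D x) ->
  compact (closure D) -> compact (closure D') ->
  weakly_flat_boundary D' ->
  (forall x, boundary D' x ->
     nondegenerate_continuum (path_component (boundary D') x)) ->
  (lebesgue_rV R n).-integrable D Q ->
  (forall g, S_class delta A Q D D' g ->
     exists2 gbar, extends_to_closure D D' g gbar &
       gbar @` closure D' = closure D) /\
  equicontinuous_in (closure D') (S_class_closure delta A Q D D').
Proof.
move=> n2 domD domD' delta0 cA AD _ Q1 _ lcD kD kD' flat nondeg intQ.
pose S := S_class delta A Q D D'.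
have osc y : closure D' y -> forall eps, 0 < eps -> oscillates_less D' y eps S.
  move=> cly eps eps0; have [D'y|nD'y] := pselect (D' y).
    exact: (oscillation_interior domD domD' Q1 intQ kD kD').
  apply: (oscillation_boundary domD domD' Q1 intQ kD kD') => //; first exact: ltnW.
  by split => // /interior_subset.
split=> [g Sg|y cly eps eps0]; last first.
  have eps2 : 0 < eps / 2 by rewrite divr_gt0.
  have [V yV Vosc] := limits_oscillation (osc y cly _ eps2).
  have [r r0 rV] := open_eucl_ballP yV.1 yV.2.
  exists r => // h [g Sg gh] w clw yw.
  apply: (@le_lt_trans _ _ (eps / 2)); last by rewrite ltr_pdivrMr// ltr_pMr// ltr1n.
  apply: (Vosc g y w) => //; [exact: yV.2|exact: extension_has_limit gh|exact: rV|].
  exact: extension_has_limit gh.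
have [f [fg _ _]] := Sg; have [fD gf gD fgK] := homeo_values fg.
have lim y : exists l, closure D' y -> closure D l /\ has_limit D' g y l.
  have [cly|] := pselect (closure D' y); last by exists 0.
  have [l Dl yl] := limit_exists kD cly gD Sg (osc y cly).
  by exists l.
have [h hP] := choice lim.
have hg y : D' y -> h y = g y.
  move=> D'y; apply: (has_limit_unique D'y).
  by apply: (hP y _).2; exact: subset_closure.
have ch : {within closure D', continuous h}.
  apply/within_continuousE => y cly U /nbhs_eucl_dist[eps eps0 epsU].
  have eps2 : 0 < eps / 2 by rewrite divr_gt0.
  have [V yV Vosc] := limits_oscillation (osc y cly _ eps2).
  apply: filterS (open_nbhs_nbhs yV) => w Vw clw; apply: epsU.
  apply: (@le_lt_trans _ _ (eps / 2)); last by rewrite ltr_pdivrMr// ltr_pMr// ltr1n.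
  by apply: (Vosc g y w) => //; [exact: yV.2|exact: (hP y cly).2|exact: (hP w clw).2].
have hD : h @` closure D' `<=` closure D.
  by move=> _ [y cly <-]; exact: (hP y cly).1.
exists h; first by split.
apply/seteqP; split => // x clx.
(* the image is compact and contains [D] *)
have clh : closed (h @` closure D').
  apply: compact_closed; first exact: rV_hausdorff.
  exact: continuous_compact.
apply: clh; apply: closureS clx => z Dz.
by exists (f z); [exact/subset_closure/fD|rewrite hg ?gf//; exact: fD].
Qed.
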